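(* Fix $\alpha\in(0,1)$ and let $I\subset\mathbb{N}$ be such that the symmetric difference of $I$ and $\mathbb{N}\cap\bigcup_{k=1}^\infty[2^k,2^k+2^{k\alpha}]$ is finite. Write $h=\dim_{\mathrm H}F_I$, and let $P$ be any set containing exactly one point of $S(X)$ for each map $S$ of the iterated function system associated with $I$ (and contained in the union of the sets $S(X)$). Then the phase transition is $\rho:=\rho_{F_I}=\rho_P=1-\alpha/2$, and $$\dim_{\mathrm A}^\theta F_I=\begin{cases}h+\frac{\alpha\theta}{(1-\theta)(2-\alpha)}(1-h),&0\le\theta<\rho,\\ 1,&\rho\le\theta<1.\end{cases}$$
   Context: $\mathbb{N}=\{1,2,3,\dots\}$; $\dim_{\mathrm H}$ and $\overline{\dim}_{\mathrm B}$ are Hausdorff and upper box dimension. For non-empty $I\subseteq\mathbb{N}$, $$F_I=\left\{z\in(0,1)\setminus\mathbb{Q}:\ z=\cfrac{1}{b_1+\cfrac{1}{b_2+\cfrac{1}{\ddots}}},\ b_n\in I\text{ for all }n\in\mathbb{N}\right\}.$$ The iterated function system on $X=[0,1]$ associated with $I$ (whose limit set is $F_I$) is: if $1\notin I$, $\{S_b(x)=1/(b+x):b\in I\}$; if $1\in I$, $\{S_b(x)=1/(b+x):b\in I,\,b\ne1\}\cup\{S_{1b}(x)=\frac{1}{b+\frac{1}{1+x}}:b\in I\}$. For non-empty bounded $E\subset\mathbb{R}$ and $\theta\in(0,1)$, the Assouad spectrum is $\dim_{\mathrm A}^\theta E=\inf\{a:\exists C>0\ \forall x\in E\ \forall\,0<R\le1,\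 N_{R^{1/\theta}}(B(x,R)\cap E)\le CR^{a(1-1/\theta)}\}$, where $B(x,R)$ is the open ball and $N_r(\cdot)$ is the smallest number of balls of radius $r$ needed to cover a set. Conventions: $\dim_{\mathrm A}^0E=\overline{\dim}_{\mathrm B}E$, $\dim_{\mathrm A}^1E=\dim_{\mathrm{qA}}E:=\lim_{\theta\to1^-}\dim_{\mathrm A}^\theta E$. Put $\rho_E=\inf\{\theta\in[0,1]:\dim_{\mathrm A}^\theta E=\dim_{\mathrm{qA}}E\}$; the paper writes $\rho$ for the common value $\rho_P=\rho_{F}$. *)

(* Defs.v *)
From HB Require Import structures.
From mathcomp Require Import all_boot all_order all_algebra.
From mathcomp Require Import all_classical all_reals all_analysis.
Set Implicit Arguments.
Unset Strict Implicit.
Unset Printing Implicit Defensive.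
Import Order.TTheory GRing.Theory Num.Theory.
Import numFieldNormedType.Exports.
Local Open Scope classical_set_scope.
Local Open Scope ring_scope.

(* All dimensions take values in \bar R, so that the infima defining them
   never fall back on a default value. *)

Definition diam (R : realType) (U : set R) : \bar R :=
  ereal_sup [set (`|x.1 - x.2|)%:E | x in U `*` U].

(* |U|^s, with |set0|^s = 0, and |U|^0 = 1 for U nonempty (as 0 `^ 0 = 1). *)
Definition diam_pow (R : realType) (s : R) (U : set R) : \bar R :=
  if U == set0 then 0%E else poweR (diam U) s.

Definition hausdorff_premeasure (R : realType) (s delta : R) (E : set R) :
    \bar R :=
  ereal_inf [set (\sum_(0 <= i <oo) diam_pow s (U i))%E | U in
    [set U : nat -> set R | E `<=` \bigcup_i U i /\
       forall i, (diam (U i) <= delta%:E)%E]].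

Definition hausdorff_measure (R : realType) (s : R) (E : set R) : \bar R :=
  ereal_sup [set hausdorff_premeasure s delta E | delta in
    [set delta : R | 0 < delta]].

Definition hausdorff_dim (R : realType) (E : set R) : \bar R :=
  ereal_inf [set s%:E | s in
    [set s : R | 0 <= s /\ hausdorff_measure s E = 0%E]].

(* +oo when no finite cover exists; the balls are open, with centres in R. *)
Definition covering_number (R : realType) (r : R) (E : set R) : \bar R :=
  ereal_inf [set (n%:R : R)%:E | n in
    [set n : nat | exists c : 'I_n -> R, E `<=` \bigcup_i ball (c i) r]].

Definition upper_box_dim (R : realType) (E : set R) : \bar R :=
  limf_esup (fun r : R => (lne (covering_number r E) * ((- ln r)^-1)%:E)%E)
    (0 : R)^'+.

(* Meaningful for 0 < theta < 1 only; [assouad_spectrum] adds the endpoints. *)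
Definition assouad_spectrum_oo (R : realType) (theta : R) (E : set R) :
    \bar R :=
  ereal_inf [set a%:E | a in
    [set a : R | exists2 C : R, 0 < C &
       forall x r : R, E x -> 0 < r <= 1 ->
         (covering_number (r `^ theta^-1) (ball x r `&` E)
            <= (C * r `^ (a * (1 - theta^-1)))%:E)%E]].

Definition quasi_assouad_dim (R : realType) (E : set R) : \bar R :=
  lim (assouad_spectrum_oo theta E @[theta --> (1 : R)^'-]).

Definition assouad_spectrum (R : realType) (theta : R) (E : set R) : \bar R :=
  if theta == 0 then upper_box_dim E
  else if theta == 1 then quasi_assouad_dim E
  else assouad_spectrum_oo theta E.

(* The set contains 1 and is bounded below by 0, so this [inf] is genuine. *)
Definition phase_transition (R : realType) (E : set R) : R :=
  inf [set theta : R | 0 <= theta <= 1 /\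
         assouad_spectrum theta E = quasi_assouad_dim E].

(* n-th convergent of 1/(b 0 + 1/(b 1 + ...)); digits are indexed from 0. *)
Fixpoint convergent (R : realType) (b : nat -> nat) (n : nat) : R :=
  if n is m.+1 then ((b 0%N)%:R + convergent R (fun k => b k.+1) m)^-1 else 0.

Definition cf_set (R : realType) (I : set nat) : set R :=
  [set z | [/\ 0 < z < 1, irrational z &
     exists b : nat -> nat,
       (forall n, I (b n)) /\ convergent R b n @[n --> \oo] --> z]].

Definition cf_ifs (R : realType) (I : set nat) : set (R -> R) :=
  [set S | (~ I 1%N /\ exists2 b, I b & S = (fun x => (b%:R + x)^-1)) \/
     (I 1%N /\
       ((exists2 b, I b /\ b <> 1%N & S = (fun x => (b%:R + x)^-1)) \/
        (exists2 b, I b & S = (fun x => (b%:R + (1 + x)^-1)^-1))))].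

Arguments cf_set R I : clear implicits.
Arguments cf_ifs R I : clear implicits.

(* P meets each image S([0, 1]) in a single point, and lies in their union;
   neighbouring images may share an endpoint, which then counts for both. *)
Definition one_point_selection (R : realType) (F : set (R -> R)) (P : set R) :
    Prop :=
  P `<=` \bigcup_(S in F) (S @` `[0, 1]) /\
  forall S, F S -> exists! p, (P `&` S @` `[0, 1]) p.

Definition dyadic_blocks (R : realType) (alpha : R) : set nat :=
  \bigcup_(k in [set k : nat | (1 <= k)%N])
    [set n : nat | 2 ^+ k <= (n%:R : R) <= 2 ^+ k + 2 `^ (k%:R * alpha)].

(* Main.v *)
Require Import Defs.
From HB Require Import structures.
From mathcomp Require Import all_boot all_order all_algebra.
From mathcomp Require Import all_classical all_reals all_analysis.
From mathcomp Require Import ring lra zify.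
Set Implicit Arguments.
Unset Strict Implicit.
Unset Printing Implicit Defensive.
Import Order.TTheory GRing.Theory Num.Theory.
Import numFieldNormedType.Exports.
Local Open Scope classical_set_scope.
Local Open Scope ring_scope.

(* Let q_w be the denominator of the last convergent of a finite word w of digits;
   the cylinder of w has length comparable to q_w^-2, and psum k 1 0 is the sum of
   q_w^(-2s) over the words of length k.

   (1) If the s-dimensional Hausdorff measure of F vanishes, these sums are bounded
   by 2^(2s) (mass distribution along a finite cover), so for s > h the sum over all
   words of q_w^(-2s) converges and every packing number of F at scale r is O(r^-s).
   Conversely, packing numbers below r^-s for arbitrarily small r force h <= s. As
   some digit is missing, the sums stay bounded for some s < 1; as the blocks are
   full, they diverge for s < alpha/2. Hence alpha/2 <= h < 1.

   (2) In an interval of length ell, the first-level cylinders with digits in the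
   k-th block number at most min(2^(k alpha), ell 4^k), each contributing
   (r 4^k)^-s. Interpolating the minimum with exponent t = expo_t gives r^-s ell^t
   for every k at once. Cylinders cut by an endpoint of the interval are treated
   recursively: there are O(log (1/r)) levels, and at most two cut cylinders on each.

   (3) The interval containing the k-th block, of length about 2^(-k(2-alpha)),
   attains these bounds.

   Packing numbers are used throughout: they are additive, need no centres and scale
   exactly under the maps of the system. *)

(* lra and nra inspect every hypothesis, which is slow in long contexts. *)
Ltac keep_comparisons := repeat match goal with
  | H : ?T |- _ => lazymatch type of T with
      | Prop => lazymatch T with
         | is_true (@Order.le _ _ _ _) => fail
         | is_true (@Order.lt _ _ _ _) => fail
         | is_true (andb _ _) => fail
         | _ = _ => fail
         | _ => clear H end
      | _ => fail end
  end.
Tactic Notation "lra" := (keep_comparisons; lra).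
Tactic Notation "nra" := (keep_comparisons; nra).

(** * Packing numbers *)

(** A packing bound C r^(-s) ell^t, read at r = R^(1/theta) and ell = 2R, bounds the spectrum by
    (s/theta - t)/(1/theta - 1). With t = (s - alpha/2)/(1 - alpha/2) this is affine in s, tends to
    the claimed formula as s decreases to h, and equals 1 at theta = 1 - alpha/2 whatever s is. This
    is why P, for which every s in (alpha/2, 1) is admissible, has the same phase transition as F.
    The bound must survive the passage to subcylinders: magnifying by q^2 >= 1 multiplies it by
    q^(2(t-s)), which is at most 1 because t <= s. The weights q_w^(-2s) act as unnormalised masses
    in place of a conformal measure. The alphabet is infinite while sums over digits are finite:
    they run over digits up to M, either with bounds uniform in M, or with M chosen after the
    packing, which is a finite set. Powers of log(1/r) and small losses in s are harmless, since all
    dimensions are limits or infima of exponents. *)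

Section Packing.
Variable R : realType.
Implicit Types (d B : R) (E : set R) (s : seq R).

Definition spaced d s := pairwise (fun x y => d <= `|x - y|) s.

(** A bound instead of a number: no supremum has to be finite or attained, and the bounds of several
    pieces add up as reals. *)
Definition packing_le d E B :=
  forall s, spaced d s -> {in s, forall x, E x} -> (size s)%:R <= B.

Lemma spaced_uniq d s : 0 < d -> spaced d s -> uniq s.
Proof.
move=> d0; rewrite uniq_pairwise; apply: sub_pairwise => x y /=.
by apply: contraTneq => ->; rewrite subrr normr0 -ltNge.
Qed.

Lemma spaced_far d s x y : 0 < d -> spaced d s -> x \in s -> y \in s ->
  `|x - y| < d -> x = y.
Proof.
move=> d0; elim: s => //= a s IH /andP[/allP ha hs].
rewrite !inE => /orP[/eqP->|xs] /orP[/eqP->|ys] //.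
- by move: (ha _ ys) => /= h1 h2; exfalso; lra.
- by move: (ha _ xs); rewrite distrC => /= h1 h2; exfalso; lra.
- exact: IH.
Qed.

Lemma spaced_filter d s a : spaced d s -> spaced d [seq x <- s | a x].
Proof. exact/subseq_pairwise/filter_subseq. Qed.

Lemma spaced_le d d' s : d <= d' -> spaced d' s -> spaced d s.
Proof. by move=> dd'; apply: sub_pairwise => x y /=; exact: le_trans. Qed.

Lemma packing_leS d d' E E' B B' : d' <= d -> E `<=` E' -> B' <= B ->
  packing_le d' E' B' -> packing_le d E B.
Proof.
move=> dd EE BB h s hs hE; apply: le_trans BB; apply: h.
  exact: spaced_le hs.
by move=> x /hE /EE.
Qed.

Lemma packing_leU d E E1 E2 B1 B2 : E `<=` E1 `|` E2 ->
  packing_le d E1 B1 -> packing_le d E2 B2 -> packing_le d E (B1 + B2).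
Proof.
move=> EE h1 h2 s hs hE; rewrite -(count_predC (fun x => `[< E1 x >]) s) natrD.
rewrite -!size_filter; apply: lerD.
  apply: h1; first exact: spaced_filter.
  by move=> x; rewrite mem_filter => /andP[/asboolP].
apply: h2; first exact: spaced_filter.
move=> x; rewrite mem_filter => /andP[/asboolPn nx xs].
by case: (EE _ (hE _ xs)).
Qed.

Lemma packing_le_sum (T : eqType) (J : seq T) d E (F : T -> set R) (B : T -> R) :
  (forall x, E x -> exists2 b, b \in J & F b x) ->
  (forall b, b \in J -> packing_le d (F b) (B b)) ->
  packing_le d E (\sum_(b <- J) B b).
Proof.
elim: J E => [|a J IH] E hE hB.
  rewrite big_nil => -[//|x s] _ /(_ x); rewrite inE eqxx => /(_ isT) /hE[b].
  by rewrite in_nil.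
rewrite big_cons.
apply: (@packing_leU _ _ (F a) [set x | exists2 b, b \in J & F b x]).
- move=> x /hE[b]; rewrite inE => /orP[/eqP->|bJ] Fx; [by left|right].
  by exists b.
- by apply: hB; rewrite mem_head.
- by apply: IH => // b bJ; apply: hB; rewrite inE bJ orbT.
Qed.

(** Counted from the least point, each half-open cell of length [d] contains at most one point of a
    spaced sequence. *)
Lemma packing_le_diam d E l : 0 < d -> 0 <= l ->
  (forall x y, E x -> E y -> `|x - y| <= l) -> packing_le d E (l / d + 1).
Proof.
move=> d0 l0 hE s hs hsE.
have [->|sN0] := eqVneq s [::]; first by rewrite addr_ge0 ?divr_ge0// ltW.
have [m ms hm] : exists2 m, m \in s & forall x, x \in s -> m <= x.
  elim: s sN0 {hs hsE} => // a s IH _.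
  have [->|sN0] := eqVneq s [::].
    by exists a; rewrite ?mem_head// => x; rewrite inE => /eqP->.
  have [m ms hm] := IH sN0; have [am|ma] := leP a m.
    exists a; rewrite ?mem_head// => x; rewrite inE => /orP[/eqP->//|/hm].
    exact: le_trans.
  exists m; first by rewrite inE ms orbT.
  by move=> x; rewrite inE => /orP[/eqP->|/hm//]; exact: ltW.
pose f x := Num.truncn ((x - m) / d).
have f0 x : x \in s -> (f x)%:R <= (x - m) / d < (f x).+1%:R.
  by move=> xs; rewrite truncn_itv// divr_ge0 ?subr_ge0 ?hm// ltW.
have uf : uniq (map f s).
  rewrite map_inj_in_uniq; first exact: spaced_uniq hs.
  move=> x y xs ys fxy; apply: (spaced_far d0 hs) => //.
  have := f0 _ xs; have := f0 _ ys; rewrite fxy.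
  rewrite !ler_pdivlMr// !ltr_pdivrMr// -natr1 => /andP[? ?] /andP[? ?].
  by rewrite ltr_distl; apply/andP; split; lra.
have sub : {subset map f s <= iota 0 (Num.truncn (l / d)).+1}.
  move=> _ /mapP[x xs ->]; rewrite mem_iota /= add0n ltnS.
  have := f0 _ xs => /andP[h1 _].
  apply: le_truncn.
  by rewrite ler_pM2r ?invr_gt0//; apply: le_trans (hE _ _ (hsE _ xs) (hsE _ ms));
    exact: ler_norm.
have := uniq_leq_size uf sub; rewrite size_map size_iota => hsz.
apply: (@le_trans _ _ (Num.truncn (l / d)).+1%:R); first by rewrite ler_nat.
by rewrite -natr1 lerD2r truncn_le// divr_ge0// ltW.
Qed.

Lemma packing_le_image d E B (f : R -> R) (L : R) : 0 < L ->
  (forall x y, E x -> E y -> `|f x - f y| <= L * `|x - y|) ->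
  packing_le (d / L) E B -> packing_le d (f @` E) B.
Proof.
move=> L0 fL hE s hs hsE.
have /choice[g hg] : forall y, exists x, y \in s -> E x /\ f x = y.
  move=> y.
  have [ys|ys] := boolP (y \in s); last by exists 0.
  by have [x Ex fx] := hsE _ ys; exists x.
rewrite -(size_map g); apply: hE; last first.
  by move=> _ /mapP[y ys ->]; case: (hg _ ys).
rewrite /spaced pairwise_map.
have /sub_in_pairwise : {in s &, forall x y, d <= `|x - y| -> d / L <= `|g x - g y|}.
  move=> x y xs ys h; rewrite ler_pdivrMr// mulrC; apply: le_trans (fL _ _ _ _).
  - by have [_ ->] := hg _ xs; have [_ ->] := hg _ ys.
  - by case: (hg _ xs).
  - by case: (hg _ ys).
by move=> /(_ s); apply => //; apply/allP.
Qed.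

(** A spaced sequence of maximal length, which exists because [B] bounds the lengths, is a net: a
    point far from all its members would prolong it. *)
Lemma packing_le_ball_cover d E (B : R) : 0 < d -> packing_le d E B ->
  exists s : seq R, [/\ (size s)%:R <= B, {in s, forall x, E x} &
    E `<=` [set x | exists2 y, y \in s & `|y - x| < d]].
Proof.
move=> d0 hB.
pose Q n := `[< exists s, [/\ size s = n, spaced d s & {in s, forall x, E x}] >].
have Q0 : exists n, Q n by exists 0%N; apply/asboolP; exists [::].
have Qb n : Q n -> (n <= Num.truncn B)%N.
  move=> /asboolP[s [<- hs hE]].
  have := hB _ hs hE => h; rewrite truncn_ge_nat//.
  exact: le_trans h.
case: (ex_maxnP Q0 Qb) => n /asboolP[s [sn hs hE]] hmax.
exists s; split=> // [|x Ex]; first exact: hB.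
apply: contrapT => nx.
have : Q n.+1.
  apply/asboolP; exists (x :: s); split => /=; first by rewrite sn.
    rewrite hs andbT; apply/allP => y ys /=; rewrite leNgt; apply/negP => xy.
    by apply: nx; exists y => //; rewrite distrC.
  by move=> y; rewrite inE => /orP[/eqP->|/hE].
by move=> /hmax; rewrite ltnn.
Qed.

Lemma covering_number_le d E B : 0 < d -> packing_le d E B ->
  (covering_number d E <= B%:E)%E.
Proof.
move=> d0 /(packing_le_ball_cover d0)[s [sB _ hE]].
apply: (@le_trans _ _ ((size s)%:R)%:E); last by rewrite lee_fin.
apply: ereal_inf_lbound; exists (size s) => //=.
exists (fun i : 'I_(size s) => nth 0 s i) => x /hE[y ys yx].
have ys' : (index y s < size s)%N by rewrite index_mem.
by exists (Ordinal ys') => //=; rewrite /ball /= nth_index.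
Qed.

Lemma covering_number_ge d E s : spaced (2 * d) s -> {in s, forall x, E x} -> 0 < d ->
  ((size s)%:R%:E <= covering_number d E)%E.
Proof.
move=> hs hE d0; apply: le_ereal_inf_tmp => _ [n [c hc] <-]; rewrite lee_fin ler_nat.
have /choice[g hg] : forall x, exists k, x \in s ->
    exists h : (k < n)%N, `|c (Ordinal h) - x| < d.
  move=> x.
  have [xs|xs] := boolP (x \in s); last by exists 0%N.
  have [[k h] _ hx] := hc _ (hE _ xs).
  by exists k => _; exists h.
have ug : uniq (map g s).
  have d20 : 0 < 2 * d by lra.
  rewrite map_inj_in_uniq; first exact: spaced_uniq hs.
  move=> x y xs ys gxy; apply: (spaced_far d20 hs) => //.
  have [h1 k1] := hg _ xs; have [h2 k2] := hg _ ys.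
  have e : Ordinal h1 = Ordinal h2 by apply: val_inj.
  rewrite e in k1.
  move: k1 k2; rewrite !ltr_distl => /andP[? ?] /andP[? ?].
  by apply/andP; split; lra.
have sub : {subset map g s <= iota 0 n}.
  by move=> _ /mapP[x xs ->]; rewrite mem_iota; have [] := hg _ xs.
by have := uniq_leq_size ug sub; rewrite size_map size_iota.
Qed.

End Packing.

(** * Moebius maps of words *)

Lemma ler_sum_subseq (R : numDomainType) (T : eqType) (J K : seq T) (f : T -> R) :
  uniq J -> uniq K -> {subset J <= K} -> {in K, forall b, 0 <= f b} ->
  \sum_(b <- J) f b <= \sum_(b <- K) f b.
Proof.
move=> uJ uK JK f0.
have -> : \sum_(b <- J) f b = \sum_(b <- K | b \in J) f b.
  rewrite -[RHS]big_filter; apply: perm_big; apply: uniq_perm => //; first exact: filter_uniq.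
  by move=> b; rewrite mem_filter; case: (boolP (b \in J)) => //= /JK ->.
rewrite big_mkcond /= !big_seq; apply: ler_sum => b bK.
by case: ifP => // _; exact: f0.
Qed.

Section Moebius.
Variable R : realType.

(* The map x |-> (p + x p') / (q + x q') attached to a finite word of digits;
   p/q and p'/q' are its last two convergents. *)
Record mob := Mob { mp : R; mp' : R; mq : R; mq' : R }.
Implicit Types (u : mob) (b : nat) (g : R -> R).

Definition mval u x := (mp u + x * mp' u) / (mq u + x * mq' u).
Definition mroot := Mob 0 1 1 0.
Definition mchild u b :=
  Mob (b%:R * mp u + mp' u) (mp u) (b%:R * mq u + mq' u) (mq u).

(** The determinant is 1 or -1 according to the parity of the word; its square avoids tracking the
    sign. *)
Definition mvalid u :=
  [/\ 1 <= mq u, 0 <= mq' u, mq' u <= mq u & (mp' u * mq u - mp u * mq' u) ^+ 2 = 1].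

Definition mlen u := `|mval u 0 - mval u 1|.
(** For monotone [g] this is subadditive over the disjoint children of a cylinder
    ([variation_children]). With [g] a clamp it measures length inside an interval, with a step
    function it counts the endpoints that cut the cylinder, and with the identity it is [mlen]. *)
Definition variation g u := `|g (mval u 0) - g (mval u 1)|.

Lemma mvalid_root : mvalid mroot.
Proof. by split => //=; ring. Qed.

Lemma mvalid_child u b : (0 < b)%N -> mvalid u -> mvalid (mchild u b).
Proof.
rewrite -(ler_nat R) => b1 [q1 q0 qq pq]; split => /=.
- nra.
- lra.
- nra.
- by rewrite -pq; ring.
Qed.

Lemma mval_root x : mval mroot x = x.
Proof. by rewrite /mval /=; field. Qed.

Lemma mden_gt0 u x : mvalid u -> 0 <= x -> 0 < mq u + x * mq' u.
Proof. by move=> [q1 q0 _ _] x0; nra. Qed.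

Lemma mval_child u b x : mvalid u -> (0 < b)%N -> 0 <= x ->
  mval (mchild u b) x = mval u (b%:R + x)^-1.
Proof.
move=> vu b0 x0; have b1 : 1 <= b%:R :> R by rewrite ler1n.
have bx : 0 < b%:R + x by lra.
have h := mden_gt0 (mvalid_child b0 vu) x0.
have h' := mden_gt0 vu (ltW (ltac:(by rewrite invr_gt0) : 0 < (b%:R + x)^-1)).
rewrite /mval /= in h *; field.
rewrite !gt_eqF//.
by have [q1 q0 _ _] := vu; nra.
Qed.

Lemma mval_sub u x y : mvalid u -> 0 <= x -> 0 <= y ->
  mval u x - mval u y =
  (mp' u * mq u - mp u * mq' u) * (x - y) / ((mq u + x * mq' u) * (mq u + y * mq' u)).
Proof.
move=> vu x0 y0; have := mden_gt0 vu x0; have := mden_gt0 vu y0 => h h'.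
by rewrite /mval; field; rewrite !gt_eqF.
Qed.

(** On [0, 1] both denominators lie between q and 2q: this is the bounded distortion behind every
    comparison with q^(-2). *)
Lemma mval_dist u x y : mvalid u -> 0 <= x -> 0 <= y ->
  `|mval u x - mval u y| = `|x - y| / ((mq u + x * mq' u) * (mq u + y * mq' u)).
Proof.
move=> vu x0 y0; rewrite mval_sub// !normrM normfV.
have -> : `|mp' u * mq u - mp u * mq' u| = 1.
  have [_ _ _ /eqP] := vu; rewrite sqrf_eq1 => /orP[]/eqP->; last by rewrite normrN1.
  exact: normr1.
by rewrite mul1r (gtr0_norm (mulr_gt0 _ _)) ?mden_gt0.
Qed.

Lemma mval_dist_le u x y : mvalid u -> 0 <= x -> 0 <= y ->
  `|mval u x - mval u y| <= (mq u ^+ 2)^-1 * `|x - y|.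
Proof.
move=> vu x0 y0; rewrite mval_dist// mulrC ler_wpM2r//.
have [q1 q0 qq _] := vu.
have hq : 0 < mq u by lra.
rewrite lef_pV2 ?posrE ?mulr_gt0 ?mden_gt0 ?exprn_gt0//.
by rewrite expr2 ler_pM ?lerDl ?mulr_ge0// ltW.
Qed.

Lemma mval_dist_ge u x y : mvalid u -> 0 <= x <= 1 -> 0 <= y <= 1 ->
  `|x - y| <= 4 * mq u ^+ 2 * `|mval u x - mval u y|.
Proof.
move=> vu /andP[x0 x1] /andP[y0 y1]; rewrite mval_dist//.
have h := mden_gt0 vu x0; have h' := mden_gt0 vu y0.
rewrite mulrA ler_pdivlMr ?mulr_gt0// mulrC ler_wpM2r//.
have [q1 q0 qq _] := vu.
have le2 z : 0 <= z <= 1 -> mq u + z * mq' u <= 2 * mq u by move=> /andP[? ?]; nra.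
have := le2 x; have := le2 y; rewrite x0 x1 y0 y1 => /(_ isT) ? /(_ isT) ?.
by nra.
Qed.

Lemma mlenE u : mvalid u -> mlen u = (mq u * (mq u + mq' u))^-1.
Proof.
by move=> vu; rewrite /mlen mval_dist// sub0r normrN1 mul0r addr0 !mul1r.
Qed.

Lemma mlen_gt0 u : mvalid u -> 0 < mlen u.
Proof. by move=> vu; rewrite mlenE//; have [? ? ? ?] := vu; rewrite invr_gt0; nra. Qed.

Lemma mlen_le u : mvalid u -> mlen u <= 4 / (mq u + mq' u) ^+ 2.
Proof.
move=> vu; rewrite mlenE//; have [q1 q0 qq _] := vu.
rewrite ler_pdivlMr; last by nra.
by rewrite mulrC ler_pdivrMr; nra.
Qed.

Lemma mgrowth u b : (0 < b)%N -> mvalid u ->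
  3 / 2 * (mq u + mq' u) <= mq (mchild u b) + mq' (mchild u b).
Proof. by rewrite -(ler_nat R) => b1 [q1 q0 qq _] /=; nra. Qed.

(** The quantity bounds the length of cylinders k levels below u. A hypothesis that it is below r
    thus passes from a word to its children, and at k = 0 it says by [mlen_le] that the cylinder
    itself is short: this ends the inductions on depth. *)
Lemma mgrowth_bound u b k : (0 < b)%N -> mvalid u ->
  4 / ((mq (mchild u b) + mq' (mchild u b)) ^+ 2 * (9 / 4) ^+ k) <=
  4 / ((mq u + mq' u) ^+ 2 * (9 / 4) ^+ k.+1).
Proof.
move=> b0 vu; have gr := mgrowth b0 vu; have [q1 q0 _ _] := vu.
have p1 : 0 < mq u + mq' u by lra.
move: (mq u + mq' u) (mq (mchild u b) + mq' (mchild u b)) gr p1 => x y xy x0.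
have y0 : 0 < y by lra.
have p j : 0 < (9 / 4) ^+ j :> R by rewrite exprn_gt0.
have x2 : 0 < x ^+ 2 by rewrite exprn_gt0.
have y2 : 0 < y ^+ 2 by rewrite exprn_gt0.
rewrite ler_pM2l// lef_pV2 ?posrE ?(mulr_gt0 x2)// ?(mulr_gt0 y2)//.
rewrite (exprS (9 / 4)) mulrA ler_pM2r//; nra.
Qed.

Lemma mval_diam u x y : mvalid u -> 0 <= x <= 1 -> 0 <= y <= 1 ->
  `|mval u x - mval u y| <= mlen u.
Proof.
move=> vu /andP[x0 x1] /andP[y0 y1]; rewrite mlenE// mval_dist//.
have h := mden_gt0 vu x0; have h' := mden_gt0 vu y0.
have [q1 q0 qq pq] := vu.
wlog xy : x y x0 x1 y0 y1 h h' / x <= y.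
  move=> H; have [/H|/ltW/H] := leP x y; first exact.
  by rewrite distrC (mulrC (mq u + y * _)); apply.
rewrite (ler0_norm (ltac:(lra) : x - y <= 0)) opprB.
rewrite ler_pdivrMr ?mulr_gt0// ler_pdivlMl; last by rewrite mulr_gt0; lra.
by rewrite -mulrA ler_pM ?mulr_ge0//; nra.
Qed.

Lemma monotone_telescope (h : R -> R) (J : seq nat) : uniq J ->
  {in J, forall b, (0 < b)%N} ->
  {in `[0, 1] &, {homo h : x y / x <= y}} ->
  \sum_(b <- J) `|h b%:R^-1 - h (b.+1%:R)^-1| <= `|h 0 - h 1|.
Proof.
move=> uJ J0 hh; pose M := \max_(b <- J) b.
have in01 b : (0 < b)%N -> b%:R^-1 \in `[0 : R, 1].
  by move=> b0; rewrite in_itv /= invr_ge0 ler0n /= invf_le1 ?ltr0n// ler1n.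
apply: (@le_trans _ _ (\sum_(b <- index_iota 1 M.+1) `|h b%:R^-1 - h (b.+1%:R)^-1|)).
  apply: ler_sum_subseq => //; first exact: iota_uniq.
  by move=> b bJ; rewrite mem_index_iota J0//= ltnS leq_bigmax_seq.
rewrite (eq_big_nat _ _ (F2 := fun b => (- h (b.+1%:R)^-1) - (- h b%:R^-1))); last first.
  move=> b /andP[b0 _]; rewrite ger0_norm; first by rewrite opprK addrC.
  rewrite subr_ge0 hh ?in01// lef_pV2 ?posrE ?ltr0n// ler_nat//.
rewrite telescope_sumr// invr1 opprK.
rewrite distrC ger0_norm; last first.
  by rewrite subr_ge0 hh// in_itv /= ?lexx ?ler01.
rewrite addrC lerD2l lerN2 hh ?in01// in_itv /= ?lexx ?ler01//.
Qed.

Lemma variation_children g u (J : seq nat) : mvalid u -> uniq J ->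
  {in J, forall b, (0 < b)%N} -> {homo g : x y / x <= y} ->
  \sum_(b <- J) variation g (mchild u b) <= variation g u.
Proof.
move=> vu uJ J0 hg.
rewrite big_seq (eq_bigr (fun b => `|g (mval u b%:R^-1) - g (mval u (b.+1%:R)^-1)|)).
  rewrite -big_seq.
  have [_ _ _ /eqP] := vu; rewrite sqrf_eq1 => /orP[]/eqP e.
    apply: (@monotone_telescope (fun x => g (mval u x))) => // x y.
    rewrite !in_itv /= => /andP[x0 _] /andP[y0 _] xy; apply: hg.
    rewrite -subr_ge0 mval_sub// e mul1r divr_ge0 ?subr_ge0//.
    by apply: ltW; rewrite mulr_gt0 ?mden_gt0.
  (* Determinant -1: [mval u] is decreasing, so the telescoping is applied to the negated
     function. *)
  have N (x y : R) : `|- x - - y| = `|x - y| by rewrite -opprD normrN.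
  have /= := @monotone_telescope (fun x => - g (mval u x)) J uJ J0.
  under eq_bigr do rewrite N.
  rewrite N; apply => x y.
  rewrite !in_itv /= => /andP[x0 _] /andP[y0 _] xy; rewrite lerN2; apply: hg.
  rewrite -subr_ge0 mval_sub// e mulN1r opprB divr_ge0 ?subr_ge0//.
  by apply: ltW; rewrite mulr_gt0 ?mden_gt0.
move=> b bJ; rewrite /variation !mval_child ?J0//.
by rewrite addr0 natr1.
Qed.

End Moebius.

(** * Continued fractions *)

Section ContinuedFractions.
Variable R : realType.
Implicit Types (b : nat -> nat) (I : set nat) (z : R).

Lemma irrational_inv_addn (n : nat) z :
  irrational z -> irrational (n%:R + z)^-1.
Proof.
move=> iz [x _ xE]; apply: iz; exists (x^-1 - n%:R) => //.
by rewrite rmorphB /= fmorphV ratr_nat /= xE invrK addrC addKr.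
Qed.

Lemma irrational_inv_subn (n : nat) z : irrational z -> irrational (z^-1 - n%:R).
Proof.
move=> iz [x _ xE]; apply: iz; exists ((n%:R + x)^-1) => //.
by rewrite fmorphV rmorphD /= ratr_nat xE addrC subrK invrK.
Qed.

(* Euclid's algorithm: each step strictly decreases the denominator. *)
Lemma infinite_cf_irrational b (v : nat -> R) :
  (forall n, 0 < v n < 1) -> (forall n, v n = ((b n)%:R + v n.+1)^-1) ->
  forall n, irrational (v n).
Proof.
move=> v01 vE n.
suff H (q : nat) : forall m p : nat, (0 < q)%N -> v m = p%:R / q%:R -> False.
  case=> x _ xE; have /andP[v0 _] := v01 n.
  have x0 : 0 < x by rewrite -(ltr0q R) xE.
  apply: (H `|denq x|%N n `|numq x|%N); first by rewrite absz_gt0 denq_eq0.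
  rewrite -xE /ratr !natr_absz !gtr0_norm ?denq_gt0 ?numq_gt0//.
have [k] := ubnP q; elim: k q => // k IH q qk m p q0 vm.
have q0' : 0 < q%:R :> R by rewrite ltr0n.
have /andP[vm0 vm1] := v01 m.
have p0 : 0 < p%:R :> R by move: vm0; rewrite vm pmulr_lgt0// invr_gt0.
have pq : (p < q)%N by move: vm1; rewrite vm ltr_pdivrMr// mul1r ltr_nat.
have /andP[vs0 _] := v01 m.+1.
have vs : v m.+1 = (q%:R - (b m)%:R * p%:R) / p%:R.
  have := vE m; rewrite vm => /(congr1 (@GRing.inv _)); rewrite invrK invf_div => e.
  by rewrite mulrBl e mulfK ?gt_eqF// addrC addKr.
have bq : (b m * p < q)%N.
  by move: vs0; rewrite vs pmulr_lgt0 ?invr_gt0// subr_gt0 -natrM ltr_nat.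
apply: (IH p _ m.+1 (q - b m * p)%N).
- by apply: leq_trans pq _.
- by rewrite -(ltr0n R).
- by rewrite vs natrB ?natrM// ltnW.
Qed.

Lemma convergent_ge0 b n : 0 <= convergent R b n.
Proof. by elim: n b => //= n IH b; rewrite invr_ge0 addr_ge0. Qed.

Lemma convergent_le1 b n : (forall k, (0 < b k)%N) -> convergent R b n <= 1.
Proof.
case: n => //= n b0; have := convergent_ge0 (fun k => b k.+1) n.
have : 1 <= (b 0%N)%:R :> R by rewrite ler1n.
by move=> ? ?; rewrite invf_le1; lra.
Qed.

Fixpoint mword b n : mob R := if n is m.+1 then mchild (mword b m) (b m) else mroot R.

Lemma mvalid_word b n : (forall k, (0 < b k)%N) -> mvalid (mword b n).
Proof. by move=> b0; elim: n => [|n IH] /=; [exact: mvalid_root|exact: mvalid_child]. Qed.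

Lemma mword_growth b n : (forall k, (0 < b k)%N) ->
  (3 / 2) ^+ n <= mq (mword b n) + mq' (mword b n).
Proof.
move=> b0; elim: n => [|n IH]; first by rewrite /=; lra.
apply: le_trans (mgrowth (b0 n) (mvalid_word n b0)).
by rewrite exprS ler_pM2l.
Qed.

Lemma mlen_word b n : (forall k, (0 < b k)%N) -> mlen (mword b n) <= 4 / (9 / 4) ^+ n.
Proof.
move=> b0; apply: (le_trans (mlen_le (mvalid_word n b0))).
have h := mword_growth n b0.
have p0 : 0 < (3 / 2) ^+ n :> R by rewrite exprn_gt0.
rewrite ler_pM2l// lef_pV2 ?posrE ?exprn_gt0//; last exact: lt_le_trans h.
have -> : 9 / 4 = (3 / 2) ^+ 2 :> R by field.
by rewrite exprAC lerXn2r ?nnegrE// ltW//; exact: lt_le_trans h.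
Qed.

Lemma convergentD b n k : (forall j, (0 < b j)%N) ->
  convergent R b (n + k) = mval (mword b n) (convergent R (fun j => b (n + j)%N) k).
Proof.
move=> b0; elim: n k => [|n IH] k; first by rewrite mval_root add0n.
rewrite addSnnS IH /= mval_child//; last 2 first.
- exact: mvalid_word.
- exact: convergent_ge0.
congr (mval _ (_ + _)^-1); first by rewrite addn0.
by congr (convergent R _ k); apply/funext => j; rewrite addSnnS.
Qed.

Lemma mlen_small (e : R) : 0 < e -> exists n, 4 / (9 / 4) ^+ n < e.
Proof.
move=> e0; have : (4 * (4 / 9) ^+ n) @[n --> \oo] --> (4 * 0 : R).
  by apply: cvgMr; apply: cvg_expr; rewrite ger0_norm; lra.
rewrite mulr0 => /cvgr0_norm_lt /(_ _ e0)[n _ /(_ n (leqnn n))] h.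
exists n; move: h; rewrite /= ger0_norm ?mulr_ge0// ?exprn_ge0//.
by rewrite -exprVn invf_div.
Qed.

Lemma convergent_is_cvg b : (forall k, (0 < b k)%N) -> cvgn (convergent R b).
Proof.
move=> b0; apply/cauchy_cvgP/cauchy_exP => e e0.
have [n hn] := mlen_small e0.
exists (convergent R b n); exists n => //= m nm.
rewrite /ball /= -(subnKC nm) -[X in convergent R b X - _]addn0 !convergentD//.
apply: le_lt_trans hn; apply: (le_trans _ (mlen_word n b0)).
apply: mval_diam; first exact: mvalid_word.
  by rewrite convergent_ge0 convergent_le1.
by rewrite convergent_ge0 convergent_le1.
Qed.

Lemma cvg_in01 (u : nat -> R) (l : R) : (forall n, 0 <= u n <= 1) ->
  u n @[n --> \oo] --> l -> 0 <= l <= 1.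
Proof.
move=> u01 ul; apply/andP; split.
  by apply: cvgr_to_ge ul _; near=> n; case/andP: (u01 n).
by apply: cvgr_to_le ul _; near=> n; case/andP: (u01 n).
Unshelve. all: by end_near. Qed.

Lemma cvg_invD (u : nat -> R) (l : R) (n : nat) : (0 < n)%N -> 0 <= l ->
  u n @[n --> \oo] --> l -> (n%:R + u k)^-1 @[k --> \oo] --> (n%:R + l)^-1.
Proof.
move=> n0 l0 ul; apply: cvgV; last by apply: cvgD => //; exact: cvg_cst.
by rewrite gt_eqF// ltr_wpDr// ltr0n.
Qed.

Lemma cf_set_points I b : I `<=` [set n | (0 < n)%N] -> (forall n, I (b n)) ->
  exists v : nat -> R, forall n, cf_set R I (v n) /\ v n = ((b n)%:R + v n.+1)^-1.
Proof.
move=> hI Ib; have b0 n : (0 < b n)%N by apply: hI.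
pose c n := convergent R (fun k => b (n + k)%N).
have cc n : cvgn (c n) by apply: convergent_is_cvg => k.
have c01 n k : 0 <= c n k <= 1 by rewrite convergent_ge0 convergent_le1.
pose v n := limn (c n).
have v01 n : 0 <= v n <= 1 by apply: cvg_in01 (c01 n) (cc n).
have vE n : v n = ((b n)%:R + v n.+1)^-1.
  have h1 : c n k.+1 @[k --> \oo] --> v n by rewrite cvg_shiftS; exact: cc.
  have h2 : c n k.+1 @[k --> \oo] --> ((b n)%:R + v n.+1)^-1.
    have -> : (fun k => c n k.+1) = (fun k => ((b n)%:R + c n.+1 k)^-1).
      apply/funext => k; rewrite /c /= addn0; congr (_ + convergent R _ _)^-1.
      by apply/funext => j; rewrite addSnnS.
    apply: cvg_invD => //; first by case/andP: (v01 n.+1).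
  exact: cvg_unique h1 h2.
(* Limits only give closed bounds; the recursion [vE] makes them strict. *)
have vgt0 n : 0 < v n.
  rewrite vE invr_gt0 ltr_wpDr//; first by case/andP: (v01 n.+1).
  by rewrite ltr0n.
have v01' n : 0 < v n < 1.
  have b1 : 1 <= (b n)%:R :> R by rewrite ler1n.
  by have h := vgt0 n.+1; rewrite vgt0 /= vE invf_lt1; lra.
exists v => n; split => //; split => //; first exact: infinite_cf_irrational vE n.
by exists (fun k => b (n + k)%N); split => //; exact: cc.
Qed.

Lemma cf_set_tail I z : I `<=` [set n | (0 < n)%N] -> cf_set R I z ->
  exists (n : nat) (z' : R), [/\ I n, cf_set R I z' & z = (n%:R + z')^-1].
Proof.
move=> hI [/andP[z0 z1] iz [b [Ib bz]]].
have b0 n : (0 < b n)%N by apply: hI.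
exists (b 0%N), (z^-1 - (b 0%N)%:R).
have cz : convergent R (fun k => b k.+1) n @[n --> \oo] --> z^-1 - (b 0%N)%:R.
  have -> : convergent R (fun k => b k.+1) =
            (fun n => (convergent R b n.+1)^-1 - (b 0%N)%:R).
    by apply/funext => n /=; rewrite invrK addrC addKr.
  apply: cvgB; last exact: cvg_cst.
  by apply: cvgV; rewrite ?gt_eqF// (cvg_shiftS (convergent R b)).
have iz' := irrational_inv_subn (n := b 0%N) iz.
have z'01 : 0 <= z^-1 - (b 0%N)%:R <= 1.
  by apply: cvg_in01 cz => n; rewrite convergent_ge0 convergent_le1.
split => //; last by rewrite addrC subrK invrK.
split => //; last by exists (fun k => b k.+1).
have ratn (n : nat) : z^-1 - (b 0%N)%:R != n%:R.
  by apply/eqP => e; apply: iz'; rewrite e; exists n%:R; rewrite ?ratr_nat.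
by rewrite !lt_neqAle eq_sym (ratn 0%N) (ratn 1%N).
Qed.

Lemma cf_set_cons I (n : nat) z : I `<=` [set n | (0 < n)%N] -> I n ->
  cf_set R I z -> cf_set R I (n%:R + z)^-1.
Proof.
move=> hI In [/andP[z0 z1] iz [b [Ib bz]]].
have n0 : 1 <= n%:R :> R by rewrite ler1n; exact: hI.
have nz : 1 < n%:R + z by lra.
split; first by rewrite invr_gt0 invf_lt1 ?nz ?andbT; lra.
  exact: irrational_inv_addn.
exists (fun k => if k is j.+1 then b j else n); split; first by case.
rewrite -cvg_shiftS /=.
by apply: cvg_invD => //; [exact: hI|exact: ltW].
Qed.

End ContinuedFractions.

(** * Partition sums *)

Section PartitionSums.
Variable R : realType.
Variables (J : seq nat) (s : R).
Hypotheses (J0 : {in J, forall b, (0 < b)%N}) (s0 : 0 <= s).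
Implicit Types (q : R) (k m : nat).

(* Sum of the weights q_w^(-2s) over the words w obtained by appending k digits
   in J to a word whose last two denominators are q, q'. *)
Fixpoint psum k q q' : R :=
  if k is k'.+1 then \sum_(b <- J) psum k' (b%:R * q + q') q else q `^ (- (2 * s)).

Lemma psum_ge0 k q q' : 0 <= psum k q q'.
Proof. by elim: k q q' => [|k IH] q q' /=; [exact: powR_ge0|exact: sumr_ge0]. Qed.

Let ge1 b : b \in J -> 1 <= b%:R :> R.
Proof. by move=> /J0; rewrite ler1n. Qed.

Lemma le_psum k q q' r r' : 0 < q <= r -> 0 <= q' <= r' ->
  psum k r r' <= psum k q q'.
Proof.
elim: k q q' r r' => [|k IH] q q' r r' /= /andP[q0 qr] /andP[q'0 qr'].
  rewrite !powRN lef_pV2 ?posrE ?powR_gt0//; last exact: lt_le_trans qr.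
  by rewrite ge0_ler_powR ?nnegrE ?mulr_ge0 ?(ltW q0) ?(le_trans (ltW q0) qr).
rewrite !big_seq; apply: ler_sum => b bJ; have := ge1 bJ => b1.
by apply: IH; apply/andP; split; nra.
Qed.

Lemma psumM k (c : R) q q' : 0 < c -> 0 < q -> 0 <= q' ->
  psum k (c * q) (c * q') = c `^ (- (2 * s)) * psum k q q'.
Proof.
move=> c0; elim: k q q' => [|k IH] q q' q0 q'0 /=.
  by rewrite powRM// ltW.
rewrite mulr_sumr !big_seq; apply: eq_bigr => b bJ; have := ge1 bJ => b1.
rewrite -IH; last 2 first.
- by nra.
- exact: ltW.
by congr (psum k _ _); ring.
Qed.

Lemma psum_le k q q' : 0 < q -> 0 <= q' ->
  psum k q q' <= q `^ (- (2 * s)) * psum k 1 0.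
Proof.
move=> q0 q'0; rewrite -psumM// mulr1 mulr0.
by apply: le_psum; rewrite ?lexx ?q0.
Qed.

(** After raising q' to q and scaling, the factor 2^(-2s) comes from comparing the starting pairs
    (1, 1) and (2, 0): one digit b later they are (b + 1, 1) and (2b, 2). *)
Lemma psum_ge k q q' : 0 < q -> 0 <= q' <= q ->
  (2 `^ (2 * s))^-1 * q `^ (- (2 * s)) * psum k 1 0 <= psum k q q'.
Proof.
move=> q0 /andP[q'0 qq].
apply: (@le_trans _ _ (psum k q q)); last by apply: le_psum; rewrite ?q0 ?q'0 /=.
rewrite -[in leRHS](mulr1 q) psumM// -mulrA mulrCA ler_wpM2l ?powR_ge0//.
rewrite -powRN -psumM// mulr1 mulr0.
case: k => [|k] /=.
  rewrite powR1 powRN invf_le1 ?powR_gt0//.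
  by rewrite -[leLHS](powRr0 2) ler_powR ?mulr_ge0// ler1n.
rewrite !big_seq; apply: ler_sum => b bJ; have := ge1 bJ => b1.
by apply: le_psum; apply/andP; split; lra.
Qed.

Lemma psumD_ge k m q q' : 0 < q -> 0 <= q' <= q ->
  (2 `^ (2 * s))^-1 * (psum k q q' * psum m 1 0) <= psum (k + m) q q'.
Proof.
elim: k q q' => [|k IH] q q' q0 qq /=; first by rewrite mulrA; exact: psum_ge.
rewrite mulr_suml mulr_sumr !big_seq; apply: ler_sum => b bJ; have := ge1 bJ => b1.
by move/andP: qq => [? ?]; apply: IH; [nra|apply/andP; split; nra].
Qed.

Lemma psum_gt0 k q q' : J != [::] -> 0 < q -> 0 <= q' -> 0 < psum k q q'.
Proof.
move=> JN0; elim: k q q' => [|k IH] q q' q0 q'0 /=; first exact: powR_gt0.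
case: J JN0 J0 IH => // a J' _ Ja IH; rewrite big_cons ltr_pwDl//.
  have : 1 <= a%:R :> R by rewrite ler1n Ja// mem_head.
  by move=> ?; apply: IH; [nra|lra].
by apply: sumr_ge0 => b _; exact: psum_ge0.
Qed.

(* psum k 1 0 cannot decay once it has reached 2^(2s): the sequence
   2^(-2s) psum k 1 0 is supermultiplicative. *)
Lemma psum_lower_bound n : J != [::] -> (0 < n)%N -> 2 `^ (2 * s) <= psum n 1 0 ->
  exists2 c : R, 0 < c & forall k, c <= psum k 1 0.
Proof.
move=> JN0 n0 hn.
have [c c0 hc] : exists2 c : R, 0 < c & forall k, (k < n)%N -> c <= psum k 1 0.
  elim: n {n0 hn} => [|n [c c0 IH]]; first by exists 1.
  exists (Num.min c (psum n 1 0)).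
    by rewrite lt_min c0 psum_gt0.
  move=> k; rewrite ltnS leq_eqVlt => /orP[/eqP->|/IH h].
    by rewrite ge_min lexx orbT.
  by rewrite ge_min h.
exists c => // k; have [j] := ubnP k; elim: j k => // j IH k kj.
have [/hc//|nk] := ltnP k n.
apply: le_trans (IH (k - n)%N _) _; first lia.
rewrite -[in leRHS](subnKC nk).
apply: le_trans (psumD_ge n (k - n)%N _ _) => //; last by rewrite lexx ler01.
rewrite mulrA ler_peMl ?psum_ge0// ler_pdivlMl ?mulr1// powR_gt0.
Qed.

End PartitionSums.

(** * Mass distribution *)

Section MassDistribution.
Variable R : realType.
Implicit Types (J : seq nat) (u : mob R) (V : set R).

Definition meets V u := exists2 x : R, 0 <= x <= 1 & V (mval u x).

Lemma meets_child V u b : mvalid u -> (0 < b)%N -> meets V (mchild u b) -> meets V u.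
Proof.
move=> vu b0 [x /andP[x0 x1]]; rewrite mval_child// => Vx.
have b1 : 1 <= b%:R :> R by rewrite ler1n.
exists (b%:R + x)^-1 => //.
by rewrite invr_ge0 invf_le1; lra.
Qed.

Fixpoint mass J (s : R) V k u : R :=
  if k is k'.+1 then \sum_(b <- J) mass J s V k' (mchild u b)
  else if `[< meets V u >] then mq u `^ (- (2 * s)) else 0.

Lemma mass_ge0 J s V k u : 0 <= mass J s V k u.
Proof.
elim: k u => [|k IH] u /=; last exact: sumr_ge0.
by case: ifP => // _; exact: powR_ge0.
Qed.

Lemma mass_le J s V k u : mass J s V k u <= psum J s k (mq u) (mq' u).
Proof.
elim: k u => [|k IH] u /=; last by apply: ler_sum => b _; exact: IH.
by case: ifP => // _; exact: powR_ge0.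
Qed.

Lemma mass_disjoint J s V k u : {in J, forall b, (0 < b)%N} -> mvalid u ->
  ~ meets V u -> mass J s V k u = 0.
Proof.
move=> J0; elim: k u => [|k IH] u vu nu /=; first by rewrite asboolF.
rewrite big_seq big1// => b /J0 b0; apply: IH; first exact: mvalid_child.
by move=> /(meets_child vu b0).
Qed.

Lemma mass_full J s V k u : {in J, forall b, (0 < b)%N} -> mvalid u ->
  (forall x, 0 <= x <= 1 -> V (mval u x)) ->
  mass J s V k u = psum J s k (mq u) (mq' u).
Proof.
move=> J0; elim: k u => [|k IH] u vu hu /=.
  by rewrite asboolT//; exists 0; [rewrite lexx ler01|apply: hu; rewrite lexx ler01].
rewrite !big_seq; apply: eq_bigr => b /J0 b0; rewrite IH//; first exact: mvalid_child.
move=> x /andP[x0 x1]; rewrite mval_child//; apply: hu.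
have b1 : 1 <= b%:R :> R by rewrite ler1n.
by rewrite invr_ge0 invf_le1; lra.
Qed.

(* Bar induction replaces compactness of the limit set: a word is good if
   finitely many of the V i cover the limit set inside its cylinder. *)
Inductive good J (V : nat -> set R) : mob R -> Prop :=
| good_here u i : (forall x, 0 <= x <= 1 -> V i (mval u x)) -> good J V u
| good_step u : (forall b, b \in J -> good J V (mchild u b)) -> good J V u.

(** From some generation on, every descendant of a good word has its cylinder inside one of finitely
    many V i. As [J] is finite, maxima over the children give common bounds. *)
Lemma good_psum J s (V : nat -> set R) u : {in J, forall b, (0 < b)%N} -> good J V u -> mvalid u ->
  exists m n0, forall n, (n0 <= n)%N ->
    psum J s n (mq u) (mq' u) <= \sum_(i < m) mass J s (V i) n u.
Proof.
move=> J0; elim=> {}u; first move=> i hi vu.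
  exists i.+1, 0%N => n _; rewrite big_ord_recr /= mass_full//.
  by rewrite lerDr sumr_ge0// => j _; exact: mass_ge0.
move=> _ IH vu.
have /choice[f hf] : forall b, exists mn : nat * nat, b \in J ->
    forall n, (mn.2 <= n)%N -> psum J s n (mq (mchild u b)) (mq' (mchild u b)) <=
      \sum_(i < mn.1) mass J s (V i) n (mchild u b).
  move=> b; have [bJ|] := boolP (b \in J); last by exists (0, 0)%N.
  have [m [n h]] := IH b bJ (mvalid_child (J0 _ bJ) vu).
  by exists (m, n).
pose m := \max_(b <- J) (f b).1; pose n0 := \max_(b <- J) (f b).2.
exists m, n0.+1 => -[//|n]; rewrite ltnS => hn /=.
rewrite exchange_big /= !big_seq; apply: ler_sum => b bJ.
apply: le_trans (hf _ bJ n _) _.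
  by apply: leq_trans hn; exact: (@leq_bigmax_seq _ _ xpredT (fun b => (f b).2)).
have le : ((f b).1 <= m)%N by exact: (@leq_bigmax_seq _ _ xpredT (fun b => (f b).1)).
rewrite -!(big_mkord xpredT (fun i => mass J s (V i) n (mchild u b))).
rewrite [leRHS](big_cat_nat (leq0n _) le)/= lerDl sumr_ge0// => i _; exact: mass_ge0.
Qed.

(** A bad word has a bad child. Following bad children from the root yields an infinite word; its
    point lies in some open V i, which then contains a whole cylinder along the way, so that a word
    of the path is good after all. *)
Lemma good_root J I (V : nat -> set R) : {in J, forall b, I b} ->
  I `<=` [set n | (0 < n)%N] -> (forall i, open (V i)) ->
  cf_set R I `<=` \bigcup_i V i -> good J V (mroot R).
Proof.
move=> JI hI oV FV; apply: contrapT => bad0.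
have /choice[f hf] : forall u, exists b, ~ good J V u -> b \in J /\ ~ good J V (mchild u b).
  move=> u; have [gu|/asboolPn ngu] := boolP `[< good J V u >].
    by exists 0%N; move/asboolP: gu.
  apply: contrapT => nb; apply: ngu; apply: good_step => b bJ.
  by apply: contrapT => ng; apply: nb; exists b.
pose w := fix w n := if n is m.+1 then mchild (w m) (f (w m)) else mroot R.
have badw n : ~ good J V (w n) by elim: n => //= n /hf[].
pose b n := f (w n).
have wE n : w n = mword R b n by elim: n => //= n <-.
have Ib n : I (b n) by apply: JI; case: (hf _ (badw n)).
have b0 n : (0 < b n)%N by exact: hI.
have [v hv] := cf_set_points R hI Ib.
have v01 n : 0 <= v n <= 1 by have [[/andP[/ltW-> /ltW->]]] := hv n.
have vE n : v 0%N = mval (w n) (v n).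
  elim: n => [|n IH]; first by rewrite mval_root.
  have [_ e] := hv n; rewrite IH e /= mval_child//; last by case/andP: (v01 n.+1).
    by rewrite wE; exact: mvalid_word.
  exact: b0.
have [i _ Vi] := FV _ (hv 0%N).1.
have /nbhs_ballP[r /= r0 hr] : nbhs (v 0%N) (V i) by apply: open_nbhs_nbhs.
have [k hk] := mlen_small r0.
apply: (badw k); apply: (@good_here _ _ _ i) => x x01; apply: hr.
rewrite /ball /= (vE k); apply: le_lt_trans hk; rewrite wE.
apply: (le_trans _ (mlen_word R k b0)).
by apply: mval_diam => //; exact: mvalid_word.
Qed.

End MassDistribution.

(** * Mass of a ball *)

Section HausdorffMeasureZero.
Variable R : realType.
Implicit Types (J : seq nat) (u : mob R) (E : set R).

Lemma powR_invl (a s : R) : 0 <= a -> a^-1 `^ s = (a `^ s)^-1.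
Proof. by move=> a0; rewrite -powR_inv1// powRAC powR_inv1// powR_ge0. Qed.

Definition clamp (a b x : R) := Num.max a (Num.min x b).

Lemma clamp_homo a b : {homo clamp a b : x y / x <= y}.
Proof.
move=> x y xy; rewrite /clamp ge_max !le_max lexx /=; apply/orP; right.
by rewrite le_min !ge_min xy lexx orbT.
Qed.

Lemma clamp_id a b x : a <= x <= b -> clamp a b x = x.
Proof. by move=> /andP[ax xb]; rewrite /clamp min_l// max_r. Qed.

Lemma clamp_dist a b x y : a <= b -> `|clamp a b x - clamp a b y| <= b - a.
Proof.
move=> ab; have h z : a <= clamp a b z <= b.
  by rewrite /clamp le_max lexx/= ge_max ab ge_min lexx orbT.
have /andP[? ?] := h x; have /andP[? ?] := h y.
by rewrite ler_norml; apply/andP; split; lra.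
Qed.

Lemma mlen_child_ge M u b : mvalid u -> (0 < b <= M)%N ->
  ((M.+1)%:R * (M.+2)%:R)^-1 * mlen u <= mlen (mchild u b).
Proof.
move=> vu /andP[b0 bM]; have vb := mvalid_child b0 vu.
rewrite !mlenE// -invfM; have [q1 q0 qq _] := vu.
have hb : 1 <= b%:R :> R by rewrite ler1n.
have hM : b%:R <= M%:R :> R by rewrite ler_nat.
rewrite -!natr1.
have p1 : 0 < mq u by lra.
rewrite /=; move: (mq u) (mq' u) (b%:R) (M%:R) q1 q0 qq p1 hb hM => q q' x y q1 q0 qq p1 hx hy /=.
have h1 : 0 < x * q + q' by nra.
have h2 : 0 < x * q + q' + q by nra.
rewrite lef_pV2 ?posrE ?mulr_gt0//; try lra.
have h3 : x * q + q' <= (y + 1) * q by nra.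
have h4 : x * q + q' + q <= (y + 1 + 1) * (q + q') by nra.
rewrite [leRHS]mulrACA; apply: ler_pM => //; exact: ltW.
Qed.

Lemma weight_le_mlen (s : R) u : 0 <= s -> mvalid u ->
  mq u `^ (- (2 * s)) <= (2 * mlen u) `^ s.
Proof.
move=> s0 vu; have [q1 q0 qq _] := vu.
have p1 : 0 < mq u by lra.
have l0 := mlen_gt0 vu; have l1 := ltW l0.
have p2 := ltW p1; have q20 : 0 <= mq u ^+ 2 by rewrite exprn_ge0.
rewrite powRN powRrM powR_mulrn ?(ltW p1)// -powR_invl//.
rewrite ge0_ler_powR ?nnegrE ?invr_ge0 ?mulr_ge0 ?(ltW l0)//.
rewrite mlenE// -[2 in leRHS]invrK -invfM lef_pV2 ?posrE ?exprn_gt0//; first by nra.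
by rewrite mulr_gt0 ?invr_gt0 ?mulr_gt0//; lra.
Qed.

Section MassBound.
Variables (J : seq nat) (s : R) (M N : nat) (K : R) (x0 d : R).
Hypotheses (uJ : uniq J) (JM : {in J, forall b, (0 < b <= M)%N}).
Hypotheses (s01 : 0 < s <= 1) (d0 : 0 < d).
Hypothesis (hK : forall k, (k <= N)%N -> psum J s k 1 0 <= K).

Let c : R := ((M.+1)%:R * (M.+2)%:R)^-1.
Let g := clamp (x0 - 2 * d) (x0 + 2 * d).

(* Only words whose cylinder is of length just below d matter: they weigh at
   most a constant times d^(s-1) times their length, and their lengths add up. *)
Lemma mass_ball_le k u : (k <= N)%N -> mvalid u -> d <= mlen u ->
  4 / ((mq u + mq' u) ^+ 2 * (9 / 4) ^+ k) < d ->
  mass J s (ball x0 d) k u <= 2 `^ s * (c * d) `^ (s - 1) * K * variation g u.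
Proof.
have J0 : {in J, forall b, (0 < b)%N} by move=> b /JM/andP[].
have /andP[s0 s1] := s01.
have c0 : 0 < c by rewrite invr_gt0 mulr_gt0 ?ltr0n.
have K0 : 0 <= K by apply: le_trans (hK (leq0n _)); exact: psum_ge0.
elim: k u => [|k IH] u kN vu du small.
  have := mlen_le vu; rewrite expr0 mulr1 in small; lra.
apply: (@le_trans _ _ (\sum_(b <- J)
  2 `^ s * (c * d) `^ (s - 1) * K * variation g (mchild u b))); last first.
  rewrite -mulr_sumr ler_wpM2l ?mulr_ge0 ?powR_ge0//.
  by apply: variation_children => //; exact: clamp_homo.
rewrite /= !big_seq; apply: ler_sum => b bJ.
have b0 := J0 _ bJ; have vb := mvalid_child b0 vu.
have [db|db] := leP d (mlen (mchild u b)).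
  apply: IH => //; first exact: ltnW.
  exact: le_lt_trans (mgrowth_bound k b0 vu) small.
have [mb|nmb] := pselect (meets (ball x0 d) (mchild u b)); last first.
  by rewrite mass_disjoint// !mulr_ge0 ?powR_ge0 ?normr_ge0.
(* The cylinder is shorter than d and meets the ball of radius d, so it lies within distance 2d of
   the centre, where [g] is the identity. *)
have -> : variation g (mchild u b) = mlen (mchild u b).
  have [x x01 hx] := mb; rewrite /variation.
  have near y : 0 <= y <= 1 -> g (mval (mchild u b) y) = mval (mchild u b) y.
    move=> y01; apply: clamp_id; have := mval_diam vb x01 y01.
    move: hx; rewrite /ball /= ltr_distl ler_distl => /andP[? ?] /andP[? ?].
    by apply/andP; split; lra.
  by rewrite !near ?lexx ?ler01.
apply: le_trans (mass_le _ _ _ _ _) _.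
have [q1 q0 _ _] := vb.
apply: le_trans (psum_le J0 (ltW s0) k _ q0) _; first lra.
rewrite [leRHS]mulrAC ler_pM ?powR_ge0 ?psum_ge0//; last by apply: hK; exact: ltnW.
apply: le_trans (weight_le_mlen (ltW s0) vb) _.
have l0 := mlen_gt0 vb.
have l1 := ltW l0.
rewrite [leLHS]powRM// -mulrA ler_wpM2l ?powR_ge0// -mulr_powRB1 ?(ltW l0)//.
rewrite mulrC ler_wpM2r ?(ltW l0)//.
(* The parent is at least d long and the digit at most M, so the length stays above c d; as s - 1 <=
   0, this bounds its power s - 1 from above. *)
have cdl : c * d <= mlen (mchild u b).
  by apply: le_trans (mlen_child_ge vu (JM bJ)); rewrite ler_wpM2l// ltW.
have cd0 : 0 < c * d by rewrite mulr_gt0.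
rewrite -(opprB 1 s) !powRN lef_pV2 ?posrE ?powR_gt0//.
by rewrite ge0_ler_powR ?nnegrE ?subr_ge0 ?(ltW cd0).
Qed.

End MassBound.

End HausdorffMeasureZero.

(** * Hausdorff measure *)

Section Hausdorff.
Variable R : realType.
Implicit Types (E U : set R) (s : R).

Lemma diam_ge U x y : U x -> U y -> ((`|x - y|)%:E <= diam U)%E.
Proof. by move=> Ux Uy; apply: ereal_sup_ubound; exists (x, y). Qed.

Lemma diam_le U (d : R) : (forall x y, U x -> U y -> `|x - y| <= d) ->
  (diam U <= d%:E)%E.
Proof.
by move=> h; apply: ge_ereal_sup => _ [[x y] [/= Ux Uy] <-]; rewrite lee_fin h.
Qed.

Lemma diam_ge0 U : U !=set0 -> (0 <= diam U)%E.
Proof.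
by case=> x Ux; apply: le_trans (diam_ge Ux Ux); rewrite lee_fin.
Qed.

Lemma diam_pow_ge0 s U : (0 <= diam_pow s U)%E.
Proof. by rewrite /diam_pow; case: ifP => // _; exact: poweR_ge0. Qed.

Lemma hausdorff_premeasure_ge0 s (d : R) E : (0 <= hausdorff_premeasure s d E)%E.
Proof.
apply: le_ereal_inf_tmp => _ [U _ <-]; apply: nneseries_ge0 => n _ _.
exact: diam_pow_ge0.
Qed.

Lemma hausdorff_measure_eq0 s E : hausdorff_measure s E = 0%E <->
  forall (d e : R), 0 < d -> 0 < e -> (hausdorff_premeasure s d E <= e%:E)%E.
Proof.
split=> [h d e d0 e0|h].
  apply: (@le_trans _ _ 0%E); last by rewrite lee_fin ltW.
  by rewrite -h; apply: ereal_sup_ubound; exists d.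
apply/eqP; rewrite eq_le; apply/andP; split.
  apply: ge_ereal_sup => _ [d /= d0 <-].
  by apply/lee_addgt0Pr => e e0; rewrite add0e h.
apply: le_trans (hausdorff_premeasure_ge0 s 1 E) _.
by apply: ereal_sup_ubound; exists 1 => //=; rewrite ltr01.
Qed.

Lemma hausdorff_ball_cover s E (e : R) : 0 < s -> hausdorff_measure s E = 0%E ->
  0 < e -> exists (c d : nat -> R), [/\ forall i, 0 < d i,
    E `<=` \bigcup_i ball (c i) (d i) &
    forall m, \sum_(i < m) d i `^ s <= e].
Proof.
move=> s0 /hausdorff_measure_eq0 /(_ 1 (e / 4) ltr01) H e0.
have e40 : 0 < e / 4 by lra.
have : (hausdorff_premeasure s 1 E < (e / 2)%:E)%E.
  by apply: le_lt_trans (H e40) _; rewrite lte_fin; lra.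
move=> /ereal_inf_lt[_ [U [EU dU] <-] hU].
pose a i := fine (diam_pow s (U i)).
have aE i : diam_pow s (U i) = (a i)%:E.
  rewrite /a fineK// ge0_fin_numE ?diam_pow_ge0// /diam_pow.
  case: ifPn => // U0; apply: poweR_lty; apply: le_lt_trans (dU i) _.
  by rewrite ltry.
have a0 i : 0 <= a i by rewrite fine_ge0// diam_pow_ge0.
(* The extra summand makes the radius strictly larger than the diameter, so that an open ball about
   a point of U i contains U i; these summands add up to at most e/2. *)
pose d i := (a i + e / 2 / (2 ^+ i.+1)) `^ s^-1.
have p0 i : 0 < a i + e / 2 / (2 ^+ i.+1).
  by rewrite ltr_wpDl// divr_gt0 ?exprn_gt0//; lra.
have d0 i : 0 < d i by rewrite powR_gt0.
have ds i : d i `^ s = a i + e / 2 / (2 ^+ i.+1).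
  by rewrite /d -powRrM mulVf ?gt_eqF// powRr1// ltW.
have /choice[c hc] : forall i, exists x, forall y, U i y -> `|x - y| < d i.
  move=> i; have [[x Ux]|/set0P/negP/negPn/eqP U0] := pselect (U i !=set0); last first.
    by exists 0; rewrite U0.
  exists x => y Uy.
  have := diam_ge Ux Uy; have := dU i; have := aE i.
  have UN0 : U i != set0 by apply/set0P; exists x.
  have := diam_ge0 (ex_intro _ x Ux).
  rewrite /diam_pow (negbTE UN0).
  case: (diam (U i)) => [r| |] //; rewrite lee_fin => r0 aiE _.
  rewrite lee_fin => hr; apply: le_lt_trans hr _.
  rewrite poweR_EFin in aiE; case: aiE => aiE.
  rewrite ltNge; apply/negP => dr.
  have := ge0_ler_powR (ltW s0) _ _ dr.
  rewrite !nnegrE ds aiE => /(_ (ltW (d0 i)) r0).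
  have : 0 < e / 2 / (2 ^+ i.+1) by rewrite divr_gt0 ?exprn_gt0//; lra.
  lra.
exists c, d; split => // [x /EU[i _ Ux]|m]; first by exists i => //; exact: hc.
under eq_bigr do rewrite ds.
rewrite big_split /=.
have h1 : \sum_(i < m) a i <= e / 2.
  rewrite -lee_fin -sumEFin; apply: le_trans (ltW hU).
  rewrite -(big_mkord xpredT (fun i => (a i)%:E)).
  apply: le_trans (nneseries_lim_ge m _).
    by apply: lee_sum => i _; rewrite aE.
  by move=> *; exact: diam_pow_ge0.
have h2 : \sum_(i < m) e / 2 / (2 ^+ i.+1) <= e / 2.
  rewrite -mulr_sumr ler_piMr//; first lra.
  suff -> : \sum_(i < m) (2 ^+ i.+1)^-1 = 1 - (2 ^+ m)^-1 :> R.
    by have : 0 < (2 ^+ m)^-1 :> R by rewrite invr_gt0 exprn_gt0; lra.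
  elim: m {h1} => [|m IH]; first by rewrite big_ord0 expr0 invr1 subrr.
  rewrite big_ord_recr /= IH exprS; field.
  by rewrite expf_neq0.
lra.
Qed.

(** If some sum reached 2^(2s), all sums would stay above some c > 0, and quasi-multiplicativity
    would bound the sums of generations up to N by a constant times that of N. Generation N would
    then give a ball of radius d at most B d^s times its total mass, against a cover with sum of d^s
    below 1/B. *)
Lemma cf_psum_lt (I : set nat) (J : seq nat) s n : I `<=` [set k | (0 < k)%N] ->
  uniq J -> {in J, forall b, I b} -> J != [::] -> 0 < s <= 1 -> (0 < n)%N ->
  hausdorff_measure s (cf_set R I) = 0%E -> psum J s n 1 0 < 2 `^ (2 * s).
Proof.
move=> hI uJ JI JN0 s01 n0 H0; rewrite ltNge; apply/negP => hn.
have J0 : {in J, forall b, (0 < b)%N} by move=> b /JI /hI.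
have /andP[s0 s1] := s01.
have [c c0 hc] := psum_lower_bound J0 (ltW s0) JN0 n0 hn.
pose M := \max_(b <- J) b.
have JM : {in J, forall b, (0 < b <= M)%N}.
  by move=> b bJ; rewrite J0//= leq_bigmax_seq.
pose a : R := ((M.+1)%:R * (M.+2)%:R)^-1.
have a0 : 0 < a by rewrite invr_gt0 mulr_gt0 ?ltr0n.
(* The clamp has variation at most 4d; 2^s a^(s-1) comes from [mass_ball_le], and 2^(2s)/c from the
   bound [K] on the earlier sums. *)
pose B : R := 4 * 2 `^ s * a `^ (s - 1) * (2 `^ (2 * s) / c).
have B0 : 0 < B by rewrite !mulr_gt0 ?invr_gt0 ?powR_gt0.
(* Half of 1/B makes the final inequality strict; the bound 1 gives d i <= 1, so that the root
   cylinder, of length 1, is long enough for [mass_ball_le]. *)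
pose e := Num.min 1 (B^-1 / 2).
have e0 : 0 < e by rewrite lt_min ltr01 divr_gt0 ?invr_gt0.
have [x [d [d0 cov sumd]]] := hausdorff_ball_cover s0 H0 e0.
have d1 i : d i <= 1.
  rewrite leNgt; apply/negP => di1.
  have := sumd i.+1; rewrite big_ord_recr /= => h.
  have : 1 < d i `^ s.
    have := gt0_ltr_powR s0 _ _ di1.
    by rewrite powR1 !nnegrE ler01 (ltW (d0 i)); apply.
  have : 0 <= \sum_(j < i) d j `^ s by apply: sumr_ge0 => j _; exact: powR_ge0.
  have : e <= 1 by rewrite ge_min lexx.
  lra.
have oV i : open (ball (x i) (d i)) by exact: ball_open.
have g := good_root JI hI oV cov.
have [m [n1 hm]] := good_psum s J0 g (mvalid_root R).
have [r r0 hr] : exists2 r, 0 < r & forall i, (i < m)%N -> r <= d i.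
  elim: m {hm} => [|m [r r0 IH]]; first by exists 1.
  exists (Num.min r (d m)); first by rewrite lt_min r0 d0.
  move=> i; rewrite ltnS leq_eqVlt => /orP[/eqP->|/IH h].
    by rewrite ge_min lexx orbT.
  by rewrite ge_min h.
have [n2 hn2] := mlen_small r0.
pose N := maxn n1 n2.
have := hm N (leq_maxl _ _).
apply/negP; rewrite -ltNge /=.
have zN0 : 0 < psum J s N 1 0 by exact: psum_gt0.
pose K := 2 `^ (2 * s) / c * psum J s N 1 0.
have hK k : (k <= N)%N -> psum J s k 1 0 <= K.
  move=> kN; rewrite /K mulrAC ler_pdivlMr//.
  apply: (@le_trans _ _ (psum J s k 1 0 * psum J s (N - k) 1 0)).
    by rewrite ler_wpM2l ?hc//; exact: psum_ge0.
  rewrite -ler_pdivrMl ?powR_gt0// -[X in _ <= psum _ _ X _ _](subnKC kN).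
  by apply: psumD_ge; rewrite ?(ltW s0) ?lexx ?ler01.
apply: (@le_lt_trans _ _ (\sum_(i < m) B * psum J s N 1 0 * d i `^ s)).
  apply: ler_sum => i _.
  have vr := mvalid_root R.
  have lr : mlen (mroot R) = 1 by rewrite mlenE//= addr0 mul1r invr1.
  apply: (le_trans (mass_ball_le (x i) uJ JM s01 (d0 i) hK (leqnn N) vr _ _)).
  - by rewrite lr.
  - apply: lt_le_trans (hr _ (ltn_ord i)); apply: le_lt_trans hn2.
    rewrite /= addr0 expr1n mul1r ler_pM2l// lef_pV2 ?posrE ?exprn_gt0//.
    by rewrite ler_weXn2l ?leq_maxr//; lra.
  have v4 : variation (clamp (x i - 2 * d i) (x i + 2 * d i)) (mroot R) <= 4 * d i.
    have di0 := d0 i.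
    by apply: le_trans (clamp_dist _ _ _) _; lra.
  apply: le_trans (ler_wpM2l _ v4) _.
    rewrite !mulr_ge0 ?powR_ge0 ?invr_ge0 ?(ltW c0)//; exact: psum_ge0.
  rewrite powRM ?(ltW a0) ?(ltW (d0 i))// -[d i `^ s]mulr_powRB1 ?(ltW (d0 i))//.
  by rewrite /B /K le_eqVlt; apply/orP; left; apply/eqP; ring.
rewrite -mulr_sumr mulrAC gtr_pMl// -ltr_pdivlMl// mulr1.
apply: le_lt_trans (sumd m) _; apply: (@le_lt_trans _ _ (B^-1 / 2)).
  by rewrite ge_min lexx orbT.
have Bi : 0 < B^-1 by rewrite invr_gt0.
lra.
Qed.

Lemma hausdorff_dim_le (s s' : R) E : 0 <= s -> s < s' ->
  (forall r0 : R, 0 < r0 -> exists (r : R) (l : seq R), [/\ 0 < r < r0,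
     E `<=` [set x | exists2 y, y \in l & `|y - x| < r] &
     (size l)%:R <= r `^ (- s)]) ->
  (hausdorff_dim E <= s'%:E)%E.
Proof.
move=> s0 ss' H; apply: ereal_inf_lbound; exists s' => //; split.
  by apply: ltW; apply: le_lt_trans ss'.
apply/hausdorff_measure_eq0 => d e d0 e0.
(* At most r^(-s) balls contribute at most (2r)^(s') each; the second bound makes the total 2^(s')
   r^(s'-s) at most e. *)
pose r1 := Num.min (d / 2) ((e / 2 `^ s') `^ (s' - s)^-1).
have [|r [l [/andP[r0 rr1] cov sz]]] := H r1.
  by rewrite lt_min !(powR_gt0, divr_gt0)// powR_gt0.
move: rr1; rewrite lt_min => /andP[rd re].
pose U i := if (i < size l)%N then ball (nth 0 l i) r else set0.
have dU i : (diam (U i) <= (2 * r)%:E)%E.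
  apply: diam_le => x y; rewrite /U; case: ifP => // _.
  rewrite /ball /= !ltr_distl => /andP[? ?] /andP[? ?].
  by rewrite ler_distl; apply/andP; split; lra.
apply: (@le_trans _ _ (\sum_(0 <= i <oo) diam_pow s' (U i))%E).
  apply: ereal_inf_lbound; exists U => //; split=> [x /cov[y yl yx]|i]; last first.
    by apply: le_trans (dU i) _; rewrite lee_fin; lra.
  exists (index y l) => //; rewrite /U index_mem yl /ball /=.
  by rewrite nth_index.
rewrite (nneseries_split 0 (size l)); last by move=> *; exact: diam_pow_ge0.
rewrite add0n eseries0 ?adde0; last first.
  by move=> i li _; rewrite /U ltnNge li /= /diam_pow eqxx.
apply: (@le_trans _ _ (\sum_(0 <= i < size l) ((2 * r) `^ s')%:E)%E).
  apply: lee_sum => i _; rewrite /diam_pow; case: ifPn => [_|U0].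
    by rewrite lee_fin powR_ge0.
  have U0' : U i !=set0 by apply/set0P.
  have := dU i; have := diam_ge0 U0'.
  case: (diam (U i)) => [z| |]//; rewrite !lee_fin => z0 zr.
    rewrite ge0_ler_powR ?nnegrE//; first by lra.
  by lra.
rewrite sumEFin big_const_nat subn0 iter_addr addr0 lee_fin.
rewrite -[leLHS]mulr_natr powRM ?(ltW r0)//.
apply: (@le_trans _ _ (2 `^ s' * r `^ s' * r `^ (- s))).
  by rewrite ler_wpM2l// mulr_ge0 ?powR_ge0.
rewrite -mulrA -powRD ?(gt_eqF r0) ?implybT// mulrC -ler_pdivlMr ?powR_gt0//.
have ss0 : 0 < s' - s by lra.
apply: le_trans (ge0_ler_powR (ltW ss0) _ _ (ltW re)) _.
- by rewrite nnegrE ltW.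
- by rewrite nnegrE powR_ge0.
by rewrite -powRrM mulVf ?gt_eqF// powRr1// divr_ge0 ?powR_ge0// ltW.
Qed.

End Hausdorff.

(** * Convergence of the partition sums *)

Section Summability.
Variable R : realType.
Implicit Types (I : set nat) (J : seq nat) (s : R) (u : mob R).

Lemma geometric_small (x e : R) : 0 <= x < 1 -> 0 < e -> exists n, forall k, (n <= k)%N -> x ^+ k < e.
Proof.
move=> /andP[x0 x1] e0; have : x ^+ n @[n --> \oo] --> (0 : R).
  by apply: cvg_expr; rewrite ger0_norm.
move=> /cvgr0_norm_lt /(_ _ e0)[n _ h]; exists n => k /h /=.
by rewrite ger0_norm// exprn_ge0.
Qed.

Lemma powR_lt1 (x a : R) : 1 < x -> a < 0 -> 0 < x `^ a < 1.
Proof.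
move=> x1 a0; have x0 : 0 < x by lra.
rewrite powR_gt0//= -[a]opprK powRN invf_lt1 ?powR_gt0//.
have := @gt0_ltr_powR _ (- a) _ 1 x.
by rewrite powR1 !nnegrE (ltW x0) ler01 oppr_gt0 => ->.
Qed.

Lemma powR_natM (x a : R) (k : nat) : x `^ (k%:R * a) = (x `^ a) ^+ k.
Proof. by rewrite mulrC powRrM powR_mulrn// powR_ge0. Qed.

Lemma exponent_le (c C a b : R) (k0 : nat) : 0 < c ->
  (forall k, (k0 <= k)%N -> c * 2 `^ (k%:R * a) <= C * 2 `^ (k%:R * b)) -> a <= b.
Proof.
move=> c0 H; rewrite leNgt; apply/negP => ba.
have C0 : 0 < C.
  have := H k0 (leqnn _); have p1 := powR_gt0 (k0%:R * a) (ltr0n R 2).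
  have p2 := powR_gt0 (k0%:R * b) (ltr0n R 2) => h.
  by rewrite -(pmulr_lgt0 _ p2); apply: lt_le_trans h; rewrite mulr_gt0.
have /andP[x0 x1] : 0 < (2 : R) `^ (b - a) < 1 by apply: powR_lt1; lra.
have [|n hn] := @geometric_small (2 `^ (b - a)) (c / C) _ (divr_gt0 c0 C0).
  by rewrite (ltW x0).
have := H _ (leq_maxl k0 n); rewrite leNgt => /negP; apply.
have := hn _ (leq_maxr k0 n); move: (maxn k0 n) => k.
rewrite -powR_natM ltr_pdivlMr// mulrBr powRB; last by rewrite pnatr_eq0 implybT.
by rewrite mulrAC ltr_pdivrMr ?powR_gt0// mulrC.
Qed.

Lemma geometric_sum_le (x : R) n : 0 <= x < 1 -> \sum_(k < n) x ^+ k <= (1 - x)^-1.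
Proof.
move=> /andP[x0 x1]; rewrite -[leRHS]mul1r ler_pdivlMr ?subr_gt0//.
suff -> : (\sum_(k < n) x ^+ k) * (1 - x) = 1 - x ^+ n.
  by rewrite gerBl exprn_ge0.
elim: n => [|n IH]; first by rewrite big_ord0 expr0 subrr mul0r.
by rewrite big_ord_recr /= mulrDl IH exprS; ring.
Qed.

Lemma hausdorff_measure_mono (E : set R) (s s' : R) : 0 <= s <= s' ->
  hausdorff_measure s E = 0%E -> hausdorff_measure s' E = 0%E.
Proof.
move=> /andP[s0 ss'] /hausdorff_measure_eq0 H; apply/hausdorff_measure_eq0 => d e d0 e0.
apply: le_trans (H (Num.min d 1) e _ e0); last by rewrite lt_min d0 ltr01.
apply: le_ereal_inf_tmp => _ [U [EU dU] <-].
apply: (@le_trans _ _ (\sum_(0 <= i <oo) diam_pow s' (U i))%E).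
  apply: ereal_inf_lbound; exists U => //; split => // i.
  by apply: le_trans (dU i) _; rewrite lee_fin ge_min lexx.
apply: lee_nneseries => [*|i *]; first exact: diam_pow_ge0.
rewrite /diam_pow; case: ifPn => // U0.
have U0' : U i !=set0 by apply/set0P.
have := dU i; have := diam_ge0 U0'.
case: (diam (U i)) => [z| |]//; rewrite !lee_fin => z0; rewrite le_min => /andP[_ z1].
move: z0; rewrite le_eqVlt => /orP[/eqP<-|z0]; last first.
  by rewrite ger_powR// z0.
(* Diameter 0: with the convention 0^0 = 1, the power s' is 0 unless s' = 0, and then s = 0 as
   well. *)
rewrite /powR eqxx ler_nat.
case: (eqVneq s' 0) => //= s'0; have -> : s = 0 by lra.
by rewrite eqxx.
Qed.

Definition digits I M := [seq b <- iota 1 M | `[< I b >]].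

Lemma digits_uniq I M : uniq (digits I M).
Proof. by rewrite filter_uniq// iota_uniq. Qed.

Lemma mem_digits I M b : (b \in digits I M) = `[< I b >] && (0 < b <= M)%N.
Proof. by rewrite mem_filter mem_iota add1n ltnS. Qed.

Lemma digits_gt0 I M : {in digits I M, forall b, (0 < b)%N}.
Proof. by move=> b; rewrite mem_digits => /and3P[]. Qed.

Lemma digits_sub I M : {in digits I M, forall b, I b}.
Proof. by move=> b; rewrite mem_digits => /and3P[/asboolP]. Qed.

(** Convergence of the sum of q_w^(-2s) over all words, stated through truncations of the alphabet
    and of the length. *)
Definition psum_bounded I s := exists Y : R, forall M n,
  \sum_(k < n) psum (digits I M) s k 1 0 <= Y.

Lemma psum_bounded_geometric I s (C x : R) : 0 <= C -> 0 <= x < 1 ->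
  (forall M k, psum (digits I M) s k 1 0 <= C * x ^+ k) -> psum_bounded I s.
Proof.
move=> C0 x01 h; exists (C * (1 - x)^-1) => M n.
apply: (@le_trans _ _ (\sum_(k < n) C * x ^+ k)); first by apply: ler_sum.
by rewrite -mulr_sumr ler_wpM2l// geometric_sum_le.
Qed.

(** The last denominator of a word of length k is at least half the sum of the last two, hence at
    least (q + q')/2 (3/2)^k; raising the exponent therefore gains a geometric factor. *)
Lemma psum_exponent J s0 s k (q q' : R) : {in J, forall b, (0 < b)%N} ->
  s0 <= s -> 0 < q -> 0 <= q' <= q ->
  psum J s k q q' <=
    ((q + q') / 2 * (3 / 2) ^+ k) `^ (- (2 * (s - s0))) * psum J s0 k q q'.
Proof.
move=> J0 ss; elim: k q q' => [|k IH] q q' q0 /andP[q'0 qq] /=.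
  rewrite expr0 mulr1.
  have -> : - (2 * s) = - (2 * (s - s0)) + - (2 * s0) by ring.
  rewrite powRD; last by rewrite (gt_eqF q0) implybT.
  rewrite ler_wpM2r ?powR_ge0// !powRN lef_pV2 ?posrE ?powR_gt0//; last by lra.
  by rewrite ge0_ler_powR ?nnegrE; lra.
rewrite mulr_sumr !big_seq; apply: ler_sum => b bJ.
have b1 : 1 <= b%:R :> R by rewrite ler1n J0.
apply: le_trans (IH _ _ _ _) _; [nra|apply/andP; split; nra|].
rewrite ler_wpM2r ?psum_ge0// !powRN.
have p0 : 0 < (3 / 2) ^+ k :> R by rewrite exprn_gt0.
have h1 : 0 < (q + q') / 2 * (3 / 2) ^+ k.+1 by rewrite mulr_gt0 ?exprn_gt0; lra.
have h2 : (q + q') / 2 * (3 / 2) ^+ k.+1 <= (b%:R * q + q' + q) / 2 * (3 / 2) ^+ k.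
  by rewrite exprS mulrA ler_pM2r//; nra.
have h3 := lt_le_trans h1 h2.
rewrite lef_pV2 ?posrE ?powR_gt0// ge0_ler_powR ?nnegrE ?(ltW h1) ?(ltW h3)//.
by lra.
Qed.

Lemma psum_bounded_of_le I s0 s (C : R) : s0 < s ->
  (forall M k, psum (digits I M) s0 k 1 0 <= C) -> psum_bounded I s.
Proof.
move=> ss hC.
have C0 : 0 <= C by apply: le_trans (hC 0%N 0%N); exact: psum_ge0.
have /andP[x0 x1] : 0 < (3 / 2 : R) `^ (- (2 * (s - s0))) < 1 by apply: powR_lt1; lra.
apply: (@psum_bounded_geometric _ _ (2^-1 `^ (- (2 * (s - s0))) * C) ((3 / 2) `^ (- (2 * (s - s0))))).
- by rewrite mulr_ge0 ?powR_ge0.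
- by rewrite (ltW x0).
move=> M k; apply: le_trans (psum_exponent k (@digits_gt0 I M) (ltW ss) ltr01 _) _.
  by rewrite lexx ler01.
rewrite addr0 mul1r powRM ?exprn_ge0//.
have -> : ((3 / 2) ^+ k) `^ (- (2 * (s - s0))) = (3 / 2 : R) `^ (- (2 * (s - s0))) ^+ k.
  by rewrite -powR_natM powRrM powR_mulrn.
by rewrite [leLHS]mulrAC ler_wpM2r ?exprn_ge0 ?(ltW x0)// ler_wpM2l ?powR_ge0.
Qed.

(** Between the dimension and s, the exponent [s2] still has measure zero, which bounds each level
    sum; the gain from [s2] to s then makes the level sums decay geometrically. *)
Lemma psum_bounded_hausdorff I s : I `<=` [set n | (0 < n)%N] -> s <= 1 ->
  (hausdorff_dim (cf_set R I) < s%:E)%E -> psum_bounded I s.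
Proof.
move=> hI s1 /ereal_inf_lt[_ [s0 [s00 H0] <-]]; rewrite lte_fin => ss.
pose s2 := (s0 + s) / 2.
have H2 : hausdorff_measure s2 (cf_set R I) = 0%E.
  by apply: hausdorff_measure_mono H0; rewrite s00 /s2/=; lra.
apply: (@psum_bounded_of_le _ s2 _ (2 `^ (2 * s2))); first by rewrite /s2; lra.
move=> M [|k].
  rewrite /= powR1 -[leLHS](powRr0 2) ler_powR ?ler1n//.
  by rewrite /s2; lra.
have [->|D0] := eqVneq (digits I M) [::].
  by rewrite /= big_nil powR_ge0.
apply/ltW/(cf_psum_lt hI) => //.
- exact: digits_uniq.
- exact: digits_sub.
- by rewrite /s2; apply/andP; split; lra.
Qed.

End Summability.

(** * Convergent partition sums for some exponent below one *)

Section DimensionBelowOne.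
Variable R : realType.
Implicit Types (I : set nat) (J : seq nat) (s : R) (u : mob R).

Lemma powR_le_affine (x s : R) : 0 <= x -> 0 < s < 1 -> x `^ s <= s * x + (1 - s).
Proof.
move=> x0 /andP[s0 s1].
have := @conjugate_powR _ (x `^ s) 1 s^-1 (1 - s)^-1 (powR_ge0 _ _) ler01.
rewrite !invrK mulr1 powR1 -powRrM mulfV ?gt_eqF// powRr1// mul1r mulrC.
by apply; rewrite ?invr_gt0//; lra.
Qed.

(** The tails of the sum of b^(-3/2) are bounded by telescoping b^(-1/2). *)
Lemma inv_mul_sqrt_telescope (b : nat) : (0 < b)%N ->
  (b.+1%:R * Num.sqrt b.+1%:R)^-1 <= 2 * ((Num.sqrt b%:R)^-1 - (Num.sqrt b.+1%:R)^-1) :> R.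
Proof.
move=> b0; set x := Num.sqrt b%:R; set y := Num.sqrt b.+1%:R.
have x0 : 0 < x by rewrite sqrtr_gt0 ltr0n.
have y0 : 0 < y by rewrite sqrtr_gt0 ltr0n.
have ye : b.+1%:R = y ^+ 2 by rewrite sqr_sqrtr.
have xe : b%:R = x ^+ 2 by rewrite sqr_sqrtr.
have xy : x <= y by rewrite ler_sqrt// ler_nat.
have e : y ^+ 2 = x ^+ 2 + 1 by rewrite -xe -ye natr1.
have -> : x^-1 - y^-1 = (x * y * (x + y))^-1.
  have s0 : 0 < x + y by lra.
  rewrite -[RHS]mul1r; have <- : (y - x) * (x + y) = 1.
    by rewrite (_ : (y - x) * (x + y) = y ^+ 2 - x ^+ 2); [lra|ring].
  by field; rewrite !gt_eqF.
rewrite ye -[2]invrK -invfM lef_pV2 ?posrE ?mulr_gt0 ?invr_gt0 ?exprn_gt0//; last by lra.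
rewrite mulrC ler_pdivrMr//.
have : x * y <= y * y by rewrite ler_wpM2r// ltW.
have : 0 < x * y by rewrite mulr_gt0.
by nra.
Qed.

Lemma sum_inv_mul_sqrt_le T M : (0 < T)%N ->
  \sum_(T.+1 <= b < M) (b%:R * Num.sqrt b%:R)^-1 <= 2 / Num.sqrt T%:R :> R.
Proof.
move=> T0; have [MT|TM] := leqP M T.+1.
  by rewrite big_geq// mulr_ge0 ?invr_ge0 ?sqrtr_ge0.
case: M TM => // M; rewrite ltnS => TM.
rewrite big_add1 /=.
apply: (@le_trans _ _ (\sum_(T <= b < M) ((- (2 / Num.sqrt b.+1%:R)) - (- (2 / Num.sqrt b%:R))))).
  rewrite !big_nat; apply: ler_sum => b /andP[Tb _].
  apply: le_trans (inv_mul_sqrt_telescope (leq_trans T0 Tb)) _.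
  by rewrite opprK mulrBr addrC.
rewrite telescope_sumr; last exact: ltnW.
by rewrite opprK gerDr oppr_le0 mulr_ge0 ?invr_ge0 ?sqrtr_ge0.
Qed.

(** The cylinder of the missing digit d leaves a gap whose proportion is bounded below independently
    of u. *)
Lemma sum_mlen_children_le J d u : uniq J -> {in J, forall b, (0 < b)%N} ->
  (0 < d)%N -> d \notin J -> mvalid u ->
  \sum_(b <- J) mlen (mchild u b) <= (1 - (d.+1%:R * d.+2%:R)^-1) * mlen u.
Proof.
move=> uJ J0 d0 dJ vu.
have h1 : \sum_(b <- d :: J) mlen (mchild u b) <= mlen u.
  apply: (@variation_children R id) => //; first by rewrite /= dJ.
  by move=> b; rewrite inE => /orP[/eqP->//|/J0].
have h2 : (d.+1%:R * d.+2%:R)^-1 * mlen u <= mlen (mchild u d).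
  by apply: mlen_child_ge => //; rewrite d0 leqnn.
rewrite mulrBl mul1r lerBrDr addrC; apply: le_trans h1.
by rewrite big_cons lerD2r.
Qed.

Lemma mlen_child_le_sq u b : mvalid u -> (0 < b)%N ->
  mlen (mchild u b) / mlen u <= 2 / b%:R ^+ 2.
Proof.
move=> vu b0; have vb := mvalid_child b0 vu.
have l0 := mlen_gt0 vu; rewrite ler_pdivrMr// !mlenE//.
have [q1 q0 qq _] := vu.
have b1 : 1 <= b%:R :> R by rewrite ler1n.
rewrite /=; move: (mq u) (mq' u) (b%:R) q1 q0 qq b1 => q q' x q1 q0 qq b1.
rewrite mulrAC -mulrA -invfM -[2]invrK -invfM.
have x0 : 0 < x by lra.
have p1 : 0 < q by lra.
have p0 : 0 < q + q' by lra.
have p2 : 0 < q * (q + q') by nra.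
have p3 : 0 < x * q + q' by nra.
have p4 : 0 < x * q + q' + q by nra.
rewrite lef_pV2 ?posrE ?mulr_gt0 ?invr_gt0 ?exprn_gt0//.
rewrite mulrC ler_pdivrMr//.
have h1 : x * q <= x * q + q' by lra.
have h2 : x * q <= x * q + q' + q by lra.
have h3 : (x * q) * (x * q) <= (x * q + q') * (x * q + q' + q).
  by apply: ler_pM => //; nra.
have h4 : q * (q + q') <= 2 * (q * q) by nra.
have h5 : q * (q + q') * x ^+ 2 <= 2 * (q * q) * x ^+ 2 by rewrite ler_wpM2r ?sqr_ge0.
nra.
Qed.

(** For digits up to T, concavity costs 1 - s each: x^s <= x + (1 - s). Beyond T the ratio is at
    most 2/b^2, so its power s >= 3/4 is at most 2 b^(-3/2), with tail 4/sqrt T. *)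
Lemma sum_powR_ratio_le J d u s T : uniq J -> {in J, forall b, (0 < b)%N} ->
  (0 < d)%N -> d \notin J -> mvalid u -> 3 / 4 <= s < 1 -> (0 < T)%N ->
  \sum_(b <- J) (mlen (mchild u b) / mlen u) `^ s <=
   1 - (d.+1%:R * d.+2%:R)^-1 + T%:R * (1 - s) + 4 / Num.sqrt T%:R.
Proof.
move=> uJ J0 d0 dJ vu /andP[s34 s1] T0.
have l0 := mlen_gt0 vu.
pose phi b : R := if (b <= T)%N then 1 - s else 2 * (b%:R * Num.sqrt b%:R)^-1.
have phi0 b : 0 <= phi b.
  by rewrite /phi; case: ifP => _; [lra|rewrite mulr_ge0 ?invr_ge0 ?mulr_ge0 ?sqrtr_ge0].
have hb b : b \in J -> (mlen (mchild u b) / mlen u) `^ s <= mlen (mchild u b) / mlen u + phi b.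
  move=> bJ; have b0 := J0 _ bJ; have lb := mlen_gt0 (mvalid_child b0 vu).
  have r0 : 0 < mlen (mchild u b) / mlen u by rewrite divr_gt0.
  rewrite /phi; case: ifPn => bT.
    apply: le_trans (powR_le_affine (ltW r0) _) _; first by apply/andP; split; lra.
    by rewrite lerD2r ler_piMl ?(ltW r0)// ltW.
  rewrite -ltnNge in bT.
  have b2 : 2 <= b%:R :> R by rewrite ler_nat; apply: leq_ltn_trans bT.
  have rb := mlen_child_le_sq vu b0.
  have r1 : mlen (mchild u b) / mlen u <= 1.
    apply: le_trans rb _; rewrite ler_pdivrMr ?exprn_gt0//; nra.
  apply: (@le_trans _ _ (2 * (b%:R * Num.sqrt b%:R)^-1)); last by rewrite lerDr ltW.
  apply: (@le_trans _ _ ((mlen (mchild u b) / mlen u) `^ (3 / 4))).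
    by apply: ger_powR => //; rewrite r0.
  apply: le_trans (ge0_ler_powR _ _ _ rb) _; first by lra.
  - by rewrite nnegrE ltW.
  - by rewrite nnegrE divr_ge0 ?exprn_ge0.
  rewrite powRM ?invr_ge0 ?exprn_ge0//.
  apply: ler_pM; rewrite ?powR_ge0//; first by apply: ler1_powR; lra.
  rewrite powR_invl ?exprn_ge0// -powR_mulrn// -powRrM.
  have -> : 2%:R * (3 / 4) = 1 + 2^-1 :> R by field.
  rewrite powRD ?powRr1 ?powR12_sqrt//.
  by rewrite pnatr_eq0 -lt0n b0 implybT.
apply: (@le_trans _ _ (\sum_(b <- J) (mlen (mchild u b) / mlen u) + \sum_(b <- J) phi b)).
  by rewrite -big_split /= !big_seq; apply: ler_sum => b; exact: hb.
rewrite -addrA; apply: lerD.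
  by rewrite -mulr_suml ler_pdivrMr//; exact: sum_mlen_children_le.
pose M := maxn T (\max_(b <- J) b).
apply: (@le_trans _ _ (\sum_(1 <= b < M.+1) phi b)).
  apply: ler_sum_subseq => //; first exact: iota_uniq.
  move=> b bJ; rewrite mem_index_iota J0//= ltnS /M leq_max; apply/orP; right.
  by rewrite leq_bigmax_seq.
rewrite (@big_cat_nat _ _ _ T.+1)//=; last by rewrite ltnS leq_maxl.
apply: lerD.
  rewrite big_nat (eq_bigr (fun=> 1 - s)); last first.
    by move=> b /andP[_]; rewrite ltnS /phi => ->.
  by rewrite -big_nat big_const_nat subn1 /= iter_addr addr0 mulr_natl.
rewrite big_nat (eq_bigr (fun b => 2 * (b%:R * Num.sqrt b%:R)^-1)); last first.
  by move=> b /andP[]; rewrite /phi ltnNge => /negbTE ->.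
rewrite -big_nat -mulr_sumr.
have := @sum_inv_mul_sqrt_le T M.+1 T0; lra.
Qed.

(** Let delta be the proportion of the gap left by d. Taking first T with 4/sqrt T <= delta/4, then
    s with 1 - s <= delta/(4T), the level sums shrink by the factor 1 - delta/2 at each
    generation. *)
Lemma psum_bounded_near1 I d : (0 < d)%N -> ~ I d ->
  exists2 s1 : R, s1 < 1 & forall s, s1 <= s < 1 -> psum_bounded I s.
Proof.
move=> d0 nId; pose dl : R := (d.+1%:R * d.+2%:R)^-1.
have dl0 : 0 < dl by rewrite invr_gt0 mulr_gt0 ?ltr0n.
have dl1 : dl <= 1.
  rewrite invf_le1 ?mulr_gt0 ?ltr0n//.
  by rewrite -natrM ler1n.
pose T := (Num.truncn ((16 / dl) ^+ 2)).+1.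
have sT : 4 / Num.sqrt T%:R <= dl / 4.
  have h : 16 / dl <= Num.sqrt T%:R.
    rewrite -[leLHS]ger0_norm ?divr_ge0 ?(ltW dl0)// -sqrtr_sqr ler_sqrt ?ltr0n//.
    by apply: ltW; exact: truncnS_gt.
  have h0 : 0 < 16 / dl by rewrite divr_gt0.
  rewrite ler_pdivrMr; last exact: lt_le_trans h.
  by rewrite ler_pdivrMr// in h; lra.
have T0 : 0 < T%:R :> R by rewrite ltr0n.
exists (Num.max (3 / 4) (1 - dl / 4 / T%:R)).
  rewrite gt_max; apply/andP; split; first lra.
  by rewrite gtrBl !divr_gt0.
move=> s /andP[]; rewrite ge_max => /andP[s34 sdl] s1.
have hT : T%:R * (1 - s) <= dl / 4.
  have : 1 - s <= dl / 4 / T%:R by lra.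
  by rewrite ler_pdivlMr// mulrC.
pose x := 1 - dl / 2.
have key M u k : mvalid u ->
    psum (digits I M) s k (mq u) (mq' u) <= 2 `^ s * x ^+ k * mlen u `^ s.
  elim: k u => [|k IH] u vu /=.
    rewrite expr0 mulr1 -powRM//; first by apply: weight_le_mlen => //; lra.
    by rewrite ltW// mlen_gt0.
  have l0 := mlen_gt0 vu.
  apply: (@le_trans _ _ (\sum_(b <- digits I M)
      2 `^ s * x ^+ k * mlen u `^ s * (mlen (mchild u b) / mlen u) `^ s)).
    rewrite !big_seq; apply: ler_sum => b /digits_gt0 b0.
    have vb := mvalid_child b0 vu; apply: le_trans (IH _ vb) _.
    rewrite -[leRHS]mulrA -powRM ?(ltW l0)//; last first.
      by rewrite divr_ge0 ?(ltW l0)// ltW// mlen_gt0.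
    by rewrite mulrCA mulfV ?gt_eqF// mulr1.
  rewrite -mulr_sumr exprSr -!mulrA ler_wpM2l ?powR_ge0//.
  rewrite ler_wpM2l ?exprn_ge0//; first by rewrite /x; lra.
  rewrite mulrC ler_wpM2r ?powR_ge0//.
  apply: le_trans (@sum_powR_ratio_le (digits I M) d u s T _ _ d0 _ vu _ _) _ => //.
  - exact: digits_uniq.
  - exact: digits_gt0.
  - by rewrite mem_digits asboolF.
  - by rewrite s34.
  - by rewrite -/dl /x; lra.
apply: (@psum_bounded_geometric _ _ _ (2 `^ s) x).
- exact: powR_ge0.
- by rewrite /x; apply/andP; split; lra.
move=> M k; have vr := mvalid_root R; have := key M (mroot R) k vr.
by rewrite mlenE//= addr0 mul1r invr1 powR1 mulr1.
Qed.

End DimensionBelowOne.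

(** * Digit blocks *)

Section Blocks.
Variable R : realType.
Implicit Types (I : set nat) (s : R) (b k n : nat).

Lemma gt1_ltr_powR (x a b : R) : 1 < x -> a < b -> x `^ a < x `^ b.
Proof.
move=> x1 ab; have -> : a = b + (a - b) by ring.
rewrite powRD; last by rewrite (gt_eqF (lt_trans ltr01 x1)) implybT.
have /andP[_ h] : 0 < x `^ (a - b) < 1 by apply: powR_lt1; rewrite // subr_lt0.
by rewrite gtr_pMr// powR_gt0// (lt_trans ltr01).
Qed.

Definition pow2 b : R := 2 ^+ trunc_log 2 b.

(** The form in which the upper bounds use I; D absorbs the finitely many digits outside the
    blocks. *)
Definition sparse_blocks I (alpha D : R) := forall b, I b ->
  (0 < b)%N /\ b%:R <= pow2 b + D * pow2 b `^ alpha.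

(** The form in which the lower bounds use I; k0 skips the blocks with missing digits. *)
Definition full_blocks I (alpha : R) k0 := forall k n, (k0 <= k)%N ->
  2 ^+ k <= n%:R :> R -> n%:R <= 2 ^+ k + (2 ^+ k) `^ alpha -> I n.

Lemma pow2_ge1 b : 1 <= pow2 b.
Proof. by rewrite exprn_ege1// ler1n. Qed.

Lemma pow2_le b : (0 < b)%N -> pow2 b <= b%:R.
Proof. by move=> b0; rewrite /pow2 -natrX ler_nat trunc_logP. Qed.

Lemma pow2_gt b : b.+1%:R <= 2 * pow2 b.
Proof. by rewrite /pow2 -exprS -natrX ler_nat trunc_log_ltn. Qed.

Lemma finite_set_nat_bounded (A : set nat) : finite_set A ->
  exists M, forall n, A n -> (n <= M)%N.
Proof.
move=> /finite_seqP[l ->]; exists (\max_(n <- l) n)%N => n /= nl.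
exact: (@leq_bigmax_seq _ _ xpredT id).
Qed.

Lemma dyadic_blocks_split (alpha : R) I : 0 < alpha < 1 ->
  I `<=` [set n | (1 <= n)%N] -> finite_set (I `+` dyadic_blocks alpha) ->
  (exists2 D, 1 <= D & sparse_blocks I alpha D) /\ exists k0, full_blocks I alpha k0.
Proof.
move=> /andP[a0 a1] hI /finite_set_nat_bounded[M hM]; split.
  exists M.+1%:R; first by rewrite ler1n.
  move=> b Ib; have b0 : (0 < b)%N by exact: hI.
  split=> //; have p1 := pow2_ge1 b.
  have pa : 1 <= pow2 b `^ alpha by rewrite -[leLHS](powRr0 (pow2 b)) ler_powR// ltW.
  have [[k /= k1 /andP[kb bk]]|nb] := pselect (dyadic_blocks alpha b).
    (* As alpha < 1 and k >= 1, the block ends before 2^(k+1), so the logarithm recovers k. *)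
    have kE : trunc_log 2 b = k.
      apply: trunc_log_eq => //; rewrite -(ler_nat R) natrX kb/=.
      rewrite -(ltr_nat R) natrX exprS mulrC mulr_natr mulr2n; apply: le_lt_trans bk _.
      rewrite ltrD2l -powR_mulrn// gt1_ltr_powR ?ltr1n//.
      by rewrite gtr_pMr// ltr0n.
    rewrite /pow2 kE; apply: le_trans bk _; rewrite lerD2l powRrM powR_mulrn//.
    by rewrite ler_peMl ?powR_ge0// ler1n.
  have bM : (b <= M)%N by apply: hM; left.
  apply: (@le_trans _ _ M.+1%:R); first by rewrite ler_nat ltnW.
  have : M.+1%:R <= M.+1%:R * pow2 b `^ alpha by rewrite ler_peMr.
  by move: p1; lra.
exists M.+1 => k n kM kn nk.
have nM : (M < n)%N.
  rewrite -(ltr_nat R); apply: lt_le_trans kn; rewrite -natrX ltr_nat.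
  by apply: leq_trans kM _; rewrite ltnW// ltn_expl.
apply: contrapT => nI; have : (n <= M)%N; last by rewrite leqNgt nM.
apply: hM; right; split => //; exists k => /=; first by apply: leq_trans kM.
by rewrite kn/= powRrM powR_mulrn.
Qed.

(** For large k the digit 2^(k+1) - 1 lies 2^k - 1 beyond the start of its block, more than D 2^(k
    alpha). *)
Lemma sparse_blocks_missing I (alpha D : R) : alpha < 1 -> sparse_blocks I alpha D ->
  exists2 d, (0 < d)%N & ~ I d.
Proof.
move=> a1 hI; apply: contrapT => H.
have Iall d : (0 < d)%N -> I d.
  by move=> d0; apply: contrapT => nId; apply: H; exists d.
suff : 1 <= alpha by rewrite leNgt a1.
apply: (@exponent_le R 2^-1 D 1 alpha 1); first by rewrite invr_gt0.
move=> k k1; rewrite mulr1 powR_mulrn// powRrM powR_mulrn//.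
have p2 : (2 <= 2 ^ k)%N by rewrite -{1}(expn1 2) leq_exp2l.
have d0 : (0 < (2 ^ k.+1).-1)%N.
  by rewrite expnS; move: p2; case: (2 ^ k)%N => [|[|m]] //; rewrite mulnS.
have [_] := hI _ (Iall _ d0).
have -> : pow2 (2 ^ k.+1).-1 = 2 ^+ k.
  rewrite /pow2 (@trunc_log_eq 2 k)//.
  by rewrite expnS; move: p2; case: (2 ^ k)%N => [|[|m]] // _; lia.
have -> : (2 ^ k.+1).-1%:R = 2 * 2 ^+ k - 1 :> R.
  by rewrite -exprS -natrX -(natrB _ (m := _) (n := 1)) ?subn1// expn_gt0.
have : 2 <= 2 ^+ k :> R by rewrite -natrX ler_nat.
move: (2 ^+ k) => X; lra.
Qed.

Lemma full_blocks_digit I (alpha : R) k0 k j : full_blocks I alpha k0 -> (k0 <= k)%N ->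
  j%:R <= (2 ^+ k) `^ alpha -> I (2 ^ k + j)%N.
Proof.
by move=> hI kk jk; apply: (hI k _ kk); rewrite natrD natrX ?lerDl// lerD2l.
Qed.

(** Words of one letter suffice: with X = 2^k, the k-th block has about X^alpha digits, each of
    weight at least (2X)^(-2s). *)
Lemma psum_bounded_exponent I (alpha s : R) k0 : full_blocks I alpha k0 ->
  alpha < 1 -> 0 <= s -> psum_bounded I s -> alpha <= 2 * s.
Proof.
move=> hI a1 s0 [Y hY].
apply: (@exponent_le R (2 `^ (- (2 * s))) Y alpha (2 * s) k0); first exact: powR_gt0.
move=> k kk; pose X : R := 2 ^+ k.
have X1 : 1 <= X by rewrite exprn_ege1// ler1n.
have X0 : 0 < X by lra.
pose m := (Num.truncn (X `^ alpha)).+1.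
pose J := map (addn (2 ^ k)) (iota 0 m).
have hj j : (j < m)%N -> j%:R <= X `^ alpha.
  rewrite ltnS => jm; apply: (@le_trans _ _ (Num.truncn (X `^ alpha))%:R); first by rewrite ler_nat.
  by rewrite truncn_le// powR_ge0.
have XaX : X `^ alpha <= X by apply: ler1_powR => //; apply: ltW.
have hb b : b \in J -> I b /\ (0 < b)%N /\ b%:R <= 2 * X.
  move=> /mapP[j]; rewrite mem_iota add0n => /andP[_ jm] ->.
  have := hj _ jm => jX.
  split; first exact: full_blocks_digit hI kk jX.
  split; first by rewrite addn_gt0 expn_gt0.
  by rewrite natrD natrX -/X; lra.
have := hY (2 ^ k.+1)%N 2%N; rewrite !big_ord_recr big_ord0 /= add0r => hY2.
have : \sum_(b <- J) b%:R `^ (- (2 * s)) <= Y.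
  apply: le_trans hY2; apply: ler_wpDl; first exact: powR_ge0.
  apply: (@le_trans _ _ (\sum_(b <- digits I (2 ^ k.+1)) b%:R `^ (- (2 * s)))).
    apply: ler_sum_subseq => //.
    - by rewrite map_inj_uniq ?iota_uniq//; exact: addnI.
    - exact: digits_uniq.
    - move=> b /hb[Ib [b0 bX]]; rewrite mem_digits asboolT//= b0 /=.
      by rewrite -(ler_nat R) natrX exprS.
  by rewrite le_eqVlt; apply/orP; left; apply/eqP; apply: eq_bigr => b _;
    rewrite mulr1 addr0.
have : m%:R * (2 * X) `^ (- (2 * s)) <= \sum_(b <- J) b%:R `^ (- (2 * s)).
  have -> : m%:R * (2 * X) `^ (- (2 * s)) = \sum_(b <- J) (2 * X) `^ (- (2 * s)).
    by rewrite big_const_seq count_predT size_map size_iota iter_addr addr0 mulr_natl.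
  rewrite !big_seq; apply: ler_sum => b /hb[_ [b0 bX]].
  have b0' : 0 < b%:R :> R by rewrite ltr0n.
  rewrite !powRN lef_pV2 ?posrE ?powR_gt0 ?mulr_gt0//.
  by rewrite ge0_ler_powR ?nnegrE ?mulr_ge0// ltW.
move=> h1 h2; have {h1 h2} := le_trans h1 h2.
rewrite powRM ?(ltW X0)// => h.
have e a : 2 `^ (k%:R * a) = X `^ a by rewrite powRrM powR_mulrn.
rewrite !e -ler_pdivrMr ?powR_gt0//.
rewrite -powRN; apply: le_trans h.
rewrite [leLHS]mulrAC [leLHS]mulrC ler_wpM2r//.
  by rewrite mulr_ge0 ?powR_ge0.
by apply: ltW; exact: truncnS_gt.
Qed.

Lemma interpolate (m x y t : R) : 0 <= m -> m <= x -> m <= y -> 0 <= t <= 1 ->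
  m <= x `^ (1 - t) * y `^ t.
Proof.
move=> m0 mx my /andP[t0 t1].
have [->|mn0] := eqVneq m 0; first by rewrite mulr_ge0 ?powR_ge0.
have -> : m = m `^ (1 - t) * m `^ t.
  by rewrite -powRD ?mn0 ?implybT// subrK powRr1.
apply: ler_pM; rewrite ?powR_ge0// ge0_ler_powR ?nnegrE ?subr_ge0//.
- exact: le_trans mx.
- exact: le_trans my.
Qed.

End Blocks.

(** * Packing numbers of one level *)

Lemma spaced_map (R : realType) (T : eqType) (f : T -> R) (d : R) (J : seq T) : uniq J ->
  {in J &, forall b b', b != b' -> d <= `|f b - f b'|} -> spaced d (map f J).
Proof.
rewrite /spaced pairwise_map; elim: J => //= a J IH /andP[aJ uJ] h.
rewrite IH// ?andbT; last first.
  by move=> b b' bJ b'J; apply: h; rewrite inE ?bJ ?b'J orbT.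
apply/allP => b bJ; apply: h; rewrite ?mem_head ?inE ?bJ ?orbT//.
by apply: contraNneq aJ => ->.
Qed.

Lemma card_nat_interval (R : realType) (J : seq nat) (x y : R) : uniq J -> 0 <= y ->
  {in J, forall b, x <= b%:R <= x + y} -> (size J)%:R <= y + 1.
Proof.
move=> uJ y0 hJ; rewrite -(size_map (fun b => b%:R : R)) -[y in leRHS]divr1.
apply: (@packing_le_diam R 1 [set b%:R | b in [set b | b \in J]] _ ltr01 y0).
- move=> _ _ [b /= /hJ/andP[? ?] <-] [b' /= /hJ/andP[? ?] <-].
  by rewrite ler_norml; apply/andP; split; lra.
- apply: spaced_map => // b b' _ _ bb'.
  wlog lt : b b' bb' / (b < b')%N.
    move=> H; have [lt|lt|e] := ltngtP b b'; [exact: H|by rewrite distrC H// eq_sym|].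
    by rewrite e eqxx in bb'.
  rewrite distrC ger0_norm ?subr_ge0 ?ler_nat; last exact: ltnW.
  by rewrite lerBrDr addrC natr1 ler_nat.
- by move=> _ /mapP[b bJ ->]; exists b.
Qed.

Lemma inv_nat_dist (R : realType) (b b' : nat) (B : R) : (0 < b)%N -> (0 < b')%N -> b != b' ->
  b%:R <= B -> b'%:R <= B -> (B ^+ 2)^-1 <= `|b%:R^-1 - b'%:R^-1|.
Proof.
move=> b0 b'0 bb'; wlog lt : b b' b0 b'0 bb' / (b < b')%N.
  move=> H bB b'B; have [lt|lt|e] := ltngtP b b'; [exact: H|by rewrite distrC H// eq_sym|].
  by rewrite e eqxx in bb'.
have x0 : 0 < b%:R :> R by rewrite ltr0n.
have x0' : 0 < b'%:R :> R by rewrite ltr0n.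
have : b%:R + 1 <= b'%:R :> R by rewrite natr1 ler_nat.
move: (b%:R : R) (b'%:R : R) x0 x0' => x y x0 y0 xy xB yB.
have -> : x^-1 - y^-1 = (y - x) / (x * y) by field; rewrite !gt_eqF.
have B0 : 0 < B by lra.
have p : 0 < x * y by rewrite mulr_gt0.
rewrite ger0_norm; last by rewrite divr_ge0 ?(ltW p)//; lra.
rewrite ler_pdivlMr// mulrC ler_pdivrMr ?exprn_gt0//.
apply: (@le_trans _ _ (B ^+ 2)); first by rewrite expr2 ler_pM// ltW.
by rewrite ler_peMl ?exprn_ge0 ?(ltW B0)//; lra.
Qed.

Lemma card_inv_nat_interval (R : realType) (J : seq nat) (B ell : R) : uniq J -> 0 <= ell ->
  {in J, forall b, (0 < b)%N /\ b%:R <= B} -> 0 < B ->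
  {in J &, forall b b', b%:R^-1 - b'%:R^-1 <= ell} -> (size J)%:R <= ell * B ^+ 2 + 1.
Proof.
move=> uJ l0 hJ B0 hell; rewrite -(size_map (fun b => b%:R^-1 : R)) -[B ^+ 2]invrK.
have d0 : 0 < (B ^+ 2)^-1 by rewrite invr_gt0 exprn_gt0.
apply: (@packing_le_diam R _ [set b%:R^-1 | b in [set b | b \in J]] _ d0 l0).
- move=> _ _ [b /= bJ <-] [b' /= b'J <-]; rewrite ler_norml lerNl opprB.
  by rewrite !hell.
- apply: spaced_map => // b b' /hJ[b0 bB] /hJ[b'0 b'B] bb'; exact: inv_nat_dist.
- by move=> _ /mapP[b bJ ->]; exists b.
Qed.

Section BlockPacking.
Variable R : realType.
Variables (I : set nat) (alpha D s : R).
Hypotheses (a01 : 0 < alpha < 1) (D1 : 1 <= D) (hI : sparse_blocks I alpha D).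
Hypothesis s01 : alpha / 2 < s < 1.

Definition cyl b : set R := [set x | b.+1%:R^-1 <= x <= b%:R^-1].

(* The block 1/b, b in [2^k, 2^k + D 2^(k alpha)], has diameter about
   2^(-k(2-alpha)) and spacing about 4^(-k); t is chosen so that both sides of
   the interpolation x^(1-t) y^t balance for every k. *)
Definition expo_t := (s - alpha / 2) / (1 - alpha / 2).

Lemma expo_t_bounds : 0 <= expo_t <= s.
Proof.
have /andP[a0 a1] := a01; have /andP[s0 s1] := s01.
have h : 0 < 1 - alpha / 2 by lra.
by rewrite /expo_t divr_ge0 ?ler_pdivrMr//=; nra.
Qed.

(** The balance in terms of X = 2^k: it reads (X^alpha)^(1-t) (X^2)^t = X^(2s), or equivalently
    (X^(alpha-2))^(1-t) = X^(-2(1-s)). *)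
Lemma expo_tE : alpha * (1 - expo_t) + 2 * expo_t = 2 * s.
Proof. have /andP[a0 a1] := a01; rewrite /expo_t; field; lra. Qed.

Let t := expo_t.

Lemma cyl_dist b b' x y : (0 < b)%N -> (0 < b')%N -> cyl b x -> cyl b' y ->
  `|x - y| <= Num.max (b%:R^-1 - b'.+1%:R^-1) (b'%:R^-1 - b.+1%:R^-1).
Proof.
move=> b0 b'0 /andP[x1 x2] /andP[y1 y2]; rewrite le_max; apply/orP.
have [xy|xy] := leP x y.
  by right; rewrite ler0_norm ?subr_le0// opprB lerB.
by left; rewrite gtr0_norm ?subr_gt0// lerB.
Qed.

Lemma block_dist b b' x y : I b -> I b' -> pow2 R b = pow2 R b' -> cyl b x -> cyl b' y ->
  `|x - y| <= (D + 1) * pow2 R b `^ (alpha - 2).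
Proof.
move=> Ib Ib' e cx cy; have D1' := D1; have /andP[a0 a1] := a01.
have [b0 bD] := hI Ib; have [b'0 b'D] := hI Ib'.
apply: le_trans (cyl_dist b0 b'0 cx cy) _.
set X := pow2 R b in e bD *; rewrite -e in b'D.
have X1 : 1 <= X := pow2_ge1 R b.
have X0 : 0 < X by lra.
have Xa : 1 <= X `^ alpha by rewrite -[leLHS](powRr0 X) ler_powR// ltW.
have -> : X `^ (alpha - 2) = X `^ alpha / X ^+ 2.
  by rewrite powRB ?powR_mulrn ?(gt_eqF X0) ?implybT// ltW.
have key c c' : X <= c%:R -> c'%:R <= X + D * X `^ alpha ->
    c%:R^-1 - c'.+1%:R^-1 <= (D + 1) * (X `^ alpha / X ^+ 2).
  move=> Xc cX.
  have h1 : c%:R^-1 <= X^-1 by rewrite lef_pV2 ?posrE//; apply: lt_le_trans Xc.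
  have h2 : (X + (D + 1) * X `^ alpha)^-1 <= c'.+1%:R^-1.
    rewrite lef_pV2 ?posrE ?ltr0n//; last first.

      apply: addr_gt0 => //; apply: mulr_gt0; [lra|exact: powR_gt0].
    by rewrite -natr1; lra.
  apply: (@le_trans _ _ (X^-1 - (X + (D + 1) * X `^ alpha)^-1)); first exact: lerB.
  have DX : 0 < (D + 1) * X `^ alpha by apply: mulr_gt0; [lra|exact: powR_gt0].
  have -> : X^-1 - (X + (D + 1) * X `^ alpha)^-1 =
      (D + 1) * X `^ alpha / (X * (X + (D + 1) * X `^ alpha)).
    by field; rewrite !gt_eqF//; lra.
  rewrite mulrA ler_wpM2l ?(ltW DX)// lef_pV2 ?posrE ?exprn_gt0//; last first.
    by rewrite mulr_gt0//; lra.
  by rewrite expr2 ler_pM2l// lerDl ltW.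
have Xb : X <= b%:R by exact: pow2_le.
have Xb' : X <= b'%:R by rewrite e; exact: pow2_le.
by rewrite ge_max !key.
Qed.

(** Because t <= s; the target bound therefore absorbs pieces with boundedly many points. *)
Lemma one_le_scale (r ell : R) : 0 < r <= 1 -> r <= ell -> 1 <= r `^ (- s) * ell `^ t.
Proof.
move=> /andP[r0 r1] rl; have /andP[t0 ts] := expo_t_bounds.
apply: (@le_trans _ _ (r `^ (- s) * r `^ t)).
  rewrite -powRD ?(gt_eqF r0) ?implybT// -[leLHS](powRr0 r) ger_powR ?r0//.
  by rewrite -/t in ts; lra.
by rewrite ler_wpM2l ?powR_ge0// ge0_ler_powR ?nnegrE ?(ltW r0)//; lra.
Qed.

(** Cylinders of far digits are no longer than about r, so a block counts only through its diameter,
    at most both the block width and ell. After interpolation, 1 <= r X^2 turns X^(-2(1-s)) into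
    r^(1-s). All blocks beyond n lie in [0, r] and form one piece, whence n + 2 pieces. *)
Lemma packing_far (r ell : R) n (E : set R) :
  0 < r <= 1 -> r^-1 <= 2 ^+ n -> r <= ell ->
  (forall x y, E x -> E y -> `|x - y| <= ell) ->
  (forall x, E x -> exists2 b, I b /\ 1 <= r * pow2 R b ^+ 2 & cyl b x) ->
  packing_le r E (n.+2%:R * ((D + 2) * (r `^ (- s) * ell `^ t))).
Proof.
move=> /andP[r0 r1] rn rl hE hb; have D1' := D1.
have /andP[a0 a1] := a01; have /andP[s0 s1] := s01.
have T1 : 1 <= r `^ (- s) * ell `^ t by apply: one_le_scale; rewrite ?r0.
set T := r `^ (- s) * ell `^ t in T1 *.
pose F k : set R := [set x | E x /\ exists b, [/\ I b, 1 <= r * pow2 R b ^+ 2,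
  cyl b x & (if (k <= n)%N then trunc_log 2 b == k else (n < trunc_log 2 b)%N)]].
have -> : n.+2%:R * ((D + 2) * T) = \sum_(k <- iota 0 n.+2) ((D + 2) * T).
  by rewrite big_const_seq count_predT size_iota iter_addr addr0 mulr_natl.
apply: (@packing_le_sum R nat _ r E F).
  move=> x Ex; have [b [Ib rb] cb] := hb _ Ex.
  exists (if (trunc_log 2 b <= n)%N then trunc_log 2 b else n.+1).
    by rewrite mem_iota add0n ltnS /=; case: ifP => h; [exact: leqW|exact: leqnn].
  split=> //; exists b; split => //.
  by case: (leqP (trunc_log 2 b) n) => h; rewrite ?h ?eqxx ?ltnn.
have l0 : 0 < ell by lra.
move=> k _; have [kn|nk] := leqP k n; last first.
  apply: (@packing_leS _ _ r _ (F k) _ (r / r + 1)) => //.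
    rewrite divff ?gt_eqF//.
    have : 2 * T <= (D + 2) * T by rewrite ler_wpM2r//; lra.
    lra.
  apply: packing_le_diam => //; first exact: ltW.
  have near0 x : F k x -> 0 <= x <= r.
    move=> [_ [b [Ib _ /andP[x1 x2]]]]; rewrite leqNgt nk /= => nb.
    have [b0 _] := hI Ib.
    rewrite (le_trans _ x1) ?invr_ge0//=; apply: le_trans x2 _.
    rewrite -[leRHS]invrK lef_pV2 ?posrE ?invr_gt0 ?ltr0n//.
    apply: le_trans rn _; apply: le_trans (pow2_le R b0).
    by rewrite ler_weXn2l ?ler1n// ltnW.
  move=> x y /near0/andP[? ?] /near0/andP[? ?].
  by rewrite ler_norml; apply/andP; split; lra.
have [[x0 [Ex0 [b [Ib rb cb]]]]|Fk0] := pselect (exists x, F k x); last first.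
  move=> [|x w] _ hw; first by rewrite /= !mulr_ge0 ?powR_ge0//; lra.
  by exfalso; apply: Fk0; exists x; apply: hw; rewrite mem_head.
rewrite kn => /eqP bk.
set X := pow2 R b in rb.
have X1 : 1 <= X := pow2_ge1 R b.
have X0 : 0 < X by lra.
have Fpow x : F k x -> exists b', [/\ I b', pow2 R b' = X & cyl b' x].
  move=> [_ [b' [Ib' _ cb']]]; rewrite kn => /eqP b'k; exists b'; split => //.
  by rewrite /X /pow2 b'k bk.
pose m := Num.min ((D + 1) * X `^ (alpha - 2)) ell.
have m0 : 0 <= m by rewrite le_min (ltW l0) mulr_ge0 ?powR_ge0//; lra.
apply: (@packing_leS _ _ r _ (F k) _ (m / r + 1)) => //; last first.
  apply: packing_le_diam => // x y Fx Fy; rewrite le_min hE ?andbT; last 2 first.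
  - by case: Fx.
  - by case: Fy.
  have [bx [Ix ex cx]] := Fpow _ Fx; have [By [Iy ey cy]] := Fpow _ Fy.
  by rewrite -ex; apply: block_dist cx cy => //; rewrite ex ey.
suff : m / r <= (D + 1) * T by move: T1; lra.
have /andP[t0 ts] := expo_t_bounds; rewrite -/t in t0 ts.
have t1 : 0 <= 1 - t by lra.
have : m <= ((D + 1) * X `^ (alpha - 2)) `^ (1 - t) * ell `^ t.
  apply: interpolate => //; rewrite ?ge_min ?lexx ?orbT//; apply/andP; split; lra.
rewrite powRM ?powR_ge0//; last by lra.
have hD : (D + 1) `^ (1 - t) <= D + 1 by apply: ler1_powR; lra.
have hX : X `^ (alpha - 2) `^ (1 - t) <= r * r `^ (- s).
  have -> : r * r `^ (- s) = r `^ (1 - s).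
    by rewrite powRD ?(gt_eqF r0) ?implybT// powRr1// ltW.
  rewrite -powRrM.
  have -> : (alpha - 2) * (1 - t) = 2 * - (1 - s) by have := expo_tE; rewrite -/t; lra.
  rewrite powRrM powR_mulrn ?(ltW X0)// powRN -powR_invl ?sqr_ge0//.
  rewrite ge0_ler_powR ?nnegrE ?invr_ge0 ?sqr_ge0 ?(ltW r0)//; first by lra.
  by rewrite -[leLHS]mul1r ler_pdivrMr ?exprn_gt0.
move=> h; rewrite ler_pdivrMr//; apply: le_trans h _.
have -> : (D + 1) * T * r = (D + 1) * (r * r `^ (- s)) * ell `^ t by rewrite /T; ring.
rewrite ler_wpM2r ?powR_ge0//; apply: ler_pM; rewrite ?powR_ge0//.
Qed.

(** Here the digits themselves are counted: at most (D + 1) X^alpha by the width of the block, at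
    most 8 ell X^2 by the spacing of reciprocals. In the product of the interpolated count and the
    weight (r X^2)^(-s), X cancels. *)
Lemma packing_near (r ell A : R) n (Eb : nat -> set R) (Sel : set nat) (E : set R) :
  0 < r <= 1 -> r^-1 <= 2 ^+ n -> 0 < ell -> 0 <= A ->
  (forall b, Sel b -> I b /\ r * pow2 R b ^+ 2 < 1) ->
  (forall b b', Sel b -> Sel b' -> b%:R^-1 - b'.+1%:R^-1 <= ell) ->
  (forall b, Sel b -> packing_le r (Eb b) (A * (r * b%:R ^+ 2) `^ (- s))) ->
  (forall x, E x -> exists2 b, Sel b & Eb b x) ->
  packing_le r E (n.+1%:R * (8 * (D + 1) * A * (r `^ (- s) * ell `^ t))).
Proof.
move=> /andP[r0 r1] rn l0 A0 hS hell hEb hE; have D1' := D1.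
have /andP[a0 a1] := a01; have /andP[s0 s1] := s01.
have /andP[t0 ts] := expo_t_bounds; rewrite -/t in t0 ts.
pose F k : set R := [set x | exists b, [/\ Sel b, trunc_log 2 b = k & Eb b x]].
set T := r `^ (- s) * ell `^ t.
have T0 : 0 <= T by rewrite mulr_ge0 ?powR_ge0.
have -> : n.+1%:R * (8 * (D + 1) * A * T) = \sum_(k <- iota 0 n.+1) (8 * (D + 1) * A * T).
  by rewrite big_const_seq count_predT size_iota iter_addr addr0 mulr_natl.
apply: (@packing_le_sum R nat _ r E F).
  move=> x /hE[b Sb Ex]; exists (trunc_log 2 b); last by exists b.
  rewrite mem_iota add0n ltnS /=; have [_ rb] := hS _ Sb.
  rewrite -(@ler_eXn2l R 2) ?ltr1n// -/(pow2 R b).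
  have p1 := pow2_ge1 R b.
  apply: le_trans rn; rewrite -[leRHS]mul1r ler_pdivlMr// mulrC.
  apply: le_trans (ltW rb); rewrite ler_wpM2l ?(ltW r0)// expr2 ler_peMl//.
  by rewrite (le_trans ler01).
move=> k _; pose X : R := 2 ^+ k.
have X1 : 1 <= X by rewrite exprn_ege1// ler1n.
have X0 : 0 < X by lra.
pose J := [seq b <- iota 0 (2 ^ k.+1) | `[< Sel b >] && (trunc_log 2 b == k)].
have uJ : uniq J by rewrite filter_uniq// iota_uniq.
have J0 b : b \in J -> [/\ Sel b, I b, (0 < b)%N, X <= b%:R & b.+1%:R <= 2 * X].
  rewrite mem_filter => /andP[/andP[/asboolP Sb /eqP bk] _].
  have [Ib _] := hS _ Sb; have [b0 _] := hI Ib; split => //.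
    by rewrite /X -bk; exact: pow2_le.
  by rewrite /X -bk; exact: pow2_gt.
have Jpack : packing_le r (F k) (\sum_(b <- J) (A * (r * X ^+ 2) `^ (- s))).
  apply: (@packing_le_sum R nat J r (F k) Eb).
    move=> x [b [Sb bk Ex]]; exists b => //.
    rewrite mem_filter asboolT//= bk eqxx mem_iota add0n -bk /=.
    exact: trunc_log_ltn.
  move=> b /J0[Sb _ b0 Xb _].
  apply: packing_leS (hEb _ Sb) => //.
  rewrite ler_wpM2l// !powRN.
  have b0' : 0 < b%:R :> R by rewrite ltr0n.
  rewrite lef_pV2 ?posrE ?powR_gt0 ?mulr_gt0 ?exprn_gt0//.
  rewrite ge0_ler_powR ?nnegrE ?mulr_ge0 ?exprn_ge0 ?(ltW r0) ?(ltW X0)//; first by lra.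
  by rewrite ler_pM2l// lerXn2r ?nnegrE ?(ltW X0).
apply: packing_leS Jpack => //.
rewrite big_const_seq count_predT iter_addr addr0 -[leLHS]mulr_natl.
case JE : J => [|c J']; first by rewrite mul0r !mulr_ge0 ?powR_ge0//; lra.
rewrite -JE; have cJ : c \in J by rewrite JE mem_head.
have Xa : 1 <= X `^ alpha by rewrite -[leLHS](powRr0 X) ler_powR// ltW.
have size1 : (size J)%:R <= (D + 1) * X `^ alpha.
  apply: (@le_trans _ _ (D * X `^ alpha + 1)); last by lra.
  apply: (@card_nat_interval R J X) => //; first by rewrite mulr_ge0//; lra.
  move=> b bJ; have [_ Ib _ Xb _] := J0 _ bJ; rewrite Xb /=.
  have [_] := hI Ib; move: bJ; rewrite mem_filter => /andP[/andP[_ /eqP bk] _].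
  by rewrite /pow2 bk.
have size2 : (size J)%:R <= 8 * (ell * X ^+ 2).
  (* A selected cylinder is at least (2X)^(-2) long and fits into length ell; this absorbs the
     additive 1 of the count. *)
  have e1 : 1 <= ell * (2 * X) ^+ 2.
    have [Sc _ c0 Xc cX] := J0 _ cJ; have := hell _ _ Sc Sc.
    have c0' : 0 < c%:R :> R by rewrite ltr0n.
    have -> : c%:R^-1 - c.+1%:R^-1 = (c%:R * c.+1%:R)^-1 :> R.
      by rewrite -natr1; field; rewrite natr1 !pnatr_eq0 -!lt0n c0.
    move=> h; rewrite -ler_pdivrMr ?exprn_gt0 ?mulr_gt0// div1r; apply: le_trans h.
    rewrite lef_pV2 ?posrE ?mulr_gt0 ?ltr0n ?exprn_gt0 ?mulr_gt0//.
    rewrite expr2; apply: ler_pM => //; apply: le_trans cX; rewrite ler_nat//.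
  apply: (@le_trans _ _ (ell * (2 * X) ^+ 2 + 1)); last by move: e1; rewrite exprMn; lra.
  apply: card_inv_nat_interval => //; first exact: ltW.
  - move=> b /J0[_ _ b0 _ bX]; split => //; apply: le_trans bX; by rewrite ler_nat.
  - by rewrite mulr_gt0.
  - move=> b b' /J0[Sb _ b0 _ _] /J0[Sb' _ b'0 _ _]; apply: le_trans (hell _ _ Sb Sb').
    by rewrite lerD2l lerN2 lef_pV2 ?posrE ?ltr0n// ler_nat.
have t1 : 0 <= 1 - t by lra.
have h : (size J)%:R <= ((D + 1) * X `^ alpha) `^ (1 - t) * (8 * (ell * X ^+ 2)) `^ t.
  by apply: interpolate => //; apply/andP; split; lra.
have eD : ((D + 1) * X `^ alpha) `^ (1 - t) = (D + 1) `^ (1 - t) * X `^ alpha `^ (1 - t).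
  by rewrite powRM ?powR_ge0//; lra.
have el : (8 * (ell * X ^+ 2)) `^ t = 8 `^ t * (ell `^ t * (X ^+ 2) `^ t).
  have X20 : 0 <= X ^+ 2 by rewrite exprn_ge0// ltW.
  have eX20 : 0 <= ell * X ^+ 2 by rewrite mulr_ge0// ltW.
  by rewrite -(@powRM _ ell) ?(ltW l0)// -powRM.
rewrite {}eD {}el in h.
have hD : (D + 1) `^ (1 - t) <= D + 1 by apply: ler1_powR; lra.
have h8 : 8 `^ t <= 8 :> R by apply: ler1_powR; lra.
have eX : X `^ alpha `^ (1 - t) * (X ^+ 2) `^ t = (X ^+ 2) `^ s.
  rewrite -!powR_mulrn ?(ltW X0)// -!powRrM -powRD ?(gt_eqF X0) ?implybT//.
  by congr (_ `^ _); have := expo_tE; rewrite -/t.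
have : (size J)%:R <= 8 * (D + 1) * ell `^ t * (X ^+ 2) `^ s.
  apply: le_trans h _; rewrite -eX.
  have -> : (D + 1) `^ (1 - t) * X `^ alpha `^ (1 - t) *
     (8 `^ t * (ell `^ t * (X ^+ 2) `^ t)) = (8 `^ t * (D + 1) `^ (1 - t)) * (ell `^ t *
     (X `^ alpha `^ (1 - t) * (X ^+ 2) `^ t)) by ring.
  rewrite -[leRHS]mulrA ler_wpM2r ?mulr_ge0 ?powR_ge0//.
  by apply: ler_pM => //; exact: powR_ge0.
move=> {}h; have p0 : 0 <= A * (r `^ (- s) * (X ^+ 2) `^ (- s)) by rewrite !mulr_ge0 ?powR_ge0.
rewrite (@powRM _ r (X ^+ 2)) ?(ltW r0) ?exprn_ge0 ?(ltW X0)//.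
apply: le_trans (ler_wpM2r p0 h) _.
rewrite le_eqVlt; apply/orP; left; apply/eqP.
have : (X ^+ 2) `^ s * (X ^+ 2) `^ (- s) = 1.
  by rewrite powRN mulfV// gt_eqF// powR_gt0// exprn_gt0.
rewrite /T; move: ((X ^+ 2) `^ s) ((X ^+ 2) `^ (- s)) => y z yz.
transitivity (8 * (D + 1) * A * (r `^ (- s) * ell `^ t) * (y * z)); first by ring.
by rewrite yz mulr1.
Qed.

End BlockPacking.

(** * Packing numbers of the limit set *)

Section PackingOfLimitSet.
Variable R : realType.
Implicit Types (I : set nat) (s r : R) (u : mob R).

(** The number n of dyadic levels down to r satisfies 2^n <= 2/r, and 1 + x <= exp x at x = n e ln 2
    bounds n by a multiple of 2^(ne). *)
Lemma log_absorb (e : R) : 0 < e -> exists2 C : R, 0 < C &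
  forall r, 0 < r <= 1 -> exists n, r^-1 <= 2 ^+ n /\ n.+2%:R <= C * r `^ (- e).
Proof.
move=> e0; have l2 : 0 < ln 2 :> R by rewrite ln_gt0// ltr1n.
have el2 : 0 < e * ln 2 by rewrite mulr_gt0.
exists ((2 + (e * ln 2)^-1) * 2 `^ e).
  by rewrite mulr_gt0 ?powR_gt0// addr_gt0 ?invr_gt0.
move=> r /andP[r0 r1]; have ri1 : 1 <= r^-1 by rewrite -[leLHS]invr1 lef_pV2 ?posrE.
pose N := Num.truncn r^-1.
have N0 : (0 < N)%N by rewrite truncn_gt0.
have Nr : N%:R <= r^-1 by rewrite truncn_le; lra.
pose n := (trunc_log 2 N).+1; exists n; split.
  apply: (@le_trans _ _ N.+1%:R); first by apply: ltW; exact: truncnS_gt.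
  by rewrite -natrX ler_nat trunc_log_ltn.
have n2 : 2 ^+ n <= 2 / r :> R.
  rewrite /n exprS ler_pM2l//; apply: le_trans Nr.
  by rewrite -natrX ler_nat trunc_logP.
have h : 1 + n%:R * (e * ln 2) <= 2 `^ (n%:R * e).
  rewrite /powR pnatr_eq0 /= -mulrA; exact: expR_ge1Dx.
apply: (@le_trans _ _ ((2 + (e * ln 2)^-1) * 2 `^ (n%:R * e))).
  apply: (@le_trans _ _ ((2 + (e * ln 2)^-1) * (1 + n%:R * (e * ln 2)))).
    have -> : (2 + (e * ln 2)^-1) * (1 + n%:R * (e * ln 2)) =
        2 + 2 * (n%:R * (e * ln 2)) + (e * ln 2)^-1 + n%:R.
      by field; rewrite !gt_eqF.
    rewrite -addn2 natrD.
    have : 0 <= 2 * (n%:R * (e * ln 2)) by rewrite !mulr_ge0 ?(ltW e0) ?(ltW l2).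
    have : 0 < (e * ln 2)^-1 by rewrite invr_gt0.
    lra.
  by rewrite ler_wpM2l// addr_ge0// invr_ge0 ltW.
rewrite -[leRHS]mulrA ler_wpM2l//; first by rewrite addr_ge0// invr_ge0 ltW.
rewrite powRN -powR_invl ?(ltW r0)// -powRM//; last by rewrite invr_ge0 ltW.
rewrite powRrM powR_mulrn// ge0_ler_powR ?nnegrE ?exprn_ge0// ?(ltW e0)//.
by rewrite divr_ge0// ltW.
Qed.

Lemma cyl_inv (b : nat) (z : R) : (0 < b)%N -> 0 <= z <= 1 -> cyl b (b%:R + z)^-1.
Proof.
move=> b0 /andP[z0 z1]; have b1 : 1 <= b%:R :> R by rewrite ler1n.
by rewrite /cyl /= -natr1 !lef_pV2 ?posrE; lra.
Qed.

Lemma cf_set_in01 I z : cf_set R I z -> 0 <= z <= 1.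
Proof. by case=> /andP[/ltW-> /ltW->]. Qed.

(** Every finite packing of the limit set lies in one of these sets ([cf_level_exists]), so that
    digit sums run over the finite list [digits I M]. *)
Fixpoint cf_level I (n M : nat) : set R := if n is m.+1 then
  [set z | exists b z', [/\ I b, (b <= M)%N, cf_level I m M z' & z = (b%:R + z')^-1]]
  else cf_set R I.

Lemma cf_level_le I n M M' : (M <= M')%N -> cf_level I n M `<=` cf_level I n M'.
Proof.
move=> MM; elim: n => //= n IH z [b [z' [Ib bM /IH z'F ->]]].
by exists b, z'; split => //; exact: leq_trans MM.
Qed.

Lemma cf_level_in01 I n M z : I `<=` [set k | (0 < k)%N] -> cf_level I n M z -> 0 <= z <= 1.
Proof.
move=> hI; elim: n z => [|n IH] z /=; first exact: cf_set_in01.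
move=> [b [z' [/hI/= b0 _ /IH/andP[z0 z1] ->]]].
have b1 : 1 <= b%:R :> R by rewrite ler1n.
by rewrite invr_ge0 invf_le1; lra.
Qed.

Lemma cf_level_exists I n (l : seq R) : I `<=` [set k | (0 < k)%N] ->
  {in l, forall z, cf_set R I z} -> exists M, {in l, forall z, cf_level I n M z}.
Proof.
move=> hI; have one z : cf_set R I z -> exists M, cf_level I n M z.
  elim: n z => [|n IH] z /=; first by exists 0%N.
  move=> /(cf_set_tail hI)[b [z' [Ib /IH[M hM] ->]]]; exists (maxn b M), b, z'.
  by split; rewrite ?leq_maxl//; apply: cf_level_le hM; rewrite leq_maxr.
elim: l => [|a l IH] hl; first by exists 0%N.
have [M1 h1] := one a (hl _ (mem_head _ _)).
have [|M2 h2] := IH; first by move=> z zl; apply: hl; rewrite inE zl orbT.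
exists (maxn M1 M2) => z; rewrite inE => /orP[/eqP->|/h2].
  by apply: cf_level_le h1; rewrite leq_maxl.
by apply: cf_level_le; rewrite leq_maxr.
Qed.

Lemma mval_image_small u (E : set R) r : mvalid u -> (forall x, E x -> 0 <= x <= 1) ->
  0 < r -> mlen u <= r -> packing_le r (mval u @` E) 2.
Proof.
move=> vu hE r0 ur; apply: (@packing_leS _ r r _ (mval u @` E) _ (r / r + 1)) => //.
  by rewrite divff ?gt_eqF//; lra.
apply: packing_le_diam => // [|_ _ [x Ex <-] [y Ey <-]]; first exact: ltW.
by apply: le_trans ur; apply: mval_diam => //; exact: hE.
Qed.

Lemma mlen_le_inv_sq u : mvalid u -> mlen u <= (mq u ^+ 2)^-1.
Proof.
move=> vu; rewrite mlenE//; have [q1 q0 qq _] := vu.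
have h : 0 < mq u by lra.
by rewrite lef_pV2 ?posrE ?exprn_gt0// ?mulr_gt0//; nra.
Qed.

Lemma sq_powR (x s : R) : 0 <= x -> (x ^+ 2) `^ s = x `^ (2 * s).
Proof. by move=> x0; rewrite powRrM powR_mulrn. Qed.

Lemma weightE (r q s : R) : 0 < r -> 0 < q ->
  (r * q ^+ 2) `^ (- s) = r `^ (- s) * q `^ (- (2 * s)).
Proof.
by move=> r0 q0; rewrite powRM ?exprn_ge0 ?ltW// sq_powR ?ltW// mulrN.
Qed.

Lemma packing_le_mval u (E : set R) r B : mvalid u -> (forall x, E x -> 0 <= x) ->
  packing_le (r * mq u ^+ 2) E B -> packing_le r (mval u @` E) B.
Proof.
move=> vu E0 hE; have [q1 _ _ _] := vu.
apply: (@packing_le_image _ _ _ _ _ (mq u ^+ 2)^-1); last by rewrite invrK.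
  by rewrite invr_gt0 exprn_gt0// (lt_le_trans ltr01).
by move=> x y /E0 x0 /E0 y0; exact: mval_dist_le.
Qed.

(** The threshold 4 gives r 4^k >= 1 for the block of b, as b < 2^(k+1): these are far digits. *)
Definition large_digits I r : set R := [set x | exists b z,
  [/\ I b, 4 <= r * b%:R ^+ 2, 0 <= z <= 1 & x = (b%:R + z)^-1]].

Lemma large_digits_in01 I r x : I `<=` [set k | (0 < k)%N] -> large_digits I r x -> 0 <= x <= 1.
Proof.
move=> hI [b [z [/hI/= b0 _ /andP[z0 z1] ->]]].
have b1 : 1 <= b%:R :> R by rewrite ler1n.
by rewrite invr_ge0 invf_le1; lra.
Qed.

Lemma packing_large_digits I (alpha D s : R) : 0 < alpha < 1 -> 1 <= D ->
  sparse_blocks I alpha D -> alpha / 2 < s < 1 ->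
  exists C : R, forall r, 0 < r <= 1 -> packing_le r (large_digits I r) (C * r `^ (- s)).
Proof.
move=> a01 D1 hD /andP[sa s1].
have hI : I `<=` [set k | (0 < k)%N] by move=> b /hD[].
pose s' := (alpha / 2 + s) / 2.
have s'01 : alpha / 2 < s' < 1 by rewrite /s'; apply/andP; split; lra.
have [C0 C00 logC] := log_absorb (ltac:(rewrite /s'; lra) : 0 < s - s').
exists (C0 * (D + 2)) => r r01; have /andP[r0 r1] := r01; have [n [rn nC]] := logC r r01.
apply: packing_leS (packing_far (ell := 1) (E := large_digits I r) a01 D1 hD s'01 r01 rn r1 _ _) => //.
- rewrite powR1 mulr1.
  have -> : C0 * (D + 2) * r `^ (- s) = C0 * r `^ (- (s - s')) * ((D + 2) * r `^ (- s')).
    rewrite [in LHS](_ : - s = - (s - s') + - s'); last by ring.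
    by rewrite powRD ?(gt_eqF r0) ?implybT//; ring.
  by rewrite ler_wpM2r// mulr_ge0 ?powR_ge0//; lra.
- move=> x y /(large_digits_in01 hI)/andP[? ?] /(large_digits_in01 hI)/andP[? ?].
  by rewrite ler_norml; apply/andP; split; lra.
- move=> x [b [z [Ib rb z01 ->]]]; have b0 := hI _ Ib.
  exists b; last exact: cyl_inv.
  split=> //; have bX := le_trans (ltac:(by rewrite ler_nat) : b%:R <= b.+1%:R :> R) (pow2_gt R b).
  have := le_trans rb (ler_wpM2l (ltW r0) (lerXn2r 2 _ _ bX)).
  rewrite !nnegrE ler0n mulr_ge0 ?exprn_ge0// => /(_ isT isT).
  rewrite exprMn mulrCA (_ : 2 ^+ 2 = 4); last by ring.
  by rewrite -[leLHS]mulr1 ler_pM2l.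
Qed.

(** The value 16 comes from the recursion: only digits with r q^2 b^2 < 4 are followed, and the next
    denominator is at most 2 b q. *)
Lemma two_le_weight (r q s C : R) : 0 < r -> 0 < q -> r * q ^+ 2 <= 16 -> 0 < s <= 1 ->
  32 <= C -> 2 <= C * (r `^ (- s) * q `^ (- (2 * s))).
Proof.
move=> r0 q0 rq /andP[s0 s1] C32; rewrite -weightE//.
have p : 0 < r * q ^+ 2 by rewrite mulr_gt0 ?exprn_gt0.
rewrite powRN ler_pdivlMr ?powR_gt0//.
have h : (r * q ^+ 2) `^ s <= 16.
  apply: le_trans (ge0_ler_powR (ltW s0) _ _ rq) _; rewrite ?nnegrE ?(ltW p)//.
  by apply: ler1_powR => //; lra.
by have := powR_ge0 (r * q ^+ 2) s; lra.
Qed.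

Section CfLevel.
Variables (I : set nat) (s r C1 C : R) (M : nat).
Hypotheses (hI : I `<=` [set k | (0 < k)%N]) (s01 : 0 < s <= 1) (r0 : 0 < r).
Hypotheses (C32 : 32 <= C) (C1C : C1 <= C).
Hypothesis hlarge : forall d, 0 < d <= 1 ->
  packing_le d (large_digits I d) (C1 * d `^ (- s)).

Definition cf_level_weight n u := C * r `^ (- s) * \sum_(k < n.+1) psum (digits I M) s k (mq u) (mq' u).

Lemma cf_level_weightS n u : cf_level_weight n.+1 u =
  C * (r `^ (- s) * mq u `^ (- (2 * s))) + \sum_(b <- digits I M) cf_level_weight n (mchild u b).
Proof.
rewrite /cf_level_weight big_ord_recl /= mulrDr -!mulrA; congr (_ + _).
by rewrite exchange_big /= !mulr_sumr; apply: eq_bigr => b _; rewrite mulrA.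
Qed.

Lemma cf_level_weight_ge n u : mvalid u ->
  C * (r `^ (- s) * mq u `^ (- (2 * s))) <= cf_level_weight n u.
Proof.
move=> vu; have C0 : 0 <= C by apply: le_trans C32.
rewrite /cf_level_weight big_ord_recl /= mulrDr -mulrA lerDl mulr_ge0 ?mulr_ge0 ?powR_ge0//.
by apply: sumr_ge0 => k _; apply: sumr_ge0 => b _; exact: psum_ge0.
Qed.

Lemma packing_cf_level_small n u : mvalid u -> r * mq u ^+ 2 <= 16 -> mlen u <= r ->
  packing_le r (mval u @` cf_level I n M) (cf_level_weight n u).
Proof.
move=> vu q16 ur; apply: (@packing_leS _ r r _ (mval u @` cf_level I n M) _ 2) => //.
  apply: le_trans (cf_level_weight_ge n vu); apply: two_le_weight => //.
  by have [q1 _ _ _] := vu; apply: lt_le_trans q1.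
by apply: mval_image_small => // x; exact: cf_level_in01.
Qed.

(** Once r q^2 >= 1 the cylinder is shorter than r and holds at most two packed points. Before that,
    the large digits are treated together by [hlarge] at the magnified scale r q^2, and the others
    recursively. *)
Lemma packing_cf_level n u : mvalid u -> r * mq u ^+ 2 <= 16 ->
  4 / ((mq u + mq' u) ^+ 2 * (9 / 4) ^+ n) <= r ->
  packing_le r (mval u @` cf_level I n M) (cf_level_weight n u).
Proof.
elim: n u => [|n IH] u vu q16 small.
  apply: packing_cf_level_small => //.
  by apply: le_trans small; rewrite expr0 mulr1; exact: mlen_le.
have [q1 q0 qq _] := vu; have q0' : 0 < mq u by apply: lt_le_trans q1.
have q20 : 0 < mq u ^+ 2 by rewrite exprn_gt0.
have [rq|rq] := leP 1 (r * mq u ^+ 2).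
  apply: packing_cf_level_small => //; apply: le_trans (mlen_le_inv_sq vu) _.
  by rewrite -[leLHS]mul1r ler_pdivrMr.
have rq0 : 0 < r * mq u ^+ 2 by rewrite mulr_gt0.
have C0 : 0 <= C by apply: le_trans C32.
rewrite cf_level_weightS.
pose G b : set R := if r * mq u ^+ 2 * b%:R ^+ 2 < 4
   then mval (mchild u b) @` cf_level I n M else set0.
apply: (@packing_leU _ r _ (mval u @` large_digits I (r * mq u ^+ 2))
  [set x | exists2 b, b \in digits I M & G b x]).
- move=> _ [_ [b [z' [Ib bM z'F ->]]] <-].
  have z'01 := cf_level_in01 hI z'F.
  have [big|small'] := leP 4 (r * mq u ^+ 2 * b%:R ^+ 2); [left|right].
    by exists (b%:R + z')^-1 => //; exists b, z'.
  exists b; first by rewrite mem_digits asboolT//= bM andbT; exact: hI.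
  rewrite /G small'; exists z' => //; rewrite mval_child//; first exact: hI.
  by case/andP: z'01.
- apply: packing_le_mval => //.
    by move=> x /(large_digits_in01 hI)/andP[].
  apply: packing_leS (hlarge (ltac:(by rewrite rq0 ltW) : 0 < r * mq u ^+ 2 <= 1)) => //.
  by rewrite weightE// ler_wpM2r// mulr_ge0 ?powR_ge0.
apply: (@packing_le_sum _ _ _ _ _ G) => // b bD.
have b0 := digits_gt0 bD; have vb := mvalid_child b0 vu.
rewrite /G; have [hb|_] := ltP (r * mq u ^+ 2 * b%:R ^+ 2) 4; last first.
  move=> [|x w] _ hw; last by have := hw x (mem_head _ _).
  by apply: le_trans (cf_level_weight_ge n vb); rewrite !mulr_ge0 ?powR_ge0.
apply: (IH _ vb); last exact: le_trans (mgrowth_bound n b0 vu) small.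
have b1 : 1 <= b%:R :> R by rewrite ler1n.
rewrite /=; move: (b%:R : R) b1 hb => x x1 hx.
have hq : x * mq u + mq' u <= 2 * (x * mq u).
  by rewrite mulr_natl mulr2n lerD2l (le_trans qq)// ler_peMl// ltW.
have h0 : 0 <= x * mq u + mq' u by rewrite addr_ge0// mulr_ge0 ?(ltW q0')// (le_trans _ x1).
have := ler_wpM2l (ltW r0) (lerXn2r 2 h0 (le_trans h0 hq) hq).
have -> : r * (2 * (x * mq u)) ^+ 2 = 4 * (r * mq u ^+ 2 * x ^+ 2) by ring.
move=> /le_trans; apply; rewrite (_ : 16 = 4 * 4); last by ring.
by rewrite ler_pM2l// ltW.
Qed.

End CfLevel.

(* Cutting words when r q^2 first exceeds 1 and covering the infinitely many long
   last digits by packing_far bounds the packing number of the limit set by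
   r^(-s) times the sum over all words of q^(-2s). *)
Lemma packing_cf_le I (alpha D s : R) : 0 < alpha < 1 -> 1 <= D ->
  sparse_blocks I alpha D -> alpha / 2 < s < 1 -> psum_bounded I s ->
  exists2 C : R, 0 < C & forall r, 0 < r <= 1 -> packing_le r (cf_set R I) (C * r `^ (- s)).
Proof.
move=> a01 D1 hD s01 [Y hY].
have hI : I `<=` [set k | (0 < k)%N] by move=> b /hD[].
have /andP[a0 a1] := a01; have /andP[sa s1] := s01.
have s01' : 0 < s <= 1 by apply/andP; split; lra.
have [C1 hfar] := packing_large_digits a01 D1 hD s01.
pose C2 := Num.max C1 32.
have C232 : 32 <= C2 by rewrite le_max lexx orbT.
have C21 : C1 <= C2 by rewrite le_max lexx.
have Y0 : 0 <= Y by apply: le_trans (hY 0%N 0%N); rewrite big_ord0.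
exists (C2 * (Y + 1)); first by rewrite mulr_gt0; lra.
move=> r /andP[r0 r1] l hl hlF.
have [n hn] := mlen_small r0.
have [M hM] := cf_level_exists n hI hlF.
have vr := mvalid_root R.
have : packing_le r (mval (mroot R) @` cf_level I n M)
     (C2 * r `^ (- s) * \sum_(k < n.+1) psum (digits I M) s k 1 0).
  apply: (packing_cf_level (M := M) (n := n) hI s01' r0 C232 C21 hfar vr) => /=.
    by rewrite expr1n; lra.
  by rewrite addr0 expr1n mul1r ltW.
move=> /(_ l hl) h; apply: le_trans (h _) _.
  by move=> z zl; exists z; [exact: hM|exact: mval_root].
rewrite [leRHS]mulrAC; apply: ler_wpM2l; first by rewrite mulr_ge0 ?powR_ge0//; lra.
by apply: le_trans (hY _ _) _; lra.
Qed.

End PackingOfLimitSet.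

(** * Packing numbers in an interval *)

Section IntervalPacking.
Variable R : realType.
Implicit Types (I : set nat) (s r c d : R) (u : mob R).

(** A monotone step function equal to 1 on [c, d]: a cylinder that meets [c, d] without lying in it
    has variation at least 1, while the total variation is at most 2. *)
Definition straddle c d (x : R) : R := (c <= x)%R%:R + (d < x)%R%:R.

Lemma straddle_homo c d : {homo straddle c d : x y / x <= y}.
Proof.
move=> x y xy; apply: lerD; rewrite ler_nat.
  by case: (leP c x) => // cx; rewrite (le_trans cx xy).
by case: (ltP d x) => // dx; rewrite (lt_le_trans dx xy).
Qed.

Lemma straddle_le2 c d x y : `|straddle c d x - straddle c d y| <= 2.
Proof.
rewrite /straddle ler_norml.
by case: (c <= x); case: (d < x); case: (c <= y); case: (d < y) => /=; apply/andP; split; lra.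
Qed.

Lemma mval_between u x : mvalid u -> 0 <= x <= 1 ->
  mval u 0 <= mval u x <= mval u 1 \/ mval u 1 <= mval u x <= mval u 0.
Proof.
move=> vu /andP[x0 x1]; have [_ _ _ /eqP] := vu.
have den y z : 0 <= y -> 0 <= z -> 0 <= ((mq u + y * mq' u) * (mq u + z * mq' u))^-1.
  by move=> y0 z0; rewrite invr_ge0 ltW// mulr_gt0 ?mden_gt0.
rewrite sqrf_eq1 => /orP[]/eqP e; [left|right]; apply/andP; split;
  rewrite -subr_ge0 mval_sub// e mulr_ge0 ?den//; lra.
Qed.

Lemma straddle_cut c d u x : mvalid u -> 0 <= x <= 1 -> c <= mval u x <= d ->
  ~ ((c <= mval u 0 <= d) /\ (c <= mval u 1 <= d)) ->
  1 <= variation (straddle c d) u.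
Proof.
move=> vu x01 /andP[cx xd] nin; rewrite /variation.
have key e0 e1 : e0 <= mval u x <= e1 -> ~ ((c <= e0 <= d) /\ (c <= e1 <= d)) ->
    1 <= straddle c d e1 - straddle c d e0.
  move=> /andP[l0 l1] {}nin; rewrite /straddle.
  rewrite (le_trans cx l1) (ltNge d e0) (le_trans l0 xd) /= addr0.
  have [ce0|ce0] := leP c e0; last by rewrite subr0 lerDl ler0n.
  have [de1|de1] := ltP d e1; first by rewrite addrK.
  exfalso; apply: nin; split; apply/andP; split => //.
    exact: le_trans xd.
  exact: le_trans l1.
have [h|h] := mval_between vu x01.
  by rewrite distrC; apply: le_trans (ler_norm _); exact: key.
by apply: le_trans (ler_norm _); apply: key => // -[h1 h2]; apply: nin.
Qed.

Lemma packing_le_fin (r : R) (E : set R) B :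
  (forall l : seq R, {in l, forall x, E x} -> packing_le r [set x | x \in l] B) ->
  packing_le r E B.
Proof. by move=> h l hl lE; apply: (h l lE l hl). Qed.

Definition step_const (D A : R) := (D + 2) + 8 * (D + 1) * A.

Lemma step_const_ge2 (D A : R) : 1 <= D -> 0 <= A -> 2 <= step_const D A.
Proof.
move=> D1 A0; have : 0 <= (D + 1) * A by rewrite mulr_ge0//; lra.
by rewrite /step_const; lra.
Qed.

Lemma step_bound_ge2 (alpha s D A r ell : R) n : 0 < alpha < 1 -> alpha / 2 < s < 1 ->
  1 <= D -> 0 <= A -> 0 < r <= 1 -> r <= ell ->
  2 <= n.+2%:R * step_const D A * (r `^ (- s) * (4 * ell) `^ expo_t alpha s).
Proof.
move=> a01 s01 D1 A0 r01 rl; have /andP[r0 _] := r01.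
have rl4 : r <= 4 * ell by lra.
have T1 := one_le_scale a01 s01 r01 rl4.
have h2 : 1 * 2 <= n.+2%:R * step_const D A by apply: ler_pM; rewrite ?ler1n ?step_const_ge2.
have : 1 * 2 * 1 <= n.+2%:R * step_const D A * (r `^ (- s) * (4 * ell) `^ expo_t alpha s).
  by apply: ler_pM.
by rewrite mul1r mulr1.
Qed.

(** Magnification by q changes the bound by the factor q^(t-s) <= 1. *)
Lemma scale_weight (alpha s r ell q : R) : 0 < alpha < 1 -> alpha / 2 < s < 1 ->
  0 < r -> 0 < ell -> 1 <= q ->
  (r * q) `^ (- s) * (4 * q * ell) `^ expo_t alpha s <=
  r `^ (- s) * (4 * ell) `^ expo_t alpha s.
Proof.
move=> a01 s01 r0 l0 q1; have /andP[t0 ts] := expo_t_bounds a01 s01.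
have q0 : 0 < q by apply: lt_le_trans q1.
have l4 : 0 <= 4 * ell by rewrite mulr_ge0// ltW.
rewrite (_ : 4 * q * ell = 4 * ell * q); last by ring.
rewrite (@powRM _ r) ?(ltW r0) ?(ltW q0)// (@powRM _ (4 * ell)) ?(ltW q0)//.
rewrite mulrACA ler_piMr ?mulr_ge0 ?powR_ge0//.
rewrite -powRD ?(gt_eqF q0) ?implybT// -[leRHS](powRr0 q) ler_powR//.
by rewrite addrC subr_le0.
Qed.

Definition inside u c d : set R := [set x | c <= mval u x <= d].

Lemma inside_dist u c d (ell x y : R) : mvalid u -> d - c <= ell ->
  0 <= x <= 1 -> 0 <= y <= 1 -> inside u c d x -> inside u c d y ->
  `|x - y| <= 4 * mq u ^+ 2 * ell.
Proof.
move=> vu dc x01 y01 /andP[? ?] /andP[? ?]; apply: le_trans (mval_dist_ge vu x01 y01) _.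
have q20 : 0 <= 4 * mq u ^+ 2 by apply: mulr_ge0 => //; exact: sqr_ge0.
rewrite ler_wpM2l//; apply: le_trans dc.
by rewrite ler_norml; apply/andP; split; lra.
Qed.

(** * One level of the recursion, for arbitrary pieces of the first-level cylinders *)

Section OneStep.
Variables (I : set nat) (alpha D s A : R) (Eb : nat -> set R).
Hypotheses (a01 : 0 < alpha < 1) (D1 : 1 <= D) (hD : sparse_blocks I alpha D).
Hypotheses (s01 : alpha / 2 < s < 1) (A0 : 0 <= A).
Hypothesis Ecyl : forall b, I b -> Eb b `<=` cyl b.
Hypothesis hEb : forall b r, I b -> 0 < r -> r * b%:R ^+ 2 <= 4 ->
  packing_le r (Eb b) (A * (r * b%:R ^+ 2) `^ (- s)).

Let t := expo_t alpha s.

Let E := \bigcup_(b in I) Eb b.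

Lemma bigcup_in01 x : E x -> 0 <= x <= 1.
Proof.
move=> [b Ib /(Ecyl Ib)/andP[x1 x2]]; rewrite (le_trans _ x1) ?invr_ge0//=.
by apply: le_trans x2 _; rewrite invf_le1 ?ltr0n ?ler1n; have [] := hD Ib.
Qed.

Lemma bigcup_block b x : I b -> Eb b x -> E x.
Proof. by move=> Ib Ex; exists b. Qed.

Definition step_far u r c d : set R := [set x | inside u c d x /\
  exists b, [/\ I b, Eb b x & 1 <= r * mq u ^+ 2 * pow2 R b ^+ 2]].

Definition step_sel u r c d b := [/\ I b, r * mq u ^+ 2 * pow2 R b ^+ 2 < 1,
  inside u c d b%:R^-1 & inside u c d b.+1%:R^-1].

Definition step_near u r c d : set R := [set x | exists2 b, step_sel u r c d b & Eb b x].

Section Scale.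
Variables (u : mob R) (r ell c d : R) (n : nat).
Hypotheses (vu : mvalid u) (r0 : 0 < r) (rn : r^-1 <= 2 ^+ n) (rl : r <= ell).
Hypotheses (dc : d - c <= ell) (rq : r * mq u ^+ 2 < 1).

Let q21 : 1 <= mq u ^+ 2.
Proof. by have [q1 _ _ _] := vu; exact: exprn_ege1. Qed.

Let l0 : 0 < ell.
Proof. exact: lt_le_trans rl. Qed.

Let q20 : 0 < mq u ^+ 2.
Proof. exact: lt_le_trans q21. Qed.

Let rq0 : 0 < r * mq u ^+ 2.
Proof. exact: mulr_gt0. Qed.

Let rqn : (r * mq u ^+ 2)^-1 <= 2 ^+ n.
Proof. by apply: le_trans rn; rewrite lef_pV2 ?posrE// ler_peMr// ltW. Qed.

Lemma packing_step_far : packing_le r (mval u @` step_far u r c d)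
  (n.+2%:R * ((D + 2) * (r `^ (- s) * (4 * ell) `^ t))).
Proof.
apply: packing_le_mval => //.
  by move=> x [_ [b [Ib Ex _]]]; case/andP: (bigcup_in01 (bigcup_block Ib Ex)).
have rq01 : 0 < r * mq u ^+ 2 <= 1 by rewrite rq0 ltW.
have rlq : r * mq u ^+ 2 <= 4 * mq u ^+ 2 * ell.
  rewrite mulrAC [leLHS]mulrC [leRHS]mulrC ler_pM2l//.
  by apply: le_trans rl _; rewrite ler_peMl ?(ltW l0)// ler1n.
apply: packing_leS (packing_far (E := step_far u r c d) a01 D1 hD s01 rq01 rqn rlq _ _) => //.
- rewrite ler_wpM2l// ler_wpM2l ?(scale_weight a01 s01 r0 l0 q21)//.
  by rewrite addr_ge0// (le_trans ler01 D1).
- move=> x y [ix [b [Ib Ex _]]] [iy [b' [Ib' Ey _]]].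
  by apply: (inside_dist vu dc _ _ ix iy); apply: bigcup_in01;
    [exact: bigcup_block Ib Ex|exact: bigcup_block Ib' Ey].
- by move=> x [_ [b [Ib Ex rb]]]; exists b => //; exact: Ecyl Ex.
Qed.

Lemma packing_step_near : packing_le r (mval u @` step_near u r c d)
  (n.+2%:R * (8 * (D + 1) * A * (r `^ (- s) * (4 * ell) `^ t))).
Proof.
apply: packing_le_mval => //.
  by move=> x [b [Ib _ _ _] Ex]; case/andP: (bigcup_in01 (bigcup_block Ib Ex)).
have rq01 : 0 < r * mq u ^+ 2 <= 1 by rewrite rq0 ltW.
have lq0 : 0 < 4 * mq u ^+ 2 * ell by rewrite mulr_gt0// mulr_gt0.
have inv01 b : (0 < b)%N -> 0 <= (b%:R^-1 : R) <= 1.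
  by move=> b0; rewrite invr_ge0 ler0n invf_le1 ?ltr0n ?ler1n.
have C0 : 0 <= 8 * (D + 1) * A.
  by rewrite mulr_ge0// mulr_ge0// addr_ge0// (le_trans ler01 D1).
apply: packing_leS (packing_near (E := step_near u r c d) (Sel := step_sel u r c d)
   (Eb := Eb) (n := n) a01 D1 hD s01 rq01 rqn lq0 A0 _ _ _ _) => //.
- apply: ler_pM; rewrite ?ler_nat//; first by rewrite mulr_ge0// mulr_ge0 ?powR_ge0.
  by rewrite ler_wpM2l// (scale_weight a01 s01 r0 l0 q21).
- by move=> b [].
- move=> b b' [Ib _ ib _] [Ib' _ _ ib']; apply: le_trans (ler_norm _) _.
  apply: (inside_dist vu dc _ _ ib ib'); apply: inv01 => //.
  by have [] := hD Ib.
- move=> b [Ib rb _ _]; apply: hEb => //.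
  have bX : b%:R <= 2 * pow2 R b by apply: le_trans (pow2_gt R b); rewrite ler_nat.
  have := ler_wpM2l (ltW rq0) (lerXn2r 2 (ler0n R b) (le_trans (ler0n R b) bX) bX).
  move=> /le_trans; apply; rewrite exprMn mulrCA (_ : 2 ^+ 2 = 4); last by ring.
  by rewrite ler_piMr// ltW.
Qed.

Lemma step_cover z b : I b -> Eb b z -> inside u c d z ->
  [\/ step_far u r c d z, step_near u r c d z |
     1 <= variation (straddle c d) (mchild u b)].
Proof.
move=> Ib Ez iz; have [b0 _] := hD Ib.
have [rb|rb] := leP 1 (r * mq u ^+ 2 * pow2 R b ^+ 2).
  by apply: Or31; split => //; exists b.
have [[ib ib1]|nib] := pselect (inside u c d b%:R^-1 /\ inside u c d b.+1%:R^-1).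
  by apply: Or32; exists b.
apply: Or33; have /andP[z1 z2] := Ecyl Ib Ez.
have z0 : 0 < z by apply: lt_le_trans z1; rewrite invr_gt0 ltr0n.
have b0' : 0 < b%:R :> R by rewrite ltr0n.
have y01 : 0 <= z^-1 - b%:R <= 1.
  rewrite subr_ge0 lerBlDr addrC natr1; apply/andP; split.
    by rewrite -[leLHS]invrK lef_pV2 ?posrE ?invr_gt0.
  by rewrite -[leRHS]invrK lef_pV2 ?posrE ?invr_gt0 ?ltr0n.
have vb := mvalid_child b0 vu.
apply: (straddle_cut vb y01).
  by rewrite mval_child//; [rewrite addrC subrK invrK|case/andP: y01].
by rewrite !mval_child// addr0 natr1.
Qed.

End Scale.

(** A child that is neither far nor contained in [c, d] is cut by an endpoint. Charging X per unit
    of variation to the cut children costs at most X times the variation of u, however many digits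
    there are. *)
Lemma packing_step (r ell c d X : R) n u : mvalid u ->
  0 < r <= 1 -> r^-1 <= 2 ^+ n -> r <= ell -> d - c <= ell ->
  (forall b, I b -> 1 <= variation (straddle c d) (mchild u b) ->
     packing_le r (mval u @` Eb b `&` [set x | c <= x <= d])
        (X * variation (straddle c d) (mchild u b))) -> 0 <= X ->
  packing_le r (mval u @` (\bigcup_(b in I) Eb b) `&` [set x | c <= x <= d])
    (n.+2%:R * step_const D A * (r `^ (- s) * (4 * ell) `^ t) +
       X * variation (straddle c d) u).
Proof.
move=> vu r01 rn rl dc hbad X0; have /andP[r0 r1] := r01.
have v0 : 0 <= X * variation (straddle c d) u by rewrite mulr_ge0// normr_ge0.
have [rq|rq] := leP 1 (r * mq u ^+ 2).
  apply: (@packing_leS _ r r _ (mval u @` E) _ 2) => //.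
    by apply: ler_wpDr => //; exact: step_bound_ge2 a01 s01 D1 A0 r01 rl.
  apply: mval_image_small => //; first exact: bigcup_in01.
  apply: le_trans (mlen_le_inv_sq vu) _.
  by rewrite -[leLHS]mul1r ler_pdivrMr// exprn_gt0//; case: vu => /(lt_le_trans ltr01).
have hFar := packing_step_far vu r0 rn rl dc rq.
have hNear := packing_step_near vu r0 rn rl dc rq.
apply: packing_le_fin => l lE.
have [M hM] : exists M, {in l, forall x, exists b z, [/\ I b, (b <= M)%N, Eb b z & mval u z = x]}.
  elim: l lE => [|a l IH] lE; first by exists 0%N.
  have [|M hM] := IH; first by move=> x xl; apply: lE; rewrite inE xl orbT.
  have [[z [b Ib Ez] za] _] := lE a (mem_head _ _).
  exists (maxn b M) => x; rewrite inE => /orP[/eqP->|/hM[b' [z' [Ib' b'M Ez' zx']]]].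
    by exists b, z; split => //; rewrite leq_maxl.
  by exists b', z'; split => //; rewrite leq_max b'M orbT.
set T := r `^ (- s) * (4 * ell) `^ t in hFar hNear *.
have -> : n.+2%:R * step_const D A * T = n.+2%:R * ((D + 2) * T) + n.+2%:R * (8 * (D + 1) * A * T).
  by rewrite /step_const; ring.
pose Bad b : set R := if 1 <= variation (straddle c d) (mchild u b)
  then mval u @` Eb b `&` [set x | c <= x <= d] else set0.
apply: (@packing_leU _ r _ (mval u @` step_far u r c d `|` mval u @` step_near u r c d)
  [set x | exists2 b, b \in digits I M & Bad b x]).
- move=> x /= xl; have [b [z [Ib bM Ez zx]]] := hM x xl; have [_ xcd] := lE x xl.
  have iz : inside u c d z by rewrite /inside /= zx.
  have [fz|nz|bz] := step_cover r vu Ib Ez iz; [by left; left; exists z|by left; right; exists z|].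
  right; exists b; first by rewrite mem_digits asboolT//= bM andbT; have [] := hD Ib.
  by rewrite /Bad bz; split => //; exists z.
- exact: packing_leU hFar hNear.
have vD : \sum_(b <- digits I M) X * variation (straddle c d) (mchild u b) <=
    X * variation (straddle c d) u.
  rewrite -mulr_sumr ler_wpM2l//; apply: variation_children => //.
  - exact: digits_uniq.
  - exact: digits_gt0.
  - exact: straddle_homo.
move=> l' hl' hE'; apply: le_trans vD; move: l' hl' hE'.
apply: (@packing_le_sum _ _ _ _ _ Bad) => // b bD.
have [hb|hb] := leP 1 (variation (straddle c d) (mchild u b)).
  by rewrite /Bad hb; apply: hbad hb; apply: (digits_sub bD).
rewrite /Bad leNgt hb /=.
move=> [|x w] _ hw; last by have := hw x (mem_head _ _).
by rewrite /= mulr_ge0// normr_ge0.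
Qed.

End OneStep.

End IntervalPacking.

(** * Packing bounds in the scale and the interval length *)

Section PackingGrowth.
Variable R : realType.
Implicit Types (I : set nat) (s t r ell c d : R) (E : set R) (u : mob R).

Definition packing_growth E s t := exists2 C : R, 0 < C &
  forall r ell c d, 0 < r <= 1 -> r <= ell -> d - c <= ell ->
    packing_le r (E `&` [set x | c <= x <= d]) (C * (r `^ (- s) * ell `^ t)).

(* The polylogarithmic factor n^2 ~ log(1/r)^2 costs an arbitrarily small power of r. *)
Lemma packing_growth_log E s t (C e : R) : 0 < C -> 0 <= t -> 0 < e ->
  (forall r ell c d n, 0 < r <= 1 -> r <= ell -> d - c <= ell -> r^-1 <= 2 ^+ n ->
     packing_le r (E `&` [set x | c <= x <= d])
       (C * n.+2%:R ^+ 2 * (r `^ (- s) * (4 * ell) `^ t))) ->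
  packing_growth E (s + e) t.
Proof.
move=> C0 t0 e0 H.
have [K K0 hK] := log_absorb (divr_gt0 e0 (ltr0n R 2)).
exists (C * K ^+ 2 * 4 `^ t); first by rewrite !mulr_gt0 ?powR_gt0.
move=> r ell c d r01 rl dc; have [n [rn nK]] := hK r r01.
have /andP[r0 r1] := r01; have l0 : 0 <= ell by lra.
apply: packing_leS (H r ell c d n r01 rl dc rn) => //.
rewrite powRM//.
have -> : C * K ^+ 2 * 4 `^ t * (r `^ (- (s + e)) * ell `^ t) =
   C * (K * r `^ (- (e / 2))) ^+ 2 * (r `^ (- s) * (4 `^ t * ell `^ t)).
  have -> : - (s + e) = - (e / 2) + - (e / 2) + - s by field.
  by rewrite !powRD ?(gt_eqF r0) ?implybT//; ring.
rewrite ler_wpM2r ?mulr_ge0 ?powR_ge0//.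
by rewrite ler_pM2l// lerXn2r ?nnegrE// mulr_ge0 ?powR_ge0// ltW.
Qed.

Lemma cf_set_bigcup I : I `<=` [set k | (0 < k)%N] ->
  \bigcup_(b in I) ((fun z => (b%:R + z)^-1) @` cf_set R I) = cf_set R I.
Proof.
move=> hI; apply/seteqP; split=> [_ [b Ib [z Fz <-]]|z /(cf_set_tail hI)[b [z' [Ib z'F ->]]]].
  exact: cf_set_cons.
by exists b => //; exists z'.
Qed.

Lemma inv_dist_le (b : nat) (x y : R) : (0 < b)%N -> 0 <= x -> 0 <= y ->
  `|(b%:R + x)^-1 - (b%:R + y)^-1| <= (b%:R ^+ 2)^-1 * `|x - y|.
Proof.
move=> b0 x0 y0; have vr := mvalid_root R; have vb := mvalid_child b0 vr.
have := mval_dist_le vb x0 y0; rewrite !mval_child// !mval_root.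
by rewrite /= mulr1 addr0.
Qed.

Lemma cf_packing_growth I (alpha D s e : R) : 0 < alpha < 1 -> 1 <= D ->
  sparse_blocks I alpha D -> alpha / 2 < s < 1 -> psum_bounded I s -> 0 < e ->
  packing_growth (cf_set R I) (s + e) (expo_t alpha s).
Proof.
move=> a01 D1 hD s01 hs e0.
have hI : I `<=` [set k | (0 < k)%N] by move=> b /hD[].
have /andP[a0 a1] := a01; have /andP[s0 s1] := s01.
have /andP[t0 ts] := expo_t_bounds a01 s01; set t := expo_t alpha s in t0 ts *.
have [A' A'0 hA'] := packing_cf_le a01 D1 hD s01 hs.
pose A := A' + 8.
have A0 : 0 <= A by rewrite /A; lra.
(* [hEb] calls for scales up to 4. For 1 < r <= 4 there are at most 2 points and r^(-s) >= 1/4,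
   whence the summand 8 in [A]. *)
have hA r : 0 < r <= 4 -> packing_le r (cf_set R I) (A * r `^ (- s)).
  move=> /andP[r0 r4]; have [r1|r1] := leP r 1.
    apply: packing_leS (hA' r _) => //; last by rewrite r0.
    by rewrite ler_wpM2r ?powR_ge0// /A; lra.
  apply: (@packing_leS _ r r _ (cf_set R I) _ (1 / r + 1)) => //; last first.
    apply: packing_le_diam => // x y /cf_set_in01/andP[? ?] /cf_set_in01/andP[? ?].
    by rewrite ler_norml; apply/andP; split; lra.
  have r1i : 1 / r <= 1 by rewrite ler_pdivrMr// mul1r ltW.
  have : r `^ s <= 4.
    apply: le_trans (_ : r `^ 1 <= _); last by rewrite powRr1// ltW.
    by apply: ler_powR; exact: ltW.
  have rs0 : 0 < r `^ s by rewrite powR_gt0.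
  have A8 : 8 <= A by rewrite /A; lra.
  rewrite powRN ler_pdivlMr// => rs4; nra.
pose Eb b : set R := (fun z => (b%:R + z)^-1) @` cf_set R I.
have Ecyl b : I b -> Eb b `<=` cyl b.
  by move=> Ib _ [z Fz <-]; apply: cyl_inv; [exact: hI|exact: cf_set_in01 Fz].
have hEb b r : I b -> 0 < r -> r * b%:R ^+ 2 <= 4 ->
    packing_le r (Eb b) (A * (r * b%:R ^+ 2) `^ (- s)).
  move=> Ib r0 rb; have b0 := hI _ Ib; have b2 : 0 < b%:R ^+ 2 :> R by rewrite exprn_gt0// ltr0n.
  apply: (@packing_le_image _ _ _ _ _ (b%:R ^+ 2)^-1); first by rewrite invr_gt0.
    by move=> x y /cf_set_in01/andP[x0 _] /cf_set_in01/andP[y0 _]; exact: inv_dist_le.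
  by rewrite invrK; apply: hA; rewrite rb mulr_gt0.
have FE := cf_set_bigcup hI.
have sc2 : 2 <= step_const D A by rewrite /step_const; nra.
apply: (@packing_growth_log _ _ _ (3 * step_const D A)) => //; first lra.
move=> r ell c d n r01 rl dc rn; have /andP[r0 r1] := r01.
pose T := n.+2%:R * step_const D A * (r `^ (- s) * (4 * ell) `^ t).
have rl4 : r <= 4 * ell by lra.
have T1 := one_le_scale a01 s01 r01 rl4; rewrite -/t in T1.
have n1 : 1 <= n.+2%:R :> R by rewrite ler1n.
have T2 : 2 <= T.
  have h2 : 1 * 2 <= n.+2%:R * step_const D A by apply: ler_pM.
  have : 1 * 2 * 1 <= T by apply: ler_pM => //; lra.
  lra.
(* One T for u itself, and one per unit of variation on each of the m remaining levels. *)
have key m u : mvalid u -> 4 / ((mq u + mq' u) ^+ 2 * (9 / 4) ^+ m) <= r ->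
    packing_le r (mval u @` cf_set R I `&` [set x | c <= x <= d])
      ((1 + m%:R * variation (straddle c d) u) * T).
  elim: m u => [|m IH] u vu small.
    apply: (@packing_leS _ r r _ (mval u @` cf_set R I) _ 2) => //.
    - by rewrite mul0r addr0 mul1r.
    - apply: mval_image_small => //; first by move=> x; exact: cf_set_in01.
      by apply: le_trans small; rewrite expr0 mulr1; exact: mlen_le.
  have := packing_step a01 D1 hD s01 A0 Ecyl hEb (X := m.+1%:R * T) vu r01 rn rl dc.
  rewrite FE -/t -/T => H.
  have -> : (1 + m.+1%:R * variation (straddle c d) u) * T =
     T + m.+1%:R * T * variation (straddle c d) u by ring.
  apply: H; last by rewrite mulr_ge0//; lra.
  move=> b Ib hb; have b0 := hI _ Ib; have vb := mvalid_child b0 vu.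
  apply: (@packing_leS _ r r _ (mval (mchild u b) @` cf_set R I `&` [set x | c <= x <= d]) _
     ((1 + m%:R * variation (straddle c d) (mchild u b)) * T)) => //.
  - move=> _ [[_ [z Fz <-] <-] cd]; split => //; exists z => //.
    by rewrite mval_child//; case/andP: (cf_set_in01 Fz).
  - rewrite mulrAC ler_wpM2r//; first by lra.
    by rewrite -natr1 mulrDl mul1r addrC lerD2l.
  exact: IH vb (le_trans (mgrowth_bound m b0 vu) small).
have vr := mvalid_root R.
(* Two levels more than n suffice, as (9/4)^2 > 4 and (9/4)^n >= 2^n >= 1/r. *)
have small : 4 / ((mq (mroot R) + mq' (mroot R)) ^+ 2 * (9 / 4) ^+ n.+2) <= r.
  rewrite /= addr0 expr1n mul1r.
  rewrite ler_pdivrMr ?exprn_gt0// -ler_pdivrMl//.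
  have h : 2 ^+ n <= (9 / 4) ^+ n :> R by rewrite lerXn2r ?nnegrE//; lra.
  have : r^-1 * 4 <= 2 ^+ n * 4 by rewrite ler_pM2r.
  have x0 : 0 <= 2 ^+ n :> R by rewrite exprn_ge0.
  rewrite !exprS => h1; move: h h1 x0; move: (2 ^+ n) ((9 / 4) ^+ n) => x y h h1 x0.
  apply: le_trans h1 _; lra.
apply: packing_leS (key n.+2 _ vr small) => //.
  by move=> x [Fx xcd]; split => //; exists x => //; exact: mval_root.
rewrite /T.
have v2 : variation (straddle c d) (mroot R) <= 2 by exact: straddle_le2.
have -> : 3 * step_const D A * n.+2%:R ^+ 2 * (r `^ (- s) * (4 * ell) `^ t) =
  (3 * n.+2%:R) * (n.+2%:R * step_const D A * (r `^ (- s) * (4 * ell) `^ t)) by ring.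
rewrite -/T ler_wpM2r//; first by lra.
nra.
Qed.

(* One point in each cylinder: the first-level part of packing_step suffices. *)
Lemma selection_packing_growth I E u (alpha D s e : R) : 0 < alpha < 1 -> 1 <= D ->
  sparse_blocks I alpha D -> alpha / 2 < s < 1 -> 0 < e -> mvalid u ->
  (forall x, E x -> exists2 b, I b & cyl b x) ->
  (forall b x y, I b -> E x -> cyl b x -> E y -> cyl b y -> x = y) ->
  packing_growth (mval u @` E) (s + e) (expo_t alpha s).
Proof.
move=> a01 D1 hD s01 e0 vu EI E1.
have /andP[a0 a1] := a01; have /andP[s0 s1] := s01.
have /andP[t0 ts] := expo_t_bounds a01 s01; set t := expo_t alpha s in t0 ts *.
pose Eb b : set R := E `&` cyl b.
(* The constant 4 serves as [A]: each cylinder holds a single point, and (r b^2)^s <= 4 when r b^2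
   <= 4. *)
have A0 : 0 <= 4 :> R by [].
have single b r (f : R -> R) (F : set R) : I b -> 0 < r -> F `<=` f @` Eb b -> packing_le r F 1.
  move=> Ib r0 FE l hl lF; have ul := spaced_uniq r0 hl.
  case: l hl lF ul => [|x [|y l]] //= _ lF /andP[+ _].
  have [x' [Ex cx] xE] := FE _ (lF x (mem_head _ _)).
  have [|y' [Ey cy] yE] := FE _ (lF y _); first by rewrite !inE eqxx orbT.
  by rewrite inE -xE -yE (E1 _ _ _ Ib Ex cx Ey cy) eqxx.
have hEb b r : I b -> 0 < r -> r * b%:R ^+ 2 <= 4 ->
    packing_le r (Eb b) (4 * (r * b%:R ^+ 2) `^ (- s)).
  move=> Ib r0 rb; apply: packing_leS (single b r id (Eb b) Ib r0 _) => //; last first.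
    by move=> x Ex; exists x.
  have [b0 _] := hD _ Ib; have p : 0 < r * b%:R ^+ 2 by rewrite mulr_gt0 ?exprn_gt0 ?ltr0n.
  rewrite powRN ler_pdivlMr ?powR_gt0// mul1r.
  apply: le_trans (ge0_ler_powR _ _ _ rb) _; rewrite ?nnegrE ?(ltW p)//; first lra.
  by apply: ler1_powR; lra.
have EE : E `<=` \bigcup_(b in I) Eb b by move=> x Ex; have [b Ib cb] := EI _ Ex; exists b.
have sc2 : 2 <= step_const D 4 by rewrite /step_const; lra.
apply: (@packing_growth_log _ _ _ (step_const D 4 + 2)) => //; first lra.
move=> r ell c d n r01 rl dc rn; have /andP[r0 r1] := r01.
have rl4 : r <= 4 * ell by lra.
have T1 := one_le_scale a01 s01 r01 rl4; rewrite -/t in T1.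
have n1 : 1 <= n.+2%:R :> R by rewrite ler1n.
apply: packing_leS (packing_step a01 D1 hD s01 A0 (Eb := Eb) _ hEb (X := 1) vu r01 rn rl dc _ _) => //.
- by move=> _ [[x Ex <-] xcd]; split => //; exists x => //; exact: EE.
- rewrite -/t; set T := r `^ (- s) * (4 * ell) `^ t in T1 *.
  have v2 : variation (straddle c d) u <= 2 by exact: straddle_le2.
  rewrite mul1r; apply: (@le_trans _ _ (n.+2%:R * step_const D 4 * T + 2 * T)); first lra.
  rewrite -mulrDl ler_wpM2r//; first by lra.
  move: (n.+2%:R : R) (step_const D 4) n1 sc2 => x y x1 y2.
  have xx : x <= x ^+ 2 by rewrite expr2 ler_peMl; lra.
  nra.
- by move=> b _ x [_].
- move=> b Ib hb.
  have h1 := single b r (mval u) _ Ib r0 (@subIsetl _ (mval u @` Eb b) [set x | c <= x <= d]).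
  by apply: packing_leS h1 => //; rewrite mul1r.
Qed.

End PackingGrowth.

(** * Dimensions from packing numbers *)

Section Spectra.
Variable R : realType.
Implicit Types (E : set R) (s t a theta r : R).

Lemma powR_le_self (r a : R) : 0 < r <= 1 -> 1 <= a -> r `^ a <= r.
Proof. by move=> /andP[r0 r1] a1; apply: ge1r_powR; rewrite ?r0. Qed.

(** Solve R^(-s/theta + t) = R^(a (1 - 1/theta)) for a; a ball of radius R has length 2R, whence the
    factor 2^t. *)
Lemma packing_growth_spectrum E s t theta : 0 < theta < 1 -> packing_growth E s t ->
  (assouad_spectrum_oo theta E <= ((s / theta - t) / (theta^-1 - 1))%:E)%E.
Proof.
move=> /andP[t0 t1] [C C0 hC]; have ti : 1 < theta^-1 by rewrite invf_gt1.
apply: ereal_inf_lbound; exists ((s / theta - t) / (theta^-1 - 1)) => //.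
exists (C * 2 `^ t); first by rewrite mulr_gt0 ?powR_gt0.
move=> x r Ex /andP[r0 r1].
have p0 : 0 < r `^ theta^-1 by rewrite powR_gt0.
have p1 : r `^ theta^-1 <= r by apply: powR_le_self; rewrite ?r0 ?r1 ?ltW.
have := hC (r `^ theta^-1) (2 * r) (x - r) (x + r).
rewrite p0 (le_trans p1 r1) => /(_ isT) H.
apply: covering_number_le => //.
have -> : C * 2 `^ t * r `^ ((s / theta - t) / (theta^-1 - 1) * (1 - theta^-1)) =
    C * (r `^ theta^-1 `^ (- s) * (2 * r) `^ t).
  have -> : (s / theta - t) / (theta^-1 - 1) * (1 - theta^-1) = theta^-1 * (- s) + t.
    by field; rewrite (gt_eqF t0) /=; lra.
  by rewrite powRD ?(gt_eqF r0) ?implybT// powRrM powRM ?(ltW r0)//; ring.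
apply: packing_leS (H _ _) => //; try lra.
move=> y []; rewrite /ball /= ltr_distl => /andP[? ?] Ey; split=> //.
by apply/andP; split; lra.
Qed.

Lemma packing_growth1 E : packing_growth E 1 1.
Proof.
exists 2 => // r ell c d /andP[r0 r1] rl dc.
have l0 : 0 < ell by lra.
apply: (@packing_leS _ r r _ (E `&` [set x | c <= x <= d]) _ (ell / r + 1)) => //.
  rewrite powR_inv1 ?(ltW r0)// powRr1 ?(ltW l0)// [r^-1 * _]mulrC.
  have : 1 <= ell / r by rewrite ler_pdivlMr ?mul1r.
  lra.
apply: packing_le_diam => // [|x y [_ /andP[? ?]] [_ /andP[? ?]]]; first exact: ltW.
by rewrite ler_norml; apply/andP; split; lra.
Qed.

Lemma spectrum_oo_le1 E theta : 0 < theta < 1 -> (assouad_spectrum_oo theta E <= 1)%E.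
Proof.
move=> /andP[t0 t1]; apply: le_trans (packing_growth_spectrum _ (packing_growth1 E)) _.
  by rewrite t0.
have ti : 1 < theta^-1 by rewrite invf_gt1.
by rewrite mul1r divff// gt_eqF// subr_gt0.
Qed.

Lemma spectrum_oo_ge E theta (x : R) :
  (forall a C, 0 < C -> (forall y r, E y -> 0 < r <= 1 ->
     (covering_number (r `^ theta^-1) (ball y r `&` E) <=
        (C * r `^ (a * (1 - theta^-1)))%:E)%E) -> x <= a) ->
  (x%:E <= assouad_spectrum_oo theta E)%E.
Proof.
move=> H; apply: le_ereal_inf_tmp => _ [a [C C0 hC] <-]; rewrite lee_fin.
exact: H C0 hC.
Qed.

Lemma neg_ln_gt0 r : 0 < r < 1 -> 0 < - ln r.
Proof. by move=> /andP[r0 r1]; rewrite oppr_gt0 ln_lt0// r0. Qed.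

Lemma upper_box_dim_le E s (r0 : R) : 0 < r0 ->
  (forall r, 0 < r < r0 -> (covering_number r E <= (r `^ (- s))%:E)%E) ->
  (upper_box_dim E <= s%:E)%E.
Proof.
move=> r00 H; pose V := [set r : R | 0 < r < Num.min r0 1].
apply: (@le_trans _ _ (ereal_sup
   [set (lne (covering_number r E) * ((- ln r)^-1)%:E)%E | r in V])).
  apply: ereal_inf_lbound; exists V => //.
  exists (Num.min r0 1); first by rewrite /= lt_min r00 ltr01.
  move=> r /=; rewrite sub0r normrN => + rp; rewrite gtr0_norm// => rlt.
  by rewrite /V /= rp.
apply: ge_ereal_sup => _ [r /andP[rp rm] <-]; move: rm; rewrite lt_min => /andP[rr0 r1].
have l0 : 0 < - ln r by apply: neg_ln_gt0; rewrite rp.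
have rr : 0 < r < r0 by rewrite rp.
have cov := H r rr.
have -> : s%:E = ((ln (r `^ (- s)))%:E * ((- ln r)^-1)%:E)%E.
  by rewrite ln_powR -EFinM; congr EFin; field; rewrite -oppr_eq0 gt_eqF.
apply: lee_wpmul2r; first by rewrite lee_fin invr_ge0 ltW.
have p0 : 0 < r `^ (- s) by rewrite powR_gt0.
rewrite -lne_EFin// lee_lne// in_itv /= ?leey ?andbT.
  apply: le_ereal_inf_tmp => _ [n _ <-]; by rewrite lee_fin.
by rewrite lee_fin ltW.
Qed.

Lemma upper_box_dim_ge E s (r0 : R) : 0 < r0 ->
  (forall r, 0 < r < r0 -> ((r `^ (- s))%:E <= covering_number r E)%E) ->
  (s%:E <= upper_box_dim E)%E.
Proof.
move=> r00 H; apply: le_ereal_inf_tmp => _ [V [e /= e0 hV] <-].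
pose r := Num.min (e / 2) (Num.min (r0 / 2) 2^-1).
have rp : 0 < r by rewrite !lt_min invr_gt0 !divr_gt0 ?ltr0n.
have re : r <= e / 2 by rewrite ge_min lexx.
have rr0 : r <= r0 / 2 by rewrite !ge_min lexx orbT.
have r1 : r <= 2^-1 by rewrite !ge_min lexx !orbT.
have l0 : 0 < - ln r by apply: neg_ln_gt0; rewrite rp; lra.
apply: le_trans (ereal_sup_ubound _); last first.
  exists r; last by [].
  by apply: hV => //=; rewrite sub0r normrN gtr0_norm//; lra.
have rr : 0 < r < r0 by rewrite rp; lra.
have cov := H r rr.
have -> : s%:E = ((ln (r `^ (- s)))%:E * ((- ln r)^-1)%:E)%E.
  by rewrite ln_powR -EFinM; congr EFin; field; rewrite -oppr_eq0 gt_eqF.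
apply: lee_wpmul2r; first by rewrite lee_fin invr_ge0 ltW.
have p0 : 0 < r `^ (- s) by rewrite powR_gt0.
rewrite -lne_EFin// lee_lne// in_itv /= ?leey ?andbT.
  by rewrite lee_fin ltW.
by apply: le_trans cov; rewrite lee_fin ltW.
Qed.

Lemma small_power (C e : R) : 0 < C -> 0 < e ->
  exists2 r0 : R, 0 < r0 <= 1 & forall r, 0 < r < r0 -> C * r `^ e <= 1.
Proof.
move=> C0 e0; exists (Num.min 1 (C^-1 `^ e^-1)).
  by rewrite lt_min ltr01 ge_min lexx powR_gt0// invr_gt0.
move=> r /andP[r0]; rewrite lt_min => /andP[r1 rC].
rewrite mulrC -ler_pdivlMr// div1r.
apply: le_trans (ge0_ler_powR (ltW e0) _ _ (ltW rC)) _; rewrite ?nnegrE ?(ltW r0) ?powR_ge0//.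
by rewrite -powRrM mulVf ?gt_eqF// powRr1// invr_ge0 ltW.
Qed.

Lemma packing_growth_box E s t s' : E `<=` [set x | 0 <= x <= 1] -> s < s' ->
  packing_growth E s t -> (upper_box_dim E <= s'%:E)%E.
Proof.
move=> E01 ss [C C0 hC].
have [r0 /andP[r00 r01] hr0] := small_power C0 (ltac:(lra) : 0 < s' - s).
apply: upper_box_dim_le r00 _ => r /andP[rp rr0].
apply: covering_number_le => //.
apply: packing_leS (hC r 1 0 1 _ _ _) => //; try lra.
- by move=> x Ex; split => //; exact: E01.
- rewrite powR1 mulr1 -[leRHS]mul1r -ler_pdivrMr ?powR_gt0// -mulrA -powRN -powRD ?(gt_eqF rp) ?implybT//.
  have -> : - s + - - s' = s' - s by ring.
  by apply: hr0; rewrite rp.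
Qed.

(* Contrapositive of: few balls of radius r along a sequence r -> 0 bound the
   Hausdorff dimension from above. *)
Lemma packing_ge_of_hausdorff E (h s : R) : E !=set0 -> hausdorff_dim E = h%:E -> s < h ->
  exists2 r0 : R, 0 < r0 <= 1 & forall r, 0 < r < r0 ->
    exists l : seq R, [/\ spaced r l, {in l, forall x, E x} & r `^ (- s) <= (size l)%:R].
Proof.
move=> [x0 Ex0] hE sh; have [s0|s0] := ltP s 0.
  exists 1; first by rewrite ltr01 lexx.
  move=> r /andP[r0 r1]; exists [:: x0]; split => //.
    by move=> x; rewrite inE => /eqP->.
  by rewrite /= -(powRr0 r) ger_powR ?r0 ?(ltW r1)//; lra.
apply: contrapT => H.
have : (hausdorff_dim E <= ((s + h) / 2)%:E)%E.
  apply: (@hausdorff_dim_le R s) => //; first by lra.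
  move=> r0 r00; apply: contrapT => nr; apply: H.
  exists (Num.min r0 1); first by rewrite lt_min r00 ltr01 ge_min lexx orbT.
  move=> r /andP[rp]; rewrite lt_min => /andP[rr0 r1].
  apply: contrapT => nl; apply: nr.
  have : packing_le r E (r `^ (- s)).
    move=> l hl lE; rewrite leNgt; apply/negP => big; apply: nl; exists l.
    by split => //; exact: ltW.
  move=> /(packing_le_ball_cover rp)[l [sl _ cov]].
  by exists r, l; rewrite rp rr0.
by rewrite hE lee_fin; lra.
Qed.

End Spectra.

(** * Lower bounds *)

Section LowerBounds.
Variable R : realType.
Implicit Types (E : set R) (s a theta r : R).

Lemma spaced_flatten (T : eqType) (lb : T -> seq R) (d : R) (J : seq T) : uniq J ->
  {in J, forall i, spaced d (lb i)} ->
  {in J &, forall i j, i != j -> forall x y, x \in lb i -> y \in lb j -> d <= `|x - y|} ->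
  spaced d (flatten (map lb J)).
Proof.
elim: J => //= i J IH /andP[iJ uJ] h1 h2.
rewrite /spaced pairwise_cat; apply/and3P; split.
- apply/allrelP => x y xi /flatten_mapP[j jJ yj].
  apply: (h2 i j) => //; rewrite ?mem_head ?inE ?jJ ?orbT//.
  by apply: contraNneq iJ => ->.
- by apply: h1; rewrite mem_head.
- apply: IH => //; first by move=> j jJ; apply: h1; rewrite inE jJ orbT.
  by move=> j k jJ kJ; apply: h2; rewrite inE ?jJ ?kJ orbT.
Qed.

Lemma size_flatten_const (T : eqType) (lb : T -> seq R) n (J : seq T) :
  {in J, forall i, size (lb i) = n} -> size (flatten (map lb J)) = (size J * n)%N.
Proof.
elim: J => //= i J IH h; rewrite size_cat IH ?(h i) ?mem_head ?mulSn//.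
by move=> j jJ; apply: h; rewrite inE jJ orbT.
Qed.

Lemma inv_block_width (X y : R) : 1 <= X -> 1 <= y <= X ->
  X^-1 - (X + y + 1)^-1 < 4 * (y / X ^+ 2).
Proof.
move=> X1 /andP[y1 yX]; have X0 : 0 < X by lra.
have p : 0 < X + y + 1 by lra.
have -> : X^-1 - (X + y + 1)^-1 = (y + 1) / (X * (X + y + 1)) by field; rewrite !gt_eqF.
rewrite mulrA ltr_pdivlMr ?exprn_gt0// mulrAC ltr_pdivrMr ?mulr_gt0// expr2.
have h1 : (y + 1) * (X * X) <= 2 * y * (X * X) by rewrite ler_wpM2r ?mulr_ge0//; lra.
have h2 : 2 * y * (X * X) < 4 * y * (X * X) by rewrite ltr_pM2r ?mulr_gt0//; lra.
have h3 : 4 * y * (X * X) <= 4 * y * (X * (X + y + 1)).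
  by rewrite ler_wpM2l ?mulr_ge0 ?ler_wpM2l//; lra.
lra.
Qed.

Lemma inv_gap (X u v g e : R) : 1 <= X -> X <= u -> u + g <= v -> v <= 2 * X -> 2 <= g ->
  0 <= e -> e * (16 * X ^+ 2) <= g - 1 -> e <= (u + 1)^-1 - v^-1.
Proof.
move=> X1 Xu uv vX g2 e0 eg; have u0 : 0 < u + 1 by lra.
have v0 : 0 < v by lra.
have -> : (u + 1)^-1 - v^-1 = (v - (u + 1)) / ((u + 1) * v) by field; rewrite !gt_eqF.
rewrite ler_pdivlMr ?mulr_gt0//; apply: (@le_trans _ _ (e * (16 * X ^+ 2))); last lra.
rewrite ler_wpM2l// (_ : 16 * X ^+ 2 = (4 * X) * (4 * X)); last by ring.
by apply: ler_pM; lra.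
Qed.

(* The digits 2^k + g i, i < m, run through the k-th block with step g. *)
Lemma block_lower_bound E theta a (C alpha : R) k g m n (lb : nat -> seq R) :
  0 < theta < 1 -> 0 < alpha < 1 -> (2 <= k)%N -> (2 <= g)%N -> (0 < m)%N -> (0 < n)%N ->
  (forall i, (i < m)%N -> (g * i)%:R <= (2 ^+ k : R) `^ alpha) ->
  (forall y r, E y -> 0 < r <= 1 ->
     (covering_number (r `^ theta^-1) (ball y r `&` E) <=
        (C * r `^ (a * (1 - theta^-1)))%:E)%E) ->
  let r := 4 * (2 ^+ k : R) `^ (alpha - 2) in
  (forall i, (i < m)%N -> [/\ size (lb i) = n, spaced (2 * r `^ theta^-1) (lb i) &
     {in lb i, forall x, E x /\ cyl (2 ^ k + g * i) x}]) ->
  2 * r `^ theta^-1 * (16 * (2 ^+ k) ^+ 2) <= g%:R - 1 ->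
  (m * n)%:R <= C * r `^ (a * (1 - theta^-1)).
Proof.
move=> /andP[t0 t1] /andP[a0 a1] k2 g2 m0 n0 hm hC; set X : R := 2 ^+ k => r hlb sep.
have X4 : 4 <= X by rewrite (_ : 4 = 2 ^+ 2) ?ler_weXn2l ?ler1n//; rewrite expr2; lra.
have X0 : 0 < X by lra.
have X1 : 1 <= X by lra.
have XaX : X `^ alpha <= X by apply: ler1_powR => //; exact: ltW.
have Xa1 : 1 <= X `^ alpha by rewrite -[leLHS](powRr0 X) ler_powR// ltW.
have Xae : X `^ (alpha - 2) = X `^ alpha / X ^+ 2.
  by rewrite powRB ?powR_mulrn ?(gt_eqF X0) ?implybT// ltW.
have r0 : 0 < r by rewrite mulr_gt0 ?powR_gt0.
have r1 : r <= 1.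
  rewrite /r Xae mulrA ler_pdivrMr ?exprn_gt0// mul1r expr2.
  by apply: ler_pM => //; exact: powR_ge0.
have bX i : (i < m)%N -> X <= (2 ^ k + g * i)%:R <= X + X `^ alpha.
  by move=> im; rewrite natrD natrX -/X lerDl ler0n lerD2l hm.
pose ll := flatten (map lb (iota 0 m)).
have inv_le i x : (i < m)%N -> cyl (2 ^ k + g * i) x ->
    (X + X `^ alpha + 1)^-1 <= x <= X^-1.
  move=> im /andP[x1 x2]; have /andP[b1 b2] := bX _ im; apply/andP; split.
    apply: le_trans x1; rewrite lef_pV2 ?posrE ?ltr0n//; last by lra.
    by rewrite -natr1 lerD2r.
  by apply: le_trans x2 _; rewrite lef_pV2 ?posrE//; apply: lt_le_trans b1.
have lE x : x \in ll -> exists2 i, (i < m)%N & x \in lb i.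
  by move=> /flatten_mapP[i]; rewrite mem_iota add0n => im xi; exists i.
have [x0 x0l] : exists x0, x0 \in lb 0%N.
  have [sz _ _] := hlb 0%N m0; case: (lb 0%N) sz => [|x0 l] e; first by rewrite -e in n0.
  by exists x0; rewrite mem_head.
have [_ _ /(_ _ x0l)[Ex0 cx0]] := hlb 0%N m0.
(* By [inv_block_width] the radius r exceeds the diameter of the block, so the ball about any of its
   points, here [x0], contains all of them. *)
have diamB x y i j : (i < m)%N -> (j < m)%N -> cyl (2 ^ k + g * i) x ->
    cyl (2 ^ k + g * j) y -> `|x - y| < r.
  move=> im jm /(inv_le _ _ im)/andP[? ?] /(inv_le _ _ jm)/andP[? ?].
  have Xa : 1 <= X `^ alpha <= X by rewrite Xa1.
  rewrite /r Xae; apply: le_lt_trans (inv_block_width X1 Xa).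
  by rewrite ler_norml; apply/andP; split; lra.
have := @covering_number_ge R (r `^ theta^-1) (ball x0 r `&` E) ll.
have sll : spaced (2 * r `^ theta^-1) ll.
  apply: spaced_flatten; first exact: iota_uniq.
    by move=> i; rewrite mem_iota add0n => im; have [] := hlb i im.
  move=> i j; rewrite !mem_iota !add0n => im jm ij x y.
  wlog lt : i j x y im jm ij / (i < j)%N.
    move=> H xi yj; have [lt|lt|e] := ltngtP i j; first exact: (H i j).
      by rewrite distrC; apply: (H j i) => //; rewrite eq_sym.
    by rewrite e eqxx in ij.
  move=> xi yj; have [_ _ /(_ _ xi)[_ /andP[x1 _]]] := hlb i im.
  have [_ _ /(_ _ yj)[_ /andP[_ y2]]] := hlb j jm.
  have /andP[bi1 bi2] := bX _ im; have /andP[bj1 bj2] := bX _ jm.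
  have gap : (2 ^ k + g * i)%:R + g%:R <= (2 ^ k + g * j)%:R :> R.
    by rewrite -natrD ler_nat -addnA leq_add2l addnC -mulnS leq_mul2l lt orbT.
  rewrite -natr1 in x1.
  move: ((2 ^ k + g * i)%:R : R) ((2 ^ k + g * j)%:R : R) x1 y2 bi1 bi2 bj1 bj2 gap
    => u v x1 y2 bi1 bi2 bj1 bj2 gap.
  have g1 : 2 <= g%:R :> R by rewrite ler_nat.
  apply: le_trans (ler_norm _); apply: (@le_trans _ _ ((u + 1)^-1 - v^-1)); last exact: lerB.
  apply: inv_gap X1 bi1 gap _ g1 _ sep; last by rewrite mulr_ge0 ?powR_ge0.
  by apply: le_trans bj2 _; rewrite mulr_natl mulr2n lerD2l.
have ballE : {in ll, forall x, (ball x0 r `&` E) x}.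
  move=> x /lE[i im xi]; have [_ _ /(_ _ xi)[Ex cx]] := hlb i im; split => //.
  exact: (diamB _ _ 0%N i).
move=> /(_ sll ballE (powR_gt0 _ r0)) h.
have := le_trans h (hC x0 r Ex0 (ltac:(rewrite r0 r1; exact: isT))).
rewrite lee_fin; apply: le_trans.
rewrite (@size_flatten_const _ _ n) ?size_iota//.
by move=> i; rewrite mem_iota add0n => im; have [] := hlb i im.
Qed.

Lemma block_steps (X alpha : R) (g : nat) : 0 < X -> (0 < g)%N ->
  let m := (Num.truncn (X `^ alpha / g%:R)).+1 in
  (forall i, (i < m)%N -> (g * i)%:R <= X `^ alpha) /\ X `^ alpha / g%:R <= m%:R.
Proof.
move=> X0 g0 m; have g0' : 0 < g%:R :> R by rewrite ltr0n.
have q0 : 0 <= X `^ alpha / g%:R by rewrite divr_ge0 ?powR_ge0 ?ltW.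
split; last by apply: ltW; exact: truncnS_gt.
move=> i; rewrite ltnS => im; rewrite natrM mulrC -ler_pdivlMr//.
by apply: le_trans (_ : (Num.truncn (X `^ alpha / g%:R))%:R <= _); rewrite ?ler_nat ?truncn_le.
Qed.

Lemma inv_dist_ge (a x y B : R) : 1 <= a -> 0 <= x <= 1 -> 0 <= y <= 1 -> a + 1 <= B ->
  `|x - y| <= B ^+ 2 * `|(a + x)^-1 - (a + y)^-1|.
Proof.
move=> a1 /andP[x0 x1] /andP[y0 y1] aB.
have p1 : 0 < a + x by lra.
have p2 : 0 < a + y by lra.
have -> : (a + x)^-1 - (a + y)^-1 = (y - x) / ((a + x) * (a + y)).
  by field; rewrite !gt_eqF.
rewrite normrM normfV (gtr0_norm (mulr_gt0 p1 p2)) (distrC y x) mulrA ler_pdivlMr ?mulr_gt0//.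
rewrite mulrC ler_wpM2r// expr2.
by apply: ler_pM; lra.
Qed.

Lemma natM_powR2 (k : nat) (x : R) : 2 `^ (k%:R * x) = (2 ^+ k : R) `^ x.
Proof. by rewrite powRrM powR_mulrn. Qed.

(** Now R^(1/theta) is at least of the order of the spacing X^(-2) of the block. Keeping every g-th
    digit, g of order X^2 R^(1/theta), leaves about X^alpha / g separated points, of order R^(1 -
    1/theta), as in a full interval. One point per cylinder is enough, so the lemma serves both F
    and P; digit 1 is left out because S_1 is not in the system when 1 is in I. *)
Lemma spectrum_ge1 E (I : set nat) (alpha theta : R) k0 : 0 < alpha < 1 ->
  full_blocks I alpha k0 -> (forall b, I b -> (2 <= b)%N -> exists2 x, E x & cyl b x) ->
  1 - alpha / 2 <= theta < 1 -> (1%:E <= assouad_spectrum_oo theta E)%E.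
Proof.
move=> a01 hI hE /andP[th0 th1]; have /andP[a0 a1] := a01.
have t0 : 0 < theta by lra.
have ti : 1 < theta^-1 by rewrite invf_gt1.
apply: spectrum_oo_ge => a C C0 hC.
have /choice[p hp] : forall b, exists x, I b -> (2 <= b)%N -> E x /\ cyl b x.
  move=> b; have [[Ib b2]|nb] := pselect (I b /\ (2 <= b)%N); last first.
    by exists 0 => Ib b2; exfalso; apply: nb.
  by have [x Ex cx] := hE b Ib b2; exists x.
pose e1 := (alpha - 2) * (1 - theta^-1).
have e10 : 0 < e1 by rewrite /e1; nra.
suff : e1 <= e1 * a by rewrite -[leLHS]mulr1 ler_pM2l.
pose K := 4 `^ theta^-1.
have K0 : 0 < K by rewrite powR_gt0.
apply: (@exponent_le R ((50 * K)^-1) (C * 4 `^ (a * (1 - theta^-1))) _ _ (maxn k0 2)).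
  by rewrite invr_gt0 mulr_gt0.
move=> k; rewrite geq_max => /andP[kk k2].
rewrite !natM_powR2; set X : R := 2 ^+ k.
have X1 : 1 <= X by rewrite exprn_ege1// ler1n.
have X0 : 0 < X by lra.
pose r := 4 * X `^ (alpha - 2).
have rE : r `^ theta^-1 = K * X `^ ((alpha - 2) * theta^-1).
  by rewrite /r powRM ?powR_ge0// -powRrM.
pose z := K * X `^ ((alpha - 2) * theta^-1) * X ^+ 2.
have K1 : 1 <= K by rewrite -[leLHS](powRr0 4) ler_powR ?invr_ge0 ?(ltW t0)//; lra.
(* [z] is R^(1/theta) relative to the spacing X^(-2); its exponent 2 - (2 - alpha)/theta is
   nonnegative because theta >= 1 - alpha/2. *)
have z1 : 1 <= z.
  rewrite /z -mulrA -powR_mulrn ?(ltW X0)// -powRD ?(gt_eqF X0) ?implybT//.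
  rewrite -[leLHS]mul1r; apply: ler_pM => //.
  rewrite -[leLHS](powRr0 X) ler_powR//.
  have : theta^-1 <= (1 - alpha / 2)^-1 by rewrite lef_pV2 ?posrE//; lra.
  move=> h; have h2 : (2 - alpha) * theta^-1 <= (2 - alpha) * (1 - alpha / 2)^-1.
    by rewrite ler_wpM2l//; lra.
  have h3 : (2 - alpha) * (1 - alpha / 2)^-1 = 2 by field; lra.
  by move: h2; rewrite h3; lra.
(* The separation condition asks for g - 1 >= 2 * 16 z, and z >= 1 gives g <= 34 z, below the 50 of
   the final constant. *)
pose g := (Num.truncn (32 * z)).+2.
have zz0 : 0 <= 32 * z by lra.
have g1 : 32 * z <= g%:R - 1.
  by rewrite -[g%:R]natr1 addrK; apply: ltW; exact: truncnS_gt.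
have g2 : g%:R <= 34 * z.
  have -> : g%:R = (Num.truncn (32 * z))%:R + 2 :> R by rewrite /g -addn2 natrD.
  have : (Num.truncn (32 * z))%:R <= 32 * z by rewrite truncn_le.
  lra.
have [hm mX] := block_steps alpha X0 (isT : (0 < g)%N).
set m := (Num.truncn (X `^ alpha / g%:R)).+1 in hm mX.
have := @block_lower_bound E theta a C alpha k g m 1 (fun i => [:: p (2 ^ k + g * i)%N])
  (ltac:(by rewrite t0 th1)) a01 k2 isT isT isT hm hC.
rewrite /= -/X -/r muln1 => /(_ _ _) H.
have {H} : m%:R <= C * r `^ (a * (1 - theta^-1)).
  apply: H.
    move=> i im; split => // x; rewrite inE => /eqP->.
    apply: hp; first by apply: full_blocks_digit hI kk _; exact: hm.
    by apply: leq_trans (leq_addr _ _); rewrite -{1}(expn1 2) leq_exp2l// ltnW.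
  by rewrite rE; apply: le_trans g1; rewrite /z; lra.
rewrite /r powRM ?powR_ge0// -powRrM (mulrA C) => H.
have -> : e1 * a = (alpha - 2) * (a * (1 - theta^-1)) by rewrite /e1; ring.
apply: le_trans H; apply: le_trans mX.
have g0 : 0 < g%:R :> R by rewrite ltr0n.
rewrite ler_pdivlMr//.
apply: (@le_trans _ _ ((50 * K)^-1 * X `^ e1 * (34 * z))).
  by rewrite ler_wpM2l// mulr_ge0 ?invr_ge0 ?powR_ge0// mulr_ge0// ltW.
have -> : (50 * K)^-1 * X `^ e1 * (34 * z) =
    34 / 50 * (X `^ e1 * X `^ ((alpha - 2) * theta^-1) * X ^+ 2).
  by rewrite /z; field; rewrite gt_eqF.
rewrite -powR_mulrn ?(ltW X0)// -!powRD ?(gt_eqF X0) ?implybT//.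
have -> : e1 + (alpha - 2) * theta^-1 + 2 = alpha by rewrite /e1; ring.
have : 0 < X `^ alpha by rewrite powR_gt0.
lra.
Qed.

(** Below the transition R^(1/theta) is much smaller than the cylinders, and each holds a copy of F
    seen at the relative scale d, of order R^(1/theta) 4^k, which tends to 0. Using every second
    digit leaves a whole cylinder between copies; about X^alpha / 2 copies have at least d^(-s)
    separated points each. *)
Lemma cf_spectrum_ge (I : set nat) (alpha theta h s : R) k0 : 0 < alpha < 1 ->
  I `<=` [set n | (0 < n)%N] -> full_blocks I alpha k0 -> cf_set R I !=set0 ->
  hausdorff_dim (cf_set R I) = h%:E -> 0 <= s < h -> 0 < theta < 1 - alpha / 2 ->
  (((alpha + s * ((2 - alpha) / theta - 2)) / ((2 - alpha) * (theta^-1 - 1)))%:E <=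
     assouad_spectrum_oo theta (cf_set R I))%E.
Proof.
move=> a01 hI0 hI F0 hE /andP[s0 sh] /andP[t0 tr]; have /andP[a0 a1] := a01.
have t1 : theta < 1 by lra.
have ti : 1 < theta^-1 by rewrite invf_gt1.
have [r0 /andP[r00 r01] hr0] := packing_ge_of_hausdorff F0 hE sh.
apply: spectrum_oo_ge => a C C0 hC.
have den0 : 0 < (2 - alpha) * (theta^-1 - 1) by rewrite mulr_gt0; lra.
rewrite ler_pdivrMr//.
have -> : a * ((2 - alpha) * (theta^-1 - 1)) = (alpha - 2) * (a * (1 - theta^-1)) by ring.
pose K := 4 `^ theta^-1.
have K0 : 0 < K by rewrite powR_gt0.
(* exponent of 2^k in the relative scale 32 r^(1/theta) 4^k *)
pose f := (alpha - 2) * theta^-1 + 2.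
have f0 : f < 0.
  have : (1 - alpha / 2)^-1 < theta^-1 by rewrite ltf_pV2 ?posrE//; lra.
  move=> h1; have h2 : (2 - alpha) * (1 - alpha / 2)^-1 < (2 - alpha) * theta^-1.
    by rewrite ltr_pM2l//; lra.
  have h3 : (2 - alpha) * (1 - alpha / 2)^-1 = 2 by field; lra.
  by rewrite /f; lra.
have [k1 hk1] : exists k1, forall k, (k1 <= k)%N -> 32 * K * (2 ^+ k : R) `^ f < r0.
  have /andP[x0 x1] : 0 < (2 : R) `^ f < 1 by apply: powR_lt1 => //; lra.
  have [||k1 hk1] := @geometric_small R (2 `^ f) (r0 / (32 * K)) _ _.
  - by rewrite (ltW x0).
  - by rewrite divr_gt0 ?mulr_gt0.
  exists k1 => k /hk1; rewrite -powR_natM natM_powR2 ltr_pdivlMr ?mulr_gt0// => lt.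
  by rewrite mulrC.
have -> : alpha + s * ((2 - alpha) / theta - 2) = alpha - s * f by rewrite /f; ring.
apply: (@exponent_le R (2^-1 * (32 * K) `^ (- s)) (C * 4 `^ (a * (1 - theta^-1))) _ _
   (maxn k0 (maxn 2 k1))).
  by rewrite mulr_gt0 ?powR_gt0 ?mulr_gt0 ?invr_gt0.
move=> k; rewrite !geq_max => /and3P[kk k2 kk1].
rewrite !natM_powR2; set X : R := 2 ^+ k.
have X1 : 1 <= X by rewrite exprn_ege1// ler1n.
have X0 : 0 < X by lra.
have XaX : X `^ alpha <= X by apply: ler1_powR => //; exact: ltW.
pose r := 4 * X `^ (alpha - 2).
have rE : r `^ theta^-1 = K * X `^ ((alpha - 2) * theta^-1).
  by rewrite /r powRM ?powR_ge0// -powRrM.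
pose d := 32 * K * X `^ f.
have d0 : 0 < d by rewrite !mulr_gt0 ?powR_gt0.
have dr0 : d < r0 by exact: hk1.
have dE : 2 * r `^ theta^-1 * (16 * X ^+ 2) = d.
  rewrite rE /d /f powRD ?(gt_eqF X0) ?implybT// powR_mulrn ?(ltW X0)//; ring.
have [l [sl lF nl]] := hr0 d (ltac:(by rewrite d0 dr0)).
have [hm mX] := block_steps alpha X0 (isT : (0 < 2)%N).
set m := (Num.truncn (X `^ alpha / 2%:R)).+1 in hm mX.
have n0 : (0 < size l)%N.
  by rewrite -(ltr0n R); apply: lt_le_trans nl; rewrite powR_gt0.
have := @block_lower_bound (cf_set R I) theta a C alpha k 2 m (size l)
  (fun i => [seq ((2 ^ k + 2 * i)%:R + z)^-1 | z <- l])
  (ltac:(by rewrite t0 t1)) a01 k2 isT isT n0 hm hC.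
rewrite /= -/X -/r => /(_ _ _) H.
have {H} : (m * size l)%:R <= C * r `^ (a * (1 - theta^-1)).
  apply: H => [i im|]; last first.
    rewrite dE (_ : 2%:R - 1 = 1) ?(ltW (lt_le_trans dr0 r01))//; ring.
  have bI : I (2 ^ k + 2 * i)%N by apply: full_blocks_digit hI kk _; exact: hm.
  have b0 := hI0 _ bI; split; first by rewrite size_map.
  - rewrite /spaced pairwise_map.
    have lz z : z \in l -> 0 <= z <= 1 by move=> /lF/cf_set_in01.
    have /sub_in_pairwise : {in l &, forall x y, d <= `|x - y| -> 2 * r `^ theta^-1 <=
       `|((2 ^ k + 2 * i)%:R + x)^-1 - ((2 ^ k + 2 * i)%:R + y)^-1|}.
      move=> x y /lz x01 /lz y01 dxy.
      have b1 : 1 <= (2 ^ k + 2 * i)%:R :> R by rewrite ler1n.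
      have four_le (x' y' w : R) : 1 <= x' -> y' <= x' -> w <= y' -> x' + w + 1 <= 4 * x'.
        by move: x' y' w; clear -R => *; lra.
      have bX : (2 ^ k + 2 * i)%:R + 1 <= 4 * X.
        by rewrite natrD natrX; exact: four_le X1 XaX (hm _ im).
      have := le_trans dxy (inv_dist_ge b1 x01 y01 bX).
      rewrite -dE exprMn (_ : 4 ^+ 2 = 16); last by rewrite expr2; ring.
      by rewrite [leRHS]mulrC ler_pM2r// mulr_gt0// exprn_gt0.
    by move=> /(_ l); apply => //; apply/allP.
  - move=> _ /mapP[z zl ->]; split; first exact: cf_set_cons (lF _ zl).
    by apply: cyl_inv => //; apply: cf_set_in01 (lF _ zl).
rewrite /r powRM ?powR_ge0// -powRrM (mulrA C) => H.
apply: le_trans H; rewrite natrM.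
have -> : 2^-1 * (32 * K) `^ (- s) * X `^ (alpha - s * f) = (X `^ alpha / 2) * d `^ (- s).
  have -> : d `^ (- s) = (32 * K) `^ (- s) * X `^ (f * - s).
    by rewrite /d (@powRM _ (32 * K)) ?powR_ge0// ?mulr_ge0 ?(ltW K0)// -powRrM.
  have -> : alpha - s * f = alpha + f * - s by ring.
  rewrite powRD ?(gt_eqF X0) ?implybT//.
  move: ((32 * K) `^ (- s)) (X `^ alpha) (X `^ (f * - s)) => x y z.
  by ring.
by apply: ler_pM => //; rewrite ?divr_ge0 ?powR_ge0.
Qed.

End LowerBounds.

(** * The limit set and the selections *)

Section Assembly.
Variable R : realType.
Implicit Types (E P : set R) (theta : R).

Lemma quasi_assouad_eq1 E (rho : R) : rho < 1 ->
  (forall theta, rho <= theta < 1 -> assouad_spectrum_oo theta E = 1%E) ->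
  quasi_assouad_dim E = 1%E.
Proof.
move=> r1 H; apply: cvg_lim => //; apply: cvg_near_cst.
near=> theta; apply: H; apply/andP; split; near: theta.
  exact: nbhs_left_ge.
exact: nbhs_left_lt.
Unshelve. all: by end_near. Qed.

Lemma phase_transition_eq E (rho : R) : 0 < rho < 1 ->
  (forall theta, rho <= theta < 1 -> assouad_spectrum_oo theta E = 1%E) ->
  (forall theta, 0 <= theta < rho -> (assouad_spectrum theta E < 1)%E) ->
  phase_transition E = rho.
Proof.
move=> /andP[r0 r1] H1 H2; have q1 := quasi_assouad_eq1 r1 H1.
rewrite /phase_transition q1; set A := [set theta | _].
have Ar : A rho.
  split; first by apply/andP; split; apply: ltW.
  rewrite /assouad_spectrum gt_eqF// lt_eqF// H1//.
  by rewrite lexx.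
have lA : lbound A rho.
  move=> theta [/andP[t0 _] e]; rewrite leNgt; apply/negP => tr.
  by have := H2 theta; rewrite t0 tr e ltxx => /(_ isT).
apply/eqP; rewrite eq_le; apply/andP; split.
  by apply: ge_inf => //; exists rho.
by apply: lb_le_inf => //; exists rho.
Qed.

Lemma lee_limit (x : R) (y : \bar R) :
  (forall e, 0 < e -> ((x - e)%:E <= y)%E) -> (x%:E <= y)%E.
Proof.
by move=> H; apply/lee_addgt0Pr => e e0; rewrite -leeBlDr// -EFinB H.
Qed.

Lemma hausdorff_dim_of_packing E (C s s' : R) : 0 <= s -> s < s' -> 0 < C ->
  (forall r, 0 < r <= 1 -> packing_le r E (C * r `^ (- s))) ->
  (hausdorff_dim E <= s'%:E)%E.
Proof.
move=> s0 ss C0 hC; pose s2 := (s + s') / 2.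
have [r1 /andP[r10 r11] hr1] := small_power C0 (ltac:(rewrite /s2; lra) : 0 < s2 - s).
apply: (@hausdorff_dim_le R s2); [rewrite /s2; lra|rewrite /s2; lra|].
move=> r0 r00; pose r := Num.min r0 r1 / 2.
have m0 : 0 < Num.min r0 r1 by rewrite lt_min r00.
have mr0 : Num.min r0 r1 <= r0 by rewrite ge_min lexx.
have mr1 : Num.min r0 r1 <= r1 by rewrite ge_min lexx orbT.
have rp : 0 < r by rewrite /r; lra.
have r01 : 0 < r <= 1 by rewrite rp /r; lra.
have [l [sl _ cov]] := packing_le_ball_cover rp (hC r r01).
exists r, l; split => //; first by rewrite rp /r; lra.
apply: le_trans sl _.
rewrite -[leRHS]mul1r -ler_pdivrMr ?powR_gt0// -mulrA -powRN -powRD ?(gt_eqF rp) ?implybT//.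
have -> : - s + - - s2 = s2 - s by ring.
by apply: hr1; rewrite rp /r; lra.
Qed.

(** * Dimensions of the limit set *)

Section LimitSet.
Variables (alpha : R) (I : set nat) (D : R) (k0 : nat).
Hypotheses (a01 : 0 < alpha < 1) (D1 : 1 <= D) (hD : sparse_blocks I alpha D).
Hypothesis hk0 : full_blocks I alpha k0.

Let F := cf_set R I.
Let rho := 1 - alpha / 2.

Lemma digits_pos : I `<=` [set n | (0 < n)%N].
Proof. by move=> b /hD[]. Qed.

Lemma cf_set_nonempty : F !=set0.
Proof.
have I0 : I (2 ^ k0 + 0)%N by apply: full_blocks_digit hk0 (leqnn _) _; exact: powR_ge0.
have [v hv] := @cf_set_points R I (fun=> (2 ^ k0 + 0)%N) digits_pos (fun=> I0).
by exists (v 0%N); case: (hv 0%N).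
Qed.

Lemma cf_set_cyl b : I b -> exists2 x, F x & cyl b x.
Proof.
move=> Ib; have [z Fz] := cf_set_nonempty.
exists (b%:R + z)^-1; first exact: cf_set_cons digits_pos Ib Fz.
by apply: cyl_inv; [exact: digits_pos|exact: cf_set_in01 Fz].
Qed.

Lemma hausdorff_dim_cf : exists h : R,
  [/\ hausdorff_dim F = h%:E, alpha / 2 <= h & h < 1].
Proof.
have /andP[a0 a1] := a01.
have [d d0 nId] := sparse_blocks_missing a1 hD.
have [s1 s11 hs1] := @psum_bounded_near1 R I d d0 nId.
(* The maximum keeps s above alpha/2, as [packing_cf_le] requires. *)
pose s := Num.max s1 ((alpha / 2 + 1) / 2).
have sa : (alpha / 2 + 1) / 2 <= s by rewrite le_max lexx orbT.
have ss1 : s1 <= s by rewrite le_max lexx.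
have slt : s < 1 by rewrite gt_max s11; lra.
have [C C0 hC] := packing_cf_le a01 D1 hD (ltac:(lra) : alpha / 2 < s < 1)
   (hs1 s (ltac:(by rewrite ss1 slt))).
have le : (hausdorff_dim F <= ((s + 1) / 2)%:E)%E.
  by apply: hausdorff_dim_of_packing C0 hC; lra.
have ge : (0 <= hausdorff_dim F)%E.
  by apply: le_ereal_inf_tmp => _ [x [x0 _] <-]; rewrite lee_fin.
exists (fine (hausdorff_dim F)).
have fin : hausdorff_dim F = (fine (hausdorff_dim F))%:E.
  rewrite fineK// ge0_fin_numE//; apply: le_lt_trans le _; exact: ltry.
move: fin ge le; move: (fine _) => h hE; rewrite hE !lee_fin => h0 h1; split => //.
  rewrite leNgt; apply/negP => ha; pose s2 := (h + alpha / 2) / 2.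
  have : psum_bounded I s2.
    apply: psum_bounded_hausdorff digits_pos _ _; first by rewrite /s2; lra.
    by rewrite hE lte_fin /s2; lra.
  move=> /(psum_bounded_exponent hk0 a1); rewrite /s2 => H.
  have : alpha <= 2 * ((h + alpha / 2) / 2) by apply: H; lra.
  lra.
lra.
Qed.

Variable h : R.
Hypotheses (hE : hausdorff_dim F = h%:E) (ha : alpha / 2 <= h) (h1 : h < 1).

Lemma cf_growth (s e : R) : h < s < 1 -> 0 < e -> packing_growth F (s + e) (expo_t alpha s).
Proof.
move=> /andP[hs s1] e0; have /andP[a0 a1] := a01; have ha' := ha.
apply: cf_packing_growth a01 D1 hD _ _ e0; first by apply/andP; split; lra.
by apply: psum_bounded_hausdorff digits_pos (ltW s1) _; rewrite hE lte_fin.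
Qed.

Lemma cf_upper_box : upper_box_dim F = h%:E.
Proof.
have /andP[a0 a1] := a01; have ha' := ha; have h1' := h1.
apply/eqP; rewrite eq_le; apply/andP; split.
  apply/lee_addgt0Pr => e e0; pose e1 := Num.min (e / 3) ((1 - h) / 2).
  have e10 : 0 < e1 by rewrite lt_min; apply/andP; split; lra.
  have e1e : e1 <= e / 3 by rewrite ge_min lexx.
  have e1h : e1 <= (1 - h) / 2 by rewrite ge_min lexx orbT.
  have g := cf_growth (ltac:(lra) : h < h + e1 < 1) e10.
  rewrite -EFinD; apply: packing_growth_box g; last by lra.
  by move=> x; exact: cf_set_in01.
apply: lee_limit => e e0; pose s := h - e / 2.
have [r0 /andP[r00 r01] hr0] := packing_ge_of_hausdorff cf_set_nonempty hE
   (ltac:(rewrite /s; lra) : s < h).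
have [r1 /andP[r10 r11] hr1] := small_power (powR_gt0 s (ltr0n R 2)) (ltac:(lra) : 0 < e / 2).
apply: (@upper_box_dim_ge R _ _ (Num.min (r0 / 2) r1)).
  by rewrite lt_min r10 divr_gt0.
move=> r /andP[rp]; rewrite lt_min => /andP[rr0 rr1].
have [l [sl lF nl]] := hr0 (2 * r) (ltac:(lra) : 0 < 2 * r < r0).
apply: le_trans (covering_number_ge sl lF rp); rewrite lee_fin; apply: le_trans nl.
rewrite powRM ?(ltW rp)// !powRN -invfM lef_pV2 ?posrE ?mulr_gt0 ?powR_gt0//.
have := hr1 r (ltac:(by rewrite rp rr1)).
have -> : e / 2 = s - (h - e) by rewrite /s; field.
rewrite powRB ?(gt_eqF rp) ?implybT// mulrA ler_pdivrMr ?powR_gt0// mul1r.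
exact.
Qed.

Definition spectrum_value theta := h + alpha * theta / ((1 - theta) * (2 - alpha)) * (1 - h).

Lemma cf_spectrum_eq theta : 0 < theta < rho ->
  assouad_spectrum_oo theta F = (spectrum_value theta)%:E.
Proof.
move=> /andP[t0]; rewrite /rho => tr; have /andP[a0 a1] := a01; have ha' := ha; have h1' := h1.
have t1 : theta < 1 by lra.
have ti : 1 < theta^-1 by rewrite invf_gt1.
have r0 : 0 < 1 - alpha / 2 by lra.
have den : 0 < theta^-1 - 1 by lra.
(* The common slope in s of the upper bound ([e1]) and the lower bound ([e2]). It lies in [0, 1], so
   letting s tend to h from either side closes the gap. *)
pose kappa := (theta^-1 - (1 - alpha / 2)^-1) / (theta^-1 - 1).
have k01 : 0 <= kappa <= 1.
  have h2 : (1 - alpha / 2)^-1 <= theta^-1 by rewrite lef_pV2 ?posrE//; lra.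
  have h3 : 1 <= (1 - alpha / 2)^-1 by rewrite -[leLHS]invr1 lef_pV2 ?posrE//; lra.
  by rewrite /kappa divr_ge0/= ?ler_pdivrMr//; lra.
have /andP[k0' k1] := k01.
have nz : [/\ theta != 0, 1 - theta != 0, 2 - alpha != 0 & 1 - alpha / 2 != 0].
  by split; rewrite gt_eqF//; lra.
have [z1 z2 z3 z4] := nz.
have z5 : theta^-1 - 1 != 0 by rewrite gt_eqF.
have e1 s e : ((s + e) / theta - expo_t alpha s) / (theta^-1 - 1) =
    spectrum_value theta + (s - h) * kappa + e / (1 - theta).
  rewrite /expo_t /spectrum_value /kappa; field.
  by rewrite z1 z2 z3.
have e2 s : (alpha + s * ((2 - alpha) / theta - 2)) / ((2 - alpha) * (theta^-1 - 1)) =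
    spectrum_value theta + (s - h) * kappa.
  rewrite /spectrum_value /kappa; field.
  by rewrite mulN1r z1 z2 z3.
apply/eqP; rewrite eq_le; apply/andP; split.
  apply/lee_addgt0Pr => e e0; pose x := Num.min (e / 2) ((1 - h) / 2).
  have x0 : 0 < x by rewrite lt_min; apply/andP; split; lra.
  have xe : x <= e / 2 by rewrite ge_min lexx.
  have xh : x <= (1 - h) / 2 by rewrite ge_min lexx orbT.
  have y0 : 0 < e * (1 - theta) / 2 by rewrite !mulr_gt0 ?invr_gt0//; lra.
  have g := cf_growth (ltac:(lra) : h < h + x < 1) y0.
  apply: le_trans (packing_growth_spectrum (theta := theta) _ g) _; first by rewrite t0.
  rewrite e1 -EFinD lee_fin -addrA lerD2l.
  have -> : e * (1 - theta) / 2 / (1 - theta) = e / 2 by field.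
  have : (h + x - h) * kappa <= x by rewrite addrAC subrr add0r ler_piMr// ltW.
  lra.
apply: lee_limit => e e0; pose x := Num.min e h.
have x0 : 0 < x by rewrite lt_min e0; lra.
have xe : x <= e by rewrite ge_min lexx.
have xh : x <= h by rewrite ge_min lexx orbT.
apply: le_trans (cf_spectrum_ge (s := h - x) a01 digits_pos hk0 cf_set_nonempty hE _ _); last 2 first.
- by apply/andP; split; lra.
- by rewrite t0.
rewrite e2 lee_fin.
have : x * kappa <= x by rewrite ler_piMr// ltW.
have -> : (h - x - h) * kappa = - (x * kappa) by ring.
lra.
Qed.

End LimitSet.

(** * Sets with one point per image *)

Section Selection.
Variables (alpha : R) (I : set nat) (D : R) (P : set R).
Hypotheses (a01 : 0 < alpha < 1) (D1 : 1 <= D) (hD : sparse_blocks I alpha D).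
Hypothesis hP : one_point_selection (cf_ifs R I) P.

Lemma cylE (b : nat) : (0 < b)%N ->
  cyl b = (fun x => (b%:R + x)^-1) @` [set x : R | 0 <= x <= 1].
Proof.
move=> b0; have b0' : 0 < b%:R :> R by rewrite ltr0n.
apply/seteqP; split=> [x /andP[x1 x2]|_ [x x01 <-]]; last exact: cyl_inv.
have x0 : 0 < x by apply: lt_le_trans x1; rewrite invr_gt0 ltr0n.
exists (x^-1 - b%:R); last by rewrite addrC subrK invrK.
rewrite /= subr_ge0 lerBlDr addrC natr1; apply/andP; split.
  by rewrite -[leLHS]invrK lef_pV2 ?posrE ?invr_gt0.
by rewrite -[leRHS]invrK lef_pV2 ?posrE ?invr_gt0 ?ltr0n.
Qed.

Lemma itv01E : `[0, 1]%classic = [set x : R | 0 <= x <= 1].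
Proof. by apply/seteqP; split => x; rewrite /= in_itv. Qed.

Lemma selection_cyl b : I b -> b <> 1%N -> exists! p, (P `&` cyl b) p.
Proof.
move=> Ib b1; have [b0 _] := hD Ib; rewrite (cylE b0) -itv01E.
apply: hP.2; have [I1|nI1] := pselect (I 1%N).
  by right; split => //; left; exists b.
by left; split => //; exists b.
Qed.

Lemma selection_sub x : P x -> exists2 b, I b & cyl b x.
Proof.
move=> /hP.1[S [[_ [b Ib ->]]|[_ [[b [Ib _] ->]|[b Ib ->]]]]] [y]; rewrite /= in_itv /= => y01 <-;
  exists b => //; have [b0 _] := hD Ib; apply: cyl_inv => //.
case/andP: y01 => y0 y1; rewrite invr_ge0 invf_le1; lra.
Qed.

(* Here S_1b = S_b o S_1 only reaches the left part of the cylinder of 1, but the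
   other maps meet that cylinder at most in the endpoint 1/2. *)
Lemma selection_unique b x y : I b -> P x -> cyl b x -> P y -> cyl b y -> x = y.
Proof.
move=> Ib Px cx Py cy; have [b1|b1] := eqVneq b 1%N; last first.
  have [p [_ pu]] := selection_cyl Ib (fun e => elimN eqP b1 e).
  by rewrite -(pu x)// -(pu y).
rewrite {}b1 in Ib cx cy.
pose S := fun x : R => (1%:R + (1 + x)^-1)^-1.
have inS z : P z -> cyl 1 z -> (S @` `[0, 1]) z.
  move=> /hP.1[T [[nI _]|[_ [[b' [Ib' b'1] ->]|[b' Ib' ->]]]]] [w].
  - by [].
  - rewrite /= in_itv /= => /andP[w0 w1] <- /andP[z1 _].
    have [b'0 _] := hD Ib'; have b'2 : 2 <= b'%:R :> R by rewrite ler_nat; case: (b') b'0 b'1 => [|[|n]].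
    exists 0; first by rewrite /= in_itv /= lexx ler01.
    rewrite /S addr0 invr1; congr (_^-1); move: z1.
    rewrite lef_pV2 ?posrE; [|lra|lra] => z1; lra.
  - rewrite /= in_itv /= => /andP[w0 w1] <- /andP[z1 _].
    have [e|n1] := eqVneq b' 1%N.
      by exists w; rewrite /= ?in_itv /= ?w0 ?w1// /S e.
    have [b'0 _] := hD Ib'; have b'2 : 2 <= b'%:R :> R.
      by rewrite ler_nat; move: b'0 n1; case: (b') => [|[|n]].
    clear n1; have i0 : 0 < (1 + w)^-1 by rewrite invr_gt0; lra.
    move: z1; rewrite lef_pV2 ?posrE; [|lra|lra] => z1; exfalso; lra.
have [p [_ pu]] : exists! p, (P `&` S @` `[0, 1]) p.
  by apply: hP.2; right; split => //; right; exists 1%N.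
by rewrite -(pu x) ?(pu y)//; split => //; exact: inS.
Qed.

Lemma selection_growth (s e : R) : alpha / 2 < s < 1 -> 0 < e ->
  packing_growth P (s + e) (expo_t alpha s).
Proof.
move=> s01 e0.
have -> : P = mval (mroot R) @` P.
  by apply/seteqP; split => [x Px|_ [x Px <-]]; [exists x => //|]; rewrite mval_root.
apply: selection_packing_growth a01 D1 hD s01 e0 (mvalid_root R) _ _.
  exact: selection_sub.
exact: selection_unique.
Qed.

(** For any fixed s in (alpha/2, 1) the upper bound, up to the loss e, reaches 1 only at theta = 1 -
    alpha/2; the midpoint is taken. *)
Lemma selection_spectrum_lt1 theta : 0 <= theta < 1 - alpha / 2 ->
  (assouad_spectrum theta P < 1)%E.
Proof.
move=> /andP[t0 tr]; have /andP[a0 a1] := a01.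
pose s := (alpha / 2 + 1) / 2.
have s01 : alpha / 2 < s < 1 by rewrite /s; apply/andP; split; lra.
have /andP[_ s1] := s01.
rewrite /assouad_spectrum; case: (eqVneq theta 0) => [_|tn0].
  have g := selection_growth s01 (ltac:(lra) : 0 < (1 - s) / 4).
  apply: (@le_lt_trans _ _ ((s + (1 - s) / 2)%:E)); last by rewrite lte_fin; lra.
  apply: packing_growth_box g; last by lra.
  move=> x /selection_sub[b Ib /andP[x1 x2]]; rewrite /= (le_trans _ x1) ?invr_ge0//=.
  by apply: le_trans x2 _; have [b0 _] := hD Ib; rewrite invf_le1 ?ltr0n ?ler1n.
have t0' : 0 < theta by rewrite lt_neqAle eq_sym tn0.
have t1 : theta < 1 by lra.
rewrite lt_eqF//.
(* At e = 0 the numerator falls short of 1/theta - 1 by (1 - s)(1/theta - 1/(1 - alpha/2)); this e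
   uses up half of that. *)
pose e := (1 - s) * (1 - theta / (1 - alpha / 2)) / 2.
have r0 : 0 < 1 - alpha / 2 by lra.
have q1 : theta / (1 - alpha / 2) < 1 by rewrite ltr_pdivrMr// mul1r.
have e0 : 0 < e by apply: divr_gt0 => //; apply: mulr_gt0; lra.
have g := selection_growth s01 e0.
apply: le_lt_trans (packing_growth_spectrum (theta := theta) _ g) _.
  by rewrite t0'.
have ti : 1 < theta^-1 by rewrite invf_gt1.
rewrite lte_fin ltr_pdivrMr ?mul1r; last by lra.
have -> : (s + e) / theta - expo_t alpha s = theta^-1 - 1 - e / theta.
  rewrite /e /expo_t; field; rewrite tn0 /=; lra.
have p : 0 < e / theta by rewrite divr_gt0.
lra.
Qed.

End Selection.

End Assembly.

Theorem proposition6p4 (R : realType) (alpha : R) (I : set nat) (P : set R)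
  (halpha : 0 < alpha < 1)
  (hI : I `<=` [set n | (1 <= n)%N])
  (hIalpha : finite_set (I `+` dyadic_blocks alpha))
  (hP : one_point_selection (cf_ifs R I) P) :
  let F := cf_set R I in
  let h := hausdorff_dim F in
  let rho := 1 - alpha / 2 in
  [/\ phase_transition F = rho,
      phase_transition P = rho,
      forall theta : R, 0 <= theta < rho ->
        assouad_spectrum theta F =
          (h + (alpha * theta / ((1 - theta) * (2 - alpha)))%:E * (1 - h))%E
    & forall theta : R, rho <= theta < 1 -> assouad_spectrum theta F = 1%E].
Proof.
move=> F h rho; have /andP[a0 a1] := halpha.
have [[D D1 hD] [k0 hk0]] := dyadic_blocks_split halpha hI hIalpha.
have [h0 [hE hlo hlt]] := hausdorff_dim_cf halpha D1 hD hk0.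
have rho01 : 0 < rho < 1 by rewrite /rho; apply/andP; split; lra.
have /andP[rho0 rho1] := rho01.
have above E theta : (forall b, I b -> (2 <= b)%N -> exists2 x, E x & cyl b x) ->
    rho <= theta < 1 -> assouad_spectrum_oo theta E = 1%E.
  move=> hE' rt; apply/eqP; rewrite eq_le (spectrum_ge1 halpha hk0 hE' rt) andbT.
  by apply: spectrum_oo_le1; case/andP: rt => ? ->; rewrite andbT; lra.
have Fcyl b : I b -> (2 <= b)%N -> exists2 x, F x & cyl b x.
  by move=> Ib _; exact: cf_set_cyl hD hk0 b Ib.
have Pcyl b : I b -> (2 <= b)%N -> exists2 x, P x & cyl b x.
  move=> Ib b2; have [|p [[Pp cp] _]] := selection_cyl hD hP Ib.
    by move=> b1; rewrite b1 in b2.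
  by exists p.
have value theta : 0 <= theta < rho ->
    assouad_spectrum theta F = (spectrum_value alpha h0 theta)%:E.
  move=> /andP[t0 tr]; rewrite /assouad_spectrum; case: (eqVneq theta 0) => [->|tn0].
    rewrite (cf_upper_box halpha D1 hD hk0 hE hlo hlt) /spectrum_value.
    by rewrite mulr0 mul0r mul0r addr0.
  have t1 : theta < 1 by rewrite (lt_trans tr).
  rewrite (lt_eqF t1) (cf_spectrum_eq halpha D1 hD hk0 hE hlo hlt)//.
  by rewrite lt_neqAle eq_sym tn0 t0.
split.
- apply: phase_transition_eq => // [theta|theta t]; first exact: above.
  have /andP[t0 tr] := t.
  rewrite value// lte_fin /spectrum_value.
  have den : 0 < (1 - theta) * (2 - alpha) by rewrite mulr_gt0//; lra.
  (* Cleared of denominators, this is 2 theta < 2 - alpha. *)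
  have q1 : alpha * theta / ((1 - theta) * (2 - alpha)) < 1.
    by rewrite ltr_pdivrMr// mul1r; move: tr; rewrite /rho; nra.
  have : alpha * theta / ((1 - theta) * (2 - alpha)) * (1 - h0) < 1 * (1 - h0).
    by rewrite ltr_pM2r//; lra.
  lra.
- apply: phase_transition_eq => // theta; first exact: above.
  exact: selection_spectrum_lt1 halpha D1 hD hP theta.
- by move=> theta t; rewrite value// /h hE /spectrum_value EFinD EFinM EFinB.
- move=> theta rt; have /andP[t0 t1] := rt; rewrite /assouad_spectrum.
  have tp : 0 < theta by exact: lt_le_trans t0.
  by rewrite gt_eqF// lt_eqF// above.
Qed.
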